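(* Let $\mathfrak p=(p,q)\in\mathbb Z_+^2$ be given. There exists a constant $C=C_{\mathfrak p}>0$ such that: (1) If $V$ is $\mathfrak p$-periodic and $\|V\|_\infty\le C$, then $\sigma(H_V)$ has at most two connected components. (2) If at least one of $p$ or $q$ is odd, then $\sigma(H_V)$ is a single (closed) interval whenever $V$ is $\mathfrak p$-periodic and $\|V\|_\infty\le C$.
   Context: For a bounded real-valued function $V:\mathbb Z^2\to\mathbb R$, $H_V=\Delta+V$ is the bounded self-adjoint operator on $\ell^2(\mathbb Z^2)$ given by $[H_V\psi]_{n,m}=\psi_{n-1,m}+\psi_{n+1,m}+\psi_{n,m-1}+\psi_{n,m+1}+V_{n,m}\psi_{n,m}$. $V$ is called $\mathfrak p$-periodic, $\mathfrak p=(p,q)\in\mathbb Z_+^2$, if $V_{n+p,m}=V_{n,m+q}=V_{n,m}$ for all $n,m\in\mathbb Z$. $\|V\|_\infty=\sup_{n,m}|V_{n,m}|$ and $\sigma(\cdot)$ denotes the spectrum. *)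

(* Defs.v *)
From Stdlib Require Import Reals ZArith.
Open Scope R_scope.

Definition Cx := (R * R)%type.

Definition Cmul (z w : Cx) : Cx :=
  (fst z * fst w - snd z * snd w, fst z * snd w + snd z * fst w).
Definition Cnorm2 (z : Cx) : R := fst z * fst z + snd z * snd z.

Definition field := (Z * Z)%type -> Cx.

Definition box_sum (N : nat) (f : (Z * Z)%type -> R) : R :=
  sum_f_R0 (fun i =>
    sum_f_R0 (fun j => f ((Z.of_nat i - Z.of_nat N)%Z, (Z.of_nat j - Z.of_nat N)%Z))
      (2 * N)) (2 * N).

(* ||psi||^2 <= M (the l^2 norm squared is the sup of the box sums). *)
Definition l2_le (psi : field) (M : R) : Prop :=
  forall N : nat, box_sum N (fun x => Cnorm2 (psi x)) <= M.

Definition is_l2 (psi : field) : Prop := exists M, l2_le psi M.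

Definition H (V : (Z * Z)%type -> R) (psi : field) : field :=
  fun x =>
    let n := fst x in let m := snd x in
    let s := fun y1 y2 y3 y4 y5 : Cx =>
      (fst y1 + fst y2 + fst y3 + fst y4 + fst y5,
       snd y1 + snd y2 + snd y3 + snd y4 + snd y5) in
    s (psi ((n - 1)%Z, m)) (psi ((n + 1)%Z, m))
      (psi (n, (m - 1)%Z)) (psi (n, (m + 1)%Z))
      (Cmul (V x, 0) (psi x)).

Definition Hz (V : (Z * Z)%type -> R) (z : Cx) (psi : field) : field :=
  fun x => (fst (H V psi x) - fst (Cmul z (psi x)),
            snd (H V psi x) - snd (Cmul z (psi x))).

Definition resolvent (V : (Z * Z)%type -> R) (z : Cx) : Prop :=
  exists K : R, 0 < K /\
    forall phi : field, is_l2 phi ->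
      exists psi : field,
        is_l2 psi /\ (forall x, Hz V z psi x = phi x) /\
        (forall psi' : field, is_l2 psi' -> (forall x, Hz V z psi' x = phi x) ->
            forall x, psi' x = psi x) /\
        (forall M, l2_le phi M -> l2_le psi (K * M)).

Definition spectrum (V : (Z * Z)%type -> R) (z : Cx) : Prop := ~ resolvent V z.

Definition periodic (p q : Z) (V : (Z * Z)%type -> R) : Prop :=
  forall n m : Z, V ((n + p)%Z, m) = V (n, m) /\ V (n, (m + q)%Z) = V (n, m).

Definition Cdist2 (z w : Cx) : R :=
  (fst z - fst w) * (fst z - fst w) + (snd z - snd w) * (snd z - snd w).

Definition Copen (U : Cx -> Prop) : Prop :=
  forall z, U z -> exists eps, 0 < eps /\ forall w, Cdist2 z w < eps -> U w.

Definition connected (S : Cx -> Prop) : Prop :=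
  forall U1 U2 : Cx -> Prop, Copen U1 -> Copen U2 ->
    (forall z, S z -> U1 z \/ U2 z) ->
    (exists z, S z /\ U1 z) -> (exists z, S z /\ U2 z) ->
    exists z, S z /\ U1 z /\ U2 z.

(* S has at most two connected components iff it is the union of two
   connected (possibly empty) subsets. *)
Definition at_most_two_components (S : Cx -> Prop) : Prop :=
  exists A B : Cx -> Prop, connected A /\ connected B /\
    forall z, S z <-> (A z \/ B z).

(* Main.v *)
(* A gap of the spectrum at energy E is an interval of energies at which no Bloch operator
   H_V(x, y) has an eigenvalue, so the number of eigenvalues below E does not depend on the
   quasimomentum (x, y). Two facts about V = 0 survive a small perturbation.

   - For E in (-4, 4) different from 0, some quasimomentum has exactly one free band
     2 cos(x + 2 pi s / p) + 2 cos(y + 2 pi t / q) at E. Moving x through it changes the sign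
     of det(H_0(x, y) - E), hence that of det(H_V(x, y) - E), which must vanish in between.
     At E = 0 a sign change exists as soon as p or q is odd.
   - At a generic quasimomentum the free bands avoid 0 and +-4. If E < E' are in the
     resolvent set and close to the same one of these energies, then
     (H_V(x, y) - E)(H_V(x, y) - E') is positive there; being invertible everywhere it stays
     positive along any path of quasimomenta, so [E, E'] contains no spectrum.

   Thus gaps appear only near 0, and all the resolvent points near 0 form one interval. *)

Require Import Defs.
From Stdlib Require Import Reals ZArith Lia Lra Psatz Classical ClassicalChoice FunctionalExtensionality.
From Coquelicot Require Import Coquelicot.
From mathcomp Require ssreflect ssrfun ssrbool eqtype ssrnat seq fintype finfun bigop ssralg ssrnum matrix perm complex Rstruct.
Open Scope R_scope.

(** * Translation-invariant inner products *)

(** Spectral statements are turned into lower bounds [c * nn f <= nn (T f)] for T = H - z: as H is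
    self-adjoint, z is in the resolvent set exactly when such a bound holds on l^2 with c > 0. These
    bounds pass both ways between l^2 and periodic fields: from l^2 to a cell by truncating Bloch
    waves, and back by placing a truncated field on a large torus, which a finite Fourier sum splits
    into Bloch fields. With m and r the midpoint and half-length of [E, E'], positivity of (H - E)(H
    - E') is the bound for H - m with constant r^2; this is what propagates in (x, y) and what puts
    (E, E') in the resolvent set. The obstacle at energy 0 is that the curve cos x + cos y = 0 is
    invariant under translation by (pi, pi), which is a translation of the band lattice exactly when
    p and q are even; the free bands then come in opposite pairs and the free determinant at 0 keeps
    its sign. The smallness of V needed for a sign change depends on E, so C comes from compactness,
    on energy intervals that stay away from -4 and 4, and also from 0 unless p or q is odd. *)

Definition pot := (Z * Z)%type -> R.
Definition cis (t : R) : C := (cos t, sin t).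

(** The conjugate of [H V] by the plane wave of phase [n x + m y]: on periodic fields it is the
    Bloch operator of quasimomentum [(x, y)], and at [x = y = 0] it is [H V] itself. *)
Definition twisted_H (V : pot) (x y : R) (f : field) : field := fun s =>
  (cis (- x) * f (fst s - 1, snd s)%Z + cis x * f (fst s + 1, snd s)%Z
   + cis (- y) * f (fst s, snd s - 1)%Z + cis y * f (fst s, snd s + 1)%Z
   + RtoC (V s) * f s)%C.

Definition twisted_Hz (V : pot) (x y : R) (z : C) (f : field) : field :=
  fun s => (twisted_H V x y f s - z * f s)%C.

Definition translate (a b : Z) (f : field) : field :=
  fun s => f (fst s + a, snd s + b)%Z.
Definition comb (c : C) (f : field) (d : C) (g : field) : field :=
  fun s => (c * f s + d * g s)%C.
Definition vmul (V : pot) (f : field) : field := fun s => (RtoC (V s) * f s)%C.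
Definition re2 (f g : field) : (Z * Z)%type -> R :=
  fun s => fst (f s) * fst (g s) + snd (f s) * snd (g s).

Lemma C_eq (z w : C) : fst z = fst w -> snd z = snd w -> z = w.
Proof. destruct z, w; simpl; intros; subst; reflexivity. Qed.

Lemma Cplus_0_inj (z w : C) : (0 + z = 0 + w)%C -> z = w.
Proof. now rewrite !Cplus_0_l. Qed.

(* [ring] reads the carrier off the left-hand side, where [Cx] would hide [C]. *)
Ltac cring := apply Cplus_0_inj; ring.

Lemma cis_add (s t : R) : cis (s + t) = (cis s * cis t)%C.
Proof.
  apply C_eq; unfold cis; simpl; [rewrite cos_plus | rewrite sin_plus]; ring.
Qed.

Lemma cis_0 : cis 0 = 1%C.
Proof. apply C_eq; unfold cis; simpl; [apply cos_0 | apply sin_0]. Qed.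

Lemma Cconj_cis (t : R) : Cconj (cis t) = cis (- t).
Proof. apply C_eq; unfold cis; simpl; [rewrite cos_neg | rewrite sin_neg]; ring. Qed.

Lemma Cnorm2_cis (t : R) : Cnorm2 (cis t) = 1.
Proof. unfold Cnorm2, cis; simpl. generalize (sin2_cos2 t); unfold Rsqr; lra. Qed.

Lemma Cnorm2_mul (z w : C) : Cnorm2 (z * w)%C = Cnorm2 z * Cnorm2 w.
Proof. unfold Cnorm2; simpl; ring. Qed.

Lemma Cnorm2_ge0 (z : C) : 0 <= Cnorm2 z.
Proof. unfold Cnorm2; nra. Qed.

(* The common structure of l^2(Z^2) and of the periodic fields with a sum over one
   cell: fields on which the real inner product [tr (re2 f g)] is translation invariant. *)
Record lattice_space (V : pot) := LatticeSpace {
  dom : field -> Prop;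
  tr : ((Z * Z)%type -> R) -> R;
  dom_comb : forall c f d g, dom f -> dom g -> dom (comb c f d g);
  dom_translate : forall a b f, dom f -> dom (translate a b f);
  dom_vmul : forall f, dom f -> dom (vmul V f);
  tr_lin : forall a b f g h k, dom f -> dom g -> dom h -> dom k ->
    tr (fun s => a * re2 f g s + b * re2 h k s) = a * tr (re2 f g) + b * tr (re2 h k);
  tr_mono : forall f g, dom f -> dom g ->
    (forall s, re2 f f s <= re2 g g s) -> tr (re2 f f) <= tr (re2 g g);
  tr_translate : forall a b f, dom f ->
    tr (re2 (translate a b f) (translate a b f)) = tr (re2 f f) }.

Arguments dom {V} _ _.
Arguments tr {V} _ _.

Definition ip {V} (L : lattice_space V) (f g : field) : R := tr L (re2 f g).
Definition nn {V} (L : lattice_space V) (f : field) : R := ip L f f.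

Section Space.
Context {V : pot} (L : lattice_space V).
Implicit Types f g h : field.

Lemma field_ext f g : (forall s, f s = g s) -> f = g.
Proof. intros; apply functional_extensionality; assumption. Qed.

Lemma ip_sym f g : ip L f g = ip L g f.
Proof.
  unfold ip; f_equal; apply functional_extensionality; intros s; unfold re2; ring.
Qed.

(** [tr] carries real parts only. A complex coefficient is handled by moving [i] to the other
    argument, where it becomes [-i]; hence the fields [comb (0, -1) h 0 h]. *)
Lemma ip_comb c f d g h : dom L f -> dom L g -> dom L h ->
  ip L (comb c f d g) h =
    fst c * ip L f h + snd c * ip L f (comb (0, -1) h 0 h)
    + fst d * ip L g h + snd d * ip L g (comb (0, -1) h 0 h).
Proof.
  intros Hf Hg Hh.
  assert (Hk : dom L (comb (0, -1) h 0 h)) by (apply dom_comb; assumption).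
  assert (Hz : dom L (comb 0 h 0 h)) by (apply dom_comb; assumption).
  set (k := comb (0, -1) h 0 h) in *.
  assert (E : forall u, dom L u -> forall c, dom L (comb c u 0 u)) by
    (intros; apply dom_comb; assumption).
  assert (S : forall u c, dom L u ->
    ip L (comb c u 0 u) h = fst c * ip L u h + snd c * ip L u k).
  { intros u c0 Hu. unfold ip. rewrite <- (tr_lin V L) by assumption.
    f_equal. apply functional_extensionality; intros s.
    unfold k, re2, comb; simpl. ring. }
  transitivity (ip L (comb c f 0 f) h + ip L (comb d g 0 g) h).
  { unfold ip.
    replace (tr L (re2 (comb c f 0 f) h) + tr L (re2 (comb d g 0 g) h)) with
      (1 * tr L (re2 (comb c f 0 f) h) + 1 * tr L (re2 (comb d g 0 g) h)) by ring.
    rewrite <- (tr_lin V L) by auto.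
    f_equal. apply functional_extensionality; intros s.
    unfold re2, comb; simpl. ring. }
  rewrite !S by assumption. ring.
Qed.

Lemma nn_comb (a b : R) f g : dom L f -> dom L g ->
  nn L (comb a f b g) = a * a * nn L f + 2 * a * b * ip L f g + b * b * nn L g.
Proof.
  intros Hf Hg. assert (Hc := dom_comb V L a f b g Hf Hg). unfold nn.
  rewrite ip_comb by assumption.
  rewrite (ip_sym f (comb a f b g)), (ip_sym g (comb a f b g)).
  rewrite !ip_comb by assumption.
  rewrite (ip_sym g f). simpl. ring.
Qed.

(** Positivity is not a field of the record: it comes from [tr_mono], by comparison with the zero
    field, written [comb 0 f 0 f]. *)
Lemma nn_ge0 f : dom L f -> 0 <= nn L f.
Proof.
  intros Hf.
  assert (Hz : dom L (comb 0 f 0 f)) by (apply dom_comb; assumption).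
  assert (E : nn L (comb 0 f 0 f) = 0) by (rewrite nn_comb by assumption; ring).
  rewrite <- E. apply tr_mono; try assumption.
  intros s. unfold re2, comb; simpl. nra.
Qed.

Lemma nn_scal (c : C) f : dom L f -> nn L (comb c f 0 f) = Cnorm2 c * nn L f.
Proof.
  intros Hf. unfold nn, ip.
  replace (Cnorm2 c * tr L (re2 f f)) with
    (Cnorm2 c * tr L (re2 f f) + 0 * tr L (re2 f f)) by ring.
  rewrite <- (tr_lin V L) by assumption.
  f_equal. apply functional_extensionality; intros s.
  unfold re2, comb, Cnorm2; simpl. ring.
Qed.

Lemma nn_translate a b f : dom L f -> nn L (translate a b f) = nn L f.
Proof. apply tr_translate. Qed.

Lemma comb_translate a b c f d g :
  comb c (translate a b f) d (translate a b g) = translate a b (comb c f d g).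
Proof. reflexivity. Qed.

(** Polarization: [tr_translate] preserves norms, and the norm of [f + g] gives back the inner
    product. *)
Lemma ip_translate a b f g : dom L f -> dom L g ->
  ip L (translate a b f) g = ip L f (translate (- a) (- b) g).
Proof.
  intros Hf Hg.
  assert (P : forall f g, dom L f -> dom L g ->
    ip L (translate a b f) (translate a b g) = ip L f g).
  { clear f g Hf Hg; intros f g Hf Hg.
    assert (A := nn_comb 1 1 f g Hf Hg).
    assert (B := nn_comb 1 1 (translate a b f) (translate a b g)
                   (dom_translate V L a b f Hf) (dom_translate V L a b g Hg)).
    rewrite comb_translate, !nn_translate in B by (try apply dom_comb; assumption). lra. }
  rewrite <- (P f (translate (- a) (- b) g)) by (try apply dom_translate; assumption).
  f_equal. apply field_ext; intros [n m]. unfold translate; simpl. f_equal. f_equal; lia.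
Qed.

Lemma ip_vmul f g : ip L (vmul V f) g = ip L f (vmul V g).
Proof.
  unfold ip; f_equal; apply functional_extensionality; intros s;
    unfold re2, vmul; simpl; ring.
Qed.

Lemma nn_vmul B f : (forall s, Rabs (V s) <= B) -> dom L f ->
  nn L (vmul V f) <= B * B * nn L f.
Proof.
  intros HB Hf.
  assert (HB0 : 0 <= B) by (generalize (HB (0, 0)%Z), (Rabs_pos (V (0, 0)%Z)); lra).
  replace (B * B * nn L f) with (nn L (comb B f 0 f)) by
    (rewrite nn_scal by assumption; unfold Cnorm2; simpl; ring).
  apply tr_mono; [apply dom_vmul | apply dom_comb | ]; try assumption.
  intros s. unfold re2, vmul, comb; simpl.
  assert (V s * V s <= B * B).
  { specialize (HB s). apply Rabs_def2b in HB || apply Rabs_le_between in HB. nra. }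
  nra.
Qed.

(** Expand [0 <= nn (t f + g)] and divide by [t]. *)
Lemma nn_young_lower t f g : 0 < t -> dom L f -> dom L g ->
  (1 - t) * nn L f + (1 - / t) * nn L g <= nn L (comb 1 f 1 g).
Proof.
  intros Ht Hf Hg. rewrite nn_comb by assumption.
  assert (Q := nn_ge0 (comb t f 1 g) (dom_comb V L _ _ _ _ Hf Hg)).
  rewrite nn_comb in Q by assumption.
  apply (Rmult_le_reg_l t); [assumption | ].
  replace (t * ((1 - t) * nn L f + (1 - / t) * nn L g)) with
    (t * (1 - t) * nn L f + (t - 1) * nn L g) by (field; lra).
  nra.
Qed.

Lemma nn_young_upper t f g : 0 < t -> dom L f -> dom L g ->
  nn L (comb 1 f 1 g) <= (1 + t) * nn L f + (1 + / t) * nn L g.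
Proof.
  intros Ht Hf Hg. rewrite nn_comb by assumption.
  assert (Q := nn_ge0 (comb t f (-1) g) (dom_comb V L _ _ _ _ Hf Hg)).
  rewrite nn_comb in Q by assumption.
  apply (Rmult_le_reg_l t); [assumption | ].
  replace (t * ((1 + t) * nn L f + (1 + / t) * nn L g)) with
    (t * (1 + t) * nn L f + (t + 1) * nn L g) by (field; lra).
  nra.
Qed.

Lemma twisted_Hz_comb x y z f :
  twisted_Hz V x y z f =
  comb 1 (comb 1 (comb (cis (- x)) (translate (-1) 0 f) (cis x) (translate 1 0 f))
               1 (comb (cis (- y)) (translate 0 (-1) f) (cis y) (translate 0 1 f)))
       1 (comb 1 (vmul V f) (- z) f).
Proof.
  apply field_ext; intros [n m].
  unfold twisted_Hz, twisted_H, comb, translate, vmul; simpl.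
  rewrite !Z.add_0_r. change (n + -1)%Z with (n - 1)%Z. change (m + -1)%Z with (m - 1)%Z.
  cring.
Qed.

Lemma dom_twisted x y z f : dom L f -> dom L (twisted_Hz V x y z f).
Proof.
  intros Hf. rewrite twisted_Hz_comb.
  repeat first [assumption | apply dom_comb | apply dom_translate | apply dom_vmul].
Qed.

Lemma ip_scal_l c f h : dom L f -> dom L h ->
  ip L (comb c f 0 f) h = ip L f (comb (Cconj c) h 0 h).
Proof.
  intros Hf Hh. rewrite ip_comb by assumption. simpl.
  rewrite (ip_sym f (comb (Cconj c) h 0 h)), ip_comb by assumption.
  assert (E : ip L f (comb (0, -1) h 0 h) = - ip L h (comb (0, -1) f 0 f)).
  { rewrite (ip_sym f). unfold ip.
    replace (- tr L (re2 h (comb (0, -1) f 0 f))) with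
      (-1 * tr L (re2 h (comb (0, -1) f 0 f)) + 0 * tr L (re2 h h)) by ring.
    rewrite <- (tr_lin V L); try (apply dom_comb); try assumption.
    f_equal. apply functional_extensionality; intros s.
    unfold re2, comb; simpl. ring. }
  rewrite E, (ip_sym h f). simpl. ring.
Qed.

Lemma ip_add_r f g h : dom L f -> dom L g -> dom L h ->
  ip L h (comb 1 f 1 g) = ip L h f + ip L h g.
Proof.
  intros. rewrite (ip_sym h), ip_comb, (ip_sym f h), (ip_sym g h) by assumption.
  simpl. ring.
Qed.

Lemma ip_add_l f g h : dom L f -> dom L g -> dom L h ->
  ip L (comb 1 f 1 g) h = ip L f h + ip L g h.
Proof. intros. rewrite ip_comb by assumption. simpl. ring. Qed.

Ltac dom_tac :=
  repeat first [assumption | apply dom_comb | apply dom_translate | apply dom_vmul].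

Lemma ip_scal_translate c a b f g : dom L f -> dom L g ->
  ip L (comb c (translate a b f) 0 (translate a b f)) g =
  ip L f (comb (Cconj c) (translate (- a) (- b) g) 0 (translate (- a) (- b) g)).
Proof.
  intros. rewrite comb_translate, ip_translate by dom_tac.
  rewrite ip_scal_l by dom_tac. reflexivity.
Qed.

Lemma comb_split c f d g : comb c f d g = comb 1 (comb c f 0 f) 1 (comb d g 0 g).
Proof. apply field_ext; intros s; unfold comb; cring. Qed.

(** The adjoint of a translation with phase [cis x] is the opposite translation with phase
    [cis (- x)], so the four hopping terms are exchanged in pairs; the potential is real. *)
Lemma twisted_adj x y z f g : dom L f -> dom L g ->
  ip L (twisted_Hz V x y z f) g = ip L f (twisted_Hz V x y (Cconj z) g).
Proof.
  intros Hf Hg. rewrite !twisted_Hz_comb.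
  rewrite (comb_split (cis (- x)) (translate (-1) 0 f)), (comb_split (cis (- y)) (translate 0 (-1) f)),
    (comb_split (cis (- x)) (translate (-1) 0 g)), (comb_split (cis (- y)) (translate 0 (-1) g)),
    (comb_split 1 (vmul V f) (- z)), (comb_split 1 (vmul V g) (- Cconj z)).
  rewrite !ip_add_l by dom_tac. rewrite !ip_add_r by dom_tac.
  rewrite !ip_scal_translate by dom_tac. rewrite !Cconj_cis, !Ropp_involutive. simpl Z.opp.
  rewrite (ip_scal_l 1), (ip_scal_l (- z)) by dom_tac.
  replace (Cconj (- z)) with (- Cconj z)%C by
    (apply C_eq; simpl; ring).
  replace (comb (Cconj 1) g 0 g) with g by
    (apply field_ext; intros s; apply C_eq; unfold comb; simpl; ring).
  replace (comb 1 (vmul V g) 0 (vmul V g)) with (vmul V g) by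
    (apply field_ext; intros s; unfold comb; cring).
  rewrite ip_vmul. ring.
Qed.

Lemma nn_add_le f g : dom L f -> dom L g ->
  nn L (comb 1 f 1 g) <= 2 * nn L f + 2 * nn L g.
Proof.
  intros Hf Hg. generalize (nn_young_upper 1 f g Rlt_0_1 Hf Hg). rewrite Rinv_1. lra.
Qed.

Lemma nn_twisted_le B x y z f : (forall s, Rabs (V s) <= B) -> dom L f ->
  nn L (twisted_Hz V x y z f) <= (32 + 4 * B * B + 4 * Cnorm2 z) * nn L f.
Proof.
  intros HB Hf. rewrite twisted_Hz_comb.
  rewrite (comb_split (cis (- x)) (translate (-1) 0 f)), (comb_split (cis (- y)) (translate 0 (-1) f)),
    (comb_split 1 (vmul V f) (- z)).
  eapply Rle_trans; [apply nn_add_le; dom_tac | ].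
  assert (S : forall t a b, nn L (comb (cis t) (translate a b f) 0 (translate a b f)) = nn L f).
  { intros. rewrite nn_scal, Cnorm2_cis, nn_translate by dom_tac. ring. }
  assert (A := nn_add_le
    (comb 1 (comb (cis (- x)) (translate (-1) 0 f) 0 (translate (-1) 0 f))
          1 (comb (cis x) (translate 1 0 f) 0 (translate 1 0 f)))
    (comb 1 (comb (cis (- y)) (translate 0 (-1) f) 0 (translate 0 (-1) f))
          1 (comb (cis y) (translate 0 1 f) 0 (translate 0 1 f)))
    ltac:(dom_tac) ltac:(dom_tac)).
  assert (A1 := nn_add_le (comb (cis (- x)) (translate (-1) 0 f) 0 (translate (-1) 0 f))
          (comb (cis x) (translate 1 0 f) 0 (translate 1 0 f)) ltac:(dom_tac) ltac:(dom_tac)).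
  assert (A2 := nn_add_le (comb (cis (- y)) (translate 0 (-1) f) 0 (translate 0 (-1) f))
          (comb (cis y) (translate 0 1 f) 0 (translate 0 1 f)) ltac:(dom_tac) ltac:(dom_tac)).
  assert (A3 := nn_add_le (comb 1 (vmul V f) 0 (vmul V f)) (comb (- z) f 0 f)
                ltac:(dom_tac) ltac:(dom_tac)).
  rewrite !S in A1, A2. rewrite !nn_scal in A3 by dom_tac.
  replace (Cnorm2 (- z)%C) with (Cnorm2 z) in A3 by (unfold Cnorm2; simpl; ring).
  assert (A4 := nn_vmul B f HB Hf).
  replace (Cnorm2 (RtoC 1)) with 1 in A3 by (unfold Cnorm2; simpl; ring).
  lra.
Qed.

Lemma twisted_comm x y z w f :
  twisted_Hz V x y z (twisted_Hz V x y w f) = twisted_Hz V x y w (twisted_Hz V x y z f).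
Proof.
  apply field_ext; intros s. unfold twisted_Hz, twisted_H; simpl. cring.
Qed.

Lemma twisted_shift_z x y z w f :
  twisted_Hz V x y (z + w)%C f = comb 1 (twisted_Hz V x y z f) (- w) f.
Proof. apply field_ext; intros s. unfold twisted_Hz, comb. cring. Qed.

Lemma nn_complex_z x y (a b : R) f : dom L f ->
  nn L (twisted_Hz V x y (a, b) f) = nn L (twisted_Hz V x y (RtoC a) f) + b * b * nn L f.
Proof.
  intros Hf. assert (HT := dom_twisted x y (RtoC a) f Hf).
  replace (a, b) with (RtoC a + (0, b))%C by (apply C_eq; simpl; ring).
  rewrite twisted_shift_z. rewrite comb_split.
  set (T := twisted_Hz V x y (RtoC a) f) in *.
  unfold nn at 1. rewrite ip_add_l by dom_tac. rewrite !ip_add_r by dom_tac.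
  change (ip L (comb (- (0, b)) f 0 f) (comb (- (0, b)) f 0 f)) with
    (nn L (comb (- (0, b))%C f 0 f)).
  change (ip L (comb 1 T 0 T) (comb 1 T 0 T)) with (nn L (comb 1 T 0 T)).
  rewrite !nn_scal by assumption.
  rewrite (ip_sym (comb (- (0, b)) f 0 f)).
  (* The cross term is its own opposite: [H - a] is symmetric and commutes with multiplication by
     [- i b], which is antisymmetric. *)
  assert (Z : ip L (comb 1 T 0 T) (comb (- (0, b)) f 0 f) = 0).
  { replace (comb 1 T 0 T) with T by (apply field_ext; intros s; unfold comb; cring).
    set (g := comb (- (0, b)) f 0 f).
    assert (Hg : dom L g) by (unfold g; dom_tac).
    assert (E : ip L T g = - ip L T g); [ | lra].
    transitivity (ip L f (twisted_Hz V x y a g)).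
    { unfold T. rewrite twisted_adj by assumption. f_equal. f_equal.
      apply C_eq; simpl; ring. }
    replace (twisted_Hz V x y a g) with (comb (- (0, b)) T 0 T).
    - rewrite (ip_sym f), ip_scal_l by assumption.
      assert (E2 : ip L T (comb (Cconj (- (0, b))) f 0 f) = - ip L T g); [ | exact E2].
      rewrite (ip_sym T g). unfold g.
      rewrite ip_comb by assumption. rewrite (ip_sym T).
      rewrite ip_comb by assumption. simpl. ring.
    - apply field_ext; intros s. unfold comb, T, g, twisted_Hz, twisted_H, comb. cring. }
  rewrite Z. unfold Cnorm2; simpl. ring.
Qed.

Lemma nn_twisted_conj x y z f : dom L f ->
  nn L (twisted_Hz V x y (Cconj z) f) = nn L (twisted_Hz V x y z f).
Proof.
  intros Hf. destruct z as [a b]. unfold Cconj; simpl.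
  rewrite !nn_complex_z by assumption. ring.
Qed.

End Space.

(** * Sums over the lattice *)

Fixpoint nsum (n : nat) (f : nat -> R) : R :=
  match n with O => 0 | S k => nsum k f + f k end.
Definition zsum (a : Z) (n : nat) (f : Z -> R) : R :=
  nsum n (fun i => f (a + Z.of_nat i)%Z).
Definition rsum (a : Z) (n : nat) (b : Z) (m : nat) (F : (Z * Z)%type -> R) : R :=
  zsum a n (fun i => zsum b m (fun j => F (i, j))).

Lemma nsum_ext n f g : (forall i, (i < n)%nat -> f i = g i) -> nsum n f = nsum n g.
Proof.
  induction n as [|n IH]; intros E; simpl; [reflexivity | ].
  rewrite (E n), IH; auto.
Qed.

Lemma nsum_lin n a b f g :
  nsum n (fun i => a * f i + b * g i) = a * nsum n f + b * nsum n g.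
Proof. induction n as [|n IH]; simpl; [ring | rewrite IH; ring]. Qed.

Lemma nsum_le n f g : (forall i, (i < n)%nat -> f i <= g i) -> nsum n f <= nsum n g.
Proof.
  induction n as [|n IH]; intros E; simpl; [lra | ].
  apply Rplus_le_compat; auto.
Qed.

Lemma nsum_const n c : nsum n (fun _ => c) = INR n * c.
Proof. induction n as [|n IH]; [simpl; ring | rewrite S_INR; simpl nsum; rewrite IH; ring]. Qed.

Lemma nsum_ge0 n f : (forall i, (i < n)%nat -> 0 <= f i) -> 0 <= nsum n f.
Proof.
  intros E. replace 0 with (nsum n (fun _ => 0)) by (rewrite nsum_const; ring).
  apply nsum_le; assumption.
Qed.

Lemma nsum_split n m f : nsum (n + m) f = nsum n f + nsum m (fun i => f (n + i)%nat).
Proof.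
  induction m as [|m IH]; simpl; [rewrite Nat.add_0_r; ring | ].
  rewrite Nat.add_succ_r; simpl. rewrite IH; ring.
Qed.

Lemma nsum_exchange n m (F : nat -> nat -> R) :
  nsum n (fun i => nsum m (F i)) = nsum m (fun j => nsum n (fun i => F i j)).
Proof.
  induction n as [|n IH]; simpl.
  - rewrite nsum_const; ring.
  - rewrite IH.
    replace (nsum m (fun j => nsum n (fun i => F i j) + F n j)) with
      (nsum m (fun j => 1 * nsum n (fun i => F i j) + 1 * F n j)).
    + rewrite (nsum_lin m 1 1 (fun j => nsum n (fun i => F i j)) (F n)). ring.
    + apply nsum_ext; intros; ring.
Qed.

Lemma nsum_scal n c f : nsum n (fun i => c * f i) = c * nsum n f.
Proof. induction n as [|n IH]; simpl; [ring | rewrite IH; ring]. Qed.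

Lemma nsum_mul K p f :
  nsum (K * p) f = nsum K (fun j => nsum p (fun i => f (j * p + i)%nat)).
Proof.
  induction K as [|K IH]; simpl; [reflexivity | ].
  rewrite Nat.add_comm, nsum_split, IH. reflexivity.
Qed.

Lemma nsum_delta n k f : (k < n)%nat ->
  nsum n (fun i => if Nat.eq_dec i k then f i else 0) = f k.
Proof.
  induction n as [|n IH]; intros Hk; [lia | simpl].
  destruct (Nat.eq_dec n k) as [-> | Hn].
  - rewrite (nsum_ext _ _ (fun _ => 0)); [rewrite nsum_const; ring | ].
    intros i Hi. destruct (Nat.eq_dec i k); [lia | reflexivity].
  - rewrite IH by lia. ring.
Qed.

Lemma zsum_ext a n f g :
  (forall i, (a <= i < a + Z.of_nat n)%Z -> f i = g i) -> zsum a n f = zsum a n g.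
Proof. intros E. apply nsum_ext; intros; apply E; lia. Qed.

Lemma zsum_le a n f g :
  (forall i, (a <= i < a + Z.of_nat n)%Z -> f i <= g i) -> zsum a n f <= zsum a n g.
Proof. intros E. apply nsum_le; intros; apply E; lia. Qed.

Lemma zsum_sub a n b m f : (forall i, 0 <= f i) ->
  (a <= b)%Z -> (b + Z.of_nat m <= a + Z.of_nat n)%Z -> zsum b m f <= zsum a n f.
Proof.
  intros Hf H1 H2. unfold zsum.
  replace n with (Z.to_nat (b - a) + (m + Z.to_nat (a + Z.of_nat n - b - Z.of_nat m)))%nat
    by lia.
  rewrite !nsum_split.
  rewrite (nsum_ext m (fun i => f (a + Z.of_nat (Z.to_nat (b - a) + i))%Z)
     (fun i => f (b + Z.of_nat i)%Z)) by (intros; f_equal; lia).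
  assert (0 <= nsum (Z.to_nat (b - a)) (fun i => f (a + Z.of_nat i)%Z)) by
    (apply nsum_ge0; auto).
  match goal with |- _ <= _ + (_ + ?t) => assert (0 <= t) by (apply nsum_ge0; auto) end.
  lra.
Qed.

Lemma zsum_shift1 a n f c : zsum a n (fun i => f (i + c)%Z) = zsum (a + c) n f.
Proof. apply nsum_ext; intros; f_equal; lia. Qed.

Lemma zsum_periodic a b n f : (forall i, f (i + Z.of_nat n)%Z = f i) ->
  zsum a n f = zsum b n f.
Proof.
  intros Hf.
  assert (S1 : forall a, zsum (a + 1) n f = zsum a n f).
  { intros c. unfold zsum.
    assert (E : nsum (S n) (fun i => f (c + Z.of_nat i)%Z) =
                f c + nsum n (fun i => f (c + 1 + Z.of_nat i)%Z)).
    { change (S n) with (1 + n)%nat. rewrite nsum_split. simpl.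
      rewrite Z.add_0_r, Rplus_0_l. f_equal. apply nsum_ext; intros; f_equal; lia. }
    simpl in E. rewrite Hf in E. lra. }
  assert (S2 : forall k a, zsum (a + Z.of_nat k) n f = zsum a n f).
  { induction k as [|k IH]; intros c; [now rewrite Z.add_0_r | ].
    replace (c + Z.of_nat (S k))%Z with (c + Z.of_nat k + 1)%Z by lia.
    now rewrite S1. }
  destruct (Z_le_gt_dec a b) as [Hab | Hab].
  - replace b with (a + Z.of_nat (Z.to_nat (b - a)))%Z by lia. symmetry; apply S2.
  - replace a with (b + Z.of_nat (Z.to_nat (a - b)))%Z by lia. apply S2.
Qed.

Lemma rsum_ext a n b m F G :
  (forall i j, (a <= i < a + Z.of_nat n)%Z -> (b <= j < b + Z.of_nat m)%Z ->
     F (i, j) = G (i, j)) -> rsum a n b m F = rsum a n b m G.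
Proof. intros E. apply zsum_ext; intros; apply zsum_ext; auto. Qed.

Lemma rsum_le a n b m F G :
  (forall i j, (a <= i < a + Z.of_nat n)%Z -> (b <= j < b + Z.of_nat m)%Z ->
     F (i, j) <= G (i, j)) -> rsum a n b m F <= rsum a n b m G.
Proof. intros E. apply zsum_le; intros; apply zsum_le; auto. Qed.

Lemma rsum_lin a n b m c d F G :
  rsum a n b m (fun s => c * F s + d * G s) = c * rsum a n b m F + d * rsum a n b m G.
Proof.
  unfold rsum, zsum. rewrite <- nsum_lin. apply nsum_ext; intros. now rewrite nsum_lin.
Qed.

Lemma rsum_sub a n b m a' n' b' m' F : (forall s, 0 <= F s) ->
  (a' <= a)%Z -> (a + Z.of_nat n <= a' + Z.of_nat n')%Z ->
  (b' <= b)%Z -> (b + Z.of_nat m <= b' + Z.of_nat m')%Z ->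
  rsum a n b m F <= rsum a' n' b' m' F.
Proof.
  intros HF H1 H2 H3 H4. unfold rsum.
  apply Rle_trans with (zsum a' n' (fun i => zsum b m (fun j => F (i, j)))).
  - apply zsum_sub; try assumption. intros; apply nsum_ge0; auto.
  - apply zsum_le; intros. apply zsum_sub; auto.
Qed.

Lemma rsum_ge0 a n b m F : (forall s, 0 <= F s) -> 0 <= rsum a n b m F.
Proof. intros HF. apply nsum_ge0; intros; apply nsum_ge0; auto. Qed.

Definition per {T} (p q : Z) (f : (Z * Z)%type -> T) : Prop :=
  forall n m, f (n + p, m)%Z = f (n, m) /\ f (n, m + q)%Z = f (n, m).

Lemma rsum_periodic a b a' b' p q (F : (Z * Z)%type -> R) :
  per (Z.of_nat p) (Z.of_nat q) F -> rsum a p b q F = rsum a' p b' q F.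
Proof.
  intros HF. unfold rsum. rewrite (zsum_periodic a a').
  - apply zsum_ext; intros; apply zsum_periodic; intros; apply HF.
  - intros i. apply zsum_ext; intros; apply HF.
Qed.

Lemma rsum_shift a n b m c d F :
  rsum a n b m (fun s => F (fst s + c, snd s + d)%Z) = rsum (a + c) n (b + d) m F.
Proof.
  unfold rsum; simpl.
  rewrite <- (zsum_shift1 a n (fun i => zsum (b + d) m (fun j => F (i, j))) c).
  apply zsum_ext; intros i _.
  apply (zsum_shift1 b m (fun j => F ((i + c)%Z, j)) d).
Qed.

Lemma per_re2 p q (f g : field) : per p q f -> per p q g -> per p q (re2 f g).
Proof.
  intros Hf Hg n m. destruct (Hf n m) as [F1 F2], (Hg n m) as [G1 G2].
  unfold re2. rewrite F1, F2, G1, G2. auto.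
Qed.

Lemma re2_ge0 (f : field) s : 0 <= re2 f f s.
Proof. unfold re2; nra. Qed.

Lemma re2_Cnorm2 (f : field) s : re2 f f s = Cnorm2 (f s).
Proof. reflexivity. Qed.

Definition cell_space (p q : nat) (V : pot) (HV : per (Z.of_nat p) (Z.of_nat q) V) :
  lattice_space V.
Proof.
  apply (LatticeSpace V (fun f => per (Z.of_nat p) (Z.of_nat q) f) (rsum 0 p 0 q)).
  - intros c f d g Hf Hg n m. destruct (Hf n m) as [F1 F2], (Hg n m) as [G1 G2].
    unfold comb. rewrite F1, F2, G1, G2. auto.
  - intros a b f Hf n m.
    destruct (Hf (n + a)%Z (m + b)%Z) as [F1 F2].
    split.
    + transitivity (f (n + a + Z.of_nat p, m + b)%Z); [ | exact F1].
      unfold translate; simpl. f_equal; f_equal; lia.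
    + transitivity (f (n + a, m + b + Z.of_nat q)%Z); [ | exact F2].
      unfold translate; simpl. f_equal; f_equal; lia.
  - intros f Hf n m. destruct (Hf n m) as [F1 F2], (HV n m) as [G1 G2].
    unfold vmul. rewrite F1, F2, G1, G2. auto.
  - intros. apply rsum_lin.
  - intros. apply rsum_le; auto.
  - intros a b f Hf.
    change (re2 (translate a b f) (translate a b f)) with
      (fun s : (Z * Z)%type => re2 f f (fst s + a, snd s + b)%Z).
    rewrite rsum_shift. apply rsum_periodic, per_re2; assumption.
Defined.

Lemma nsum_sum_f_R0 n f : sum_f_R0 f n = nsum (S n) f.
Proof. induction n as [|n IH]; [simpl; ring | simpl sum_f_R0; rewrite IH; reflexivity]. Qed.

Lemma box_sum_rsum N F :
  box_sum N F = rsum (- Z.of_nat N) (2 * N + 1) (- Z.of_nat N) (2 * N + 1) F.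
Proof.
  unfold box_sum, rsum, zsum. rewrite nsum_sum_f_R0.
  replace (2 * N + 1)%nat with (S (2 * N)) by lia.
  apply nsum_ext; intros i _. rewrite nsum_sum_f_R0.
  apply nsum_ext; intros j _. f_equal. f_equal; lia.
Qed.

Lemma rsum_le_box a n b m F : (forall s, 0 <= F s) ->
  exists N, rsum a n b m F <= box_sum N F.
Proof.
  intros HF.
  exists (Z.to_nat (Z.abs a + Z.abs b + Z.of_nat n + Z.of_nat m)).
  rewrite box_sum_rsum. apply rsum_sub; try assumption; lia.
Qed.

Lemma l2_le_rsum f M a n b m : l2_le f M -> rsum a n b m (re2 f f) <= M.
Proof.
  intros Hf. destruct (rsum_le_box a n b m _ (re2_ge0 f)) as [N HN].
  eapply Rle_trans; [exact HN | apply Hf].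
Qed.

Lemma box_sum_lin N c d F G :
  box_sum N (fun s => c * F s + d * G s) = c * box_sum N F + d * box_sum N G.
Proof. rewrite !box_sum_rsum. apply rsum_lin. Qed.

Lemma box_sum_le N F G : (forall s, F s <= G s) -> box_sum N F <= box_sum N G.
Proof. intros E. rewrite !box_sum_rsum. apply rsum_le; auto. Qed.

Lemma is_l2_comb c f d g : is_l2 f -> is_l2 g -> is_l2 (comb c f d g).
Proof.
  intros [M HM] [M' HM'].
  exists (2 * Cnorm2 c * M + 2 * Cnorm2 d * M'). intros N.
  apply Rle_trans with
    (box_sum N (fun s => 2 * Cnorm2 c * re2 f f s + 2 * Cnorm2 d * re2 g g s)).
  - apply box_sum_le; intros s. unfold Cnorm2, re2, comb; simpl.
    destruct c as [c1 c2], d as [d1 d2]; simpl.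
    set (a1 := c1 * fst (f s) - c2 * snd (f s)). set (a2 := c1 * snd (f s) + c2 * fst (f s)).
    set (b1 := d1 * fst (g s) - d2 * snd (g s)). set (b2 := d1 * snd (g s) + d2 * fst (g s)).
    replace (2 * (c1 * c1 + c2 * c2) * (fst (f s) * fst (f s) + snd (f s) * snd (f s))) with
      (2 * (a1 * a1 + a2 * a2)) by (unfold a1, a2; ring).
    replace (2 * (d1 * d1 + d2 * d2) * (fst (g s) * fst (g s) + snd (g s) * snd (g s))) with
      (2 * (b1 * b1 + b2 * b2)) by (unfold b1, b2; ring).
    generalize (Rle_0_sqr (a1 - b1)), (Rle_0_sqr (a2 - b2)); unfold Rsqr; lra.
  - rewrite box_sum_lin.
    assert (Hc := Cnorm2_ge0 c). assert (Hd := Cnorm2_ge0 d).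
    specialize (HM N); specialize (HM' N).
    change (box_sum N (fun x => Cnorm2 (f x))) with (box_sum N (re2 f f)) in HM.
    change (box_sum N (fun x => Cnorm2 (g x))) with (box_sum N (re2 g g)) in HM'.
    apply Rplus_le_compat; apply Rmult_le_compat_l; lra.
Qed.

Lemma l2_le_translate a b f M : l2_le f M -> l2_le (translate a b f) M.
Proof.
  intros Hf N. rewrite box_sum_rsum.
  change (fun x => Cnorm2 (translate a b f x)) with
    (fun s : (Z * Z)%type => re2 f f (fst s + a, snd s + b)%Z).
  rewrite rsum_shift. apply l2_le_rsum; assumption.
Qed.

Lemma box_sum_incr f N : box_sum N (re2 f f) <= box_sum (S N) (re2 f f).
Proof. rewrite !box_sum_rsum. apply rsum_sub; [apply re2_ge0 | lia..]. Qed.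

(** [Lim_seq] is total, so the value is meaningful only when the box sums converge; [l2_tr_lim]
    provides this for products of l^2 fields. *)
Definition l2_tr (F : (Z * Z)%type -> R) : R := real (Lim_seq (fun N => box_sum N F)).

(** Box sums of [re2 h h] are monotone and bounded; mixed sums converge by polarization. *)
Lemma l2_tr_lim f g : is_l2 f -> is_l2 g ->
  is_lim_seq (fun N => box_sum N (re2 f g)) (l2_tr (re2 f g)).
Proof.
  intros Hf Hg.
  assert (D : forall h, is_l2 h -> ex_finite_lim_seq (fun N => box_sum N (re2 h h))).
  { intros h [M HM]. apply ex_finite_lim_seq_incr with M; [apply box_sum_incr | exact HM]. }
  apply Lim_seq_correct'.
  destruct (D f Hf) as [lf Lf], (D g Hg) as [lg Lg],
    (D (comb 1 f 1 g) (is_l2_comb _ _ _ _ Hf Hg)) as [ls Ls].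
  exists (/ 2 * (ls - lf - lg)).
  apply is_lim_seq_ext with (fun N => / 2 * (box_sum N (re2 (comb 1 f 1 g) (comb 1 f 1 g))
     - box_sum N (re2 f f) - box_sum N (re2 g g))).
  - intros N.
    replace (re2 (comb 1 f 1 g) (comb 1 f 1 g)) with
      (fun s => 1 * (1 * re2 f f s + 1 * re2 g g s) + 2 * re2 f g s).
    + rewrite (box_sum_lin N 1 2 (fun s => 1 * re2 f f s + 1 * re2 g g s)).
      rewrite box_sum_lin. field.
    + apply functional_extensionality; intros s. unfold re2, comb; simpl; ring.
  - apply (is_lim_seq_scal_l _ (/ 2) (ls - lf - lg)).
    apply is_lim_seq_minus'; [apply is_lim_seq_minus'; assumption | assumption].
Qed.

Lemma l2_tr_unique F l : is_lim_seq (fun N => box_sum N F) (Finite l) -> l2_tr F = l.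
Proof. intros Hl. unfold l2_tr. now rewrite (is_lim_seq_unique _ _ Hl). Qed.

Lemma l2_box_le f N : is_l2 f -> box_sum N (re2 f f) <= l2_tr (re2 f f).
Proof.
  intros Hf. apply (is_lim_seq_incr_compare (fun N => box_sum N (re2 f f)));
    [apply l2_tr_lim; assumption | apply box_sum_incr].
Qed.

Lemma l2_tr_le f M : is_l2 f -> l2_le f M -> l2_tr (re2 f f) <= M.
Proof.
  intros Hf HM.
  apply (is_lim_seq_le (fun N => box_sum N (re2 f f)) (fun _ => M)
    (Finite (l2_tr (re2 f f))) (Finite M)); [exact HM | apply l2_tr_lim; assumption | ].
  apply is_lim_seq_const.
Qed.

Definition l2_space (V : pot) (HV : exists B, forall s, Rabs (V s) <= B) : lattice_space V.
Proof.
  apply (LatticeSpace V is_l2 l2_tr).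
  - intros; apply is_l2_comb; assumption.
  - intros a b f [M HM]. exists M. now apply l2_le_translate.
  - intros f [M HM]. destruct HV as [B HB].
    assert (HB0 : 0 <= B) by (generalize (HB (0, 0)%Z), (Rabs_pos (V (0, 0)%Z)); lra).
    exists (B * B * M + 0 * M). intros N.
    apply Rle_trans with (box_sum N (fun s => B * B * re2 f f s + 0 * re2 f f s)).
    + apply box_sum_le; intros s. unfold Cnorm2, re2, vmul; simpl.
      specialize (HB s). apply Rabs_le_between in HB.
      assert (V s * V s <= B * B) by nra. nra.
    + rewrite box_sum_lin. specialize (HM N).
      change (box_sum N (fun x => Cnorm2 (f x))) with (box_sum N (re2 f f)) in HM. nra.
  - intros a b f g h k Hf Hg Hh Hk. apply l2_tr_unique.
    apply is_lim_seq_ext with (fun N => a * box_sum N (re2 f g) + b * box_sum N (re2 h k)).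
    + intros N. now rewrite box_sum_lin.
    + apply is_lim_seq_plus'; [apply (is_lim_seq_scal_l _ a (Finite _)) |
        apply (is_lim_seq_scal_l _ b (Finite _))]; apply l2_tr_lim; assumption.
  - intros f g Hf Hg E. apply l2_tr_le; [assumption | ]. intros N.
    apply Rle_trans with (box_sum N (re2 g g)); [now apply box_sum_le | now apply l2_box_le].
  - intros a b f Hf.
    assert (Q : forall a b f, is_l2 f -> is_l2 (translate a b f)).
    { intros a0 b0 f0 [M HM]. exists M. now apply l2_le_translate. }
    assert (P : forall a b f, is_l2 f ->
      l2_tr (re2 (translate a b f) (translate a b f)) <= l2_tr (re2 f f)).
    { intros a0 b0 f0 H0. apply l2_tr_le; [now apply Q | ].
      apply l2_le_translate. intros N. now apply l2_box_le. }
    (* The reverse inequality is [P] for the inverse translation. *)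
    apply Rle_antisym; [now apply P | ].
    replace (re2 f f) with (re2 (translate (- a) (- b) (translate a b f)) (translate (- a) (- b) (translate a b f))).
    + apply P. now apply Q.
    + replace (translate (- a) (- b) (translate a b f)) with f; [reflexivity | ].
      apply field_ext; intros [n m]; unfold translate; simpl. f_equal. f_equal; lia.
Defined.

Lemma l2_le_nn V HV f : is_l2 f -> l2_le f (nn (l2_space V HV) f).
Proof. intros Hf N. now apply l2_box_le. Qed.

Lemma nn_le_l2 V HV f M : is_l2 f -> l2_le f M -> nn (l2_space V HV) f <= M.
Proof. intros. now apply l2_tr_le. Qed.

(** * The resolvent *)

Definition bounded_below {V} (L : lattice_space V) (x y : R) (z : C) (c : R) : Prop :=
  forall f, dom L f -> c * nn L f <= nn L (twisted_Hz V x y z f).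

Lemma Hz_twisted V z f : Hz V z f = twisted_Hz V 0 0 z f.
Proof.
  apply field_ext; intros [n m].
  unfold Hz, H, twisted_Hz, twisted_H. rewrite Ropp_0, cis_0.
  apply C_eq; simpl; unfold Cmul; simpl; ring.
Qed.

(** Solvability is applied to the right-hand side [(H - z) f]: uniqueness identifies the solution
    with [f], and the bound on the solution becomes a lower bound with constant [/ K]. *)
Lemma bounded_below_of_resolvent V HV z : resolvent V z ->
  exists c, 0 < c /\ bounded_below (l2_space V HV) 0 0 z c.
Proof.
  intros [K [HK R]]. exists (/ K). split; [now apply Rinv_0_lt_compat | ].
  intros f Hf. set (g := twisted_Hz V 0 0 z f).
  assert (Hg : is_l2 g) by (apply (dom_twisted (l2_space V HV)); exact Hf).
  destruct (R g Hg) as [psi [H1 [H2 [H3 H4]]]].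
  assert (E : f = psi).
  { apply field_ext; intros s. apply H3; [exact Hf | ].
    intros x. now rewrite Hz_twisted. }
  rewrite E.
  apply (Rmult_le_reg_l K); [assumption | ].
  rewrite <- Rmult_assoc, Rinv_r, Rmult_1_l by lra.
  apply nn_le_l2; [assumption | ]. apply H4. now apply l2_le_nn.
Qed.

Definition ptlim (F : nat -> field) (f : field) : Prop := forall s,
  is_lim_seq (fun n => fst (F n s)) (fst (f s)) /\
  is_lim_seq (fun n => snd (F n s)) (snd (f s)).

Lemma ptlim_const f : ptlim (fun _ => f) f.
Proof. intros s; split; apply is_lim_seq_const. Qed.

Lemma ptlim_comb c F f d G g : ptlim F f -> ptlim G g ->
  ptlim (fun n => comb c (F n) d (G n)) (comb c f d g).
Proof.
  intros HF HG s. destruct (HF s) as [F1 F2], (HG s) as [G1 G2].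
  assert (S : forall (a : R) u l, is_lim_seq u (Finite l) ->
    is_lim_seq (fun n => a * u n) (Finite (a * l)))
    by (intros a u l Hu; apply (is_lim_seq_scal_l u a l Hu)).
  split; unfold comb; simpl.
  - apply is_lim_seq_plus'; apply is_lim_seq_minus'; apply S; assumption.
  - apply is_lim_seq_plus'; apply is_lim_seq_plus'; apply S; assumption.
Qed.

Lemma ptlim_translate a b F f : ptlim F f ->
  ptlim (fun n => translate a b (F n)) (translate a b f).
Proof. intros HF s. apply HF. Qed.

Lemma ptlim_vmul V F f : ptlim F f -> ptlim (fun n => vmul V (F n)) (vmul V f).
Proof.
  intros HF s. destruct (ptlim_comb (V s) F f 0 F f HF HF s) as [H1 H2].
  split; [eapply is_lim_seq_ext; [ | replace (fst (vmul V f s)) with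
      (fst (comb (V s) f 0 f s)); [exact H1 | ]] |
    eapply is_lim_seq_ext; [ | replace (snd (vmul V f s)) with
      (snd (comb (V s) f 0 f s)); [exact H2 | ]]];
    intros; unfold comb, vmul; simpl; ring.
Qed.

Lemma ptlim_twisted V x y z F f : ptlim F f ->
  ptlim (fun n => twisted_Hz V x y z (F n)) (twisted_Hz V x y z f).
Proof.
  intros HF. rewrite twisted_Hz_comb.
  replace (fun n => twisted_Hz V x y z (F n)) with (fun n =>
    comb 1 (comb 1 (comb (cis (- x)) (translate (-1) 0 (F n)) (cis x) (translate 1 0 (F n)))
               1 (comb (cis (- y)) (translate 0 (-1) (F n)) (cis y) (translate 0 1 (F n))))
       1 (comb 1 (vmul V (F n)) (- z) (F n))).
  - repeat first [assumption | apply ptlim_comb | apply ptlim_vmul | apply ptlim_translate].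
  - apply functional_extensionality; intros n. now rewrite twisted_Hz_comb.
Qed.

Lemma ptlim_unique F f g : ptlim F f -> ptlim F g -> f = g.
Proof.
  intros Hf Hg. apply field_ext; intros s.
  destruct (Hf s) as [F1 F2], (Hg s) as [G1 G2].
  apply is_lim_seq_unique in F1, F2, G1, G2.
  apply C_eq; [rewrite F1 in G1; now injection G1 | rewrite F2 in G2; now injection G2].
Qed.

Lemma nsum_lim n (F : nat -> nat -> R) f :
  (forall i, (i < n)%nat -> is_lim_seq (fun k => F k i) (Finite (f i))) ->
  is_lim_seq (fun k => nsum n (F k)) (Finite (nsum n f)).
Proof.
  induction n as [|n IH]; intros E; simpl; [apply is_lim_seq_const | ].
  apply is_lim_seq_plus'; auto.
Qed.

(** A Fatou argument: a box is finite, so its sum passes to the pointwise limit. *)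
Lemma l2_le_ptlim F f M : (forall n, l2_le (F n) M) -> ptlim F f -> l2_le f M.
Proof.
  intros HF Hl N.
  apply (is_lim_seq_le (fun n => box_sum N (fun s => Cnorm2 (F n s))) (fun _ => M)
    (Finite (box_sum N (fun s => Cnorm2 (f s)))) (Finite M));
    [intros n; apply HF | | apply is_lim_seq_const].
  rewrite box_sum_rsum.
  apply is_lim_seq_ext with (fun n => rsum (- Z.of_nat N) (2 * N + 1) (- Z.of_nat N)
    (2 * N + 1) (fun s => Cnorm2 (F n s))).
  { intros n. now rewrite box_sum_rsum. }
  apply nsum_lim; intros i _; apply nsum_lim; intros j _.
  unfold Cnorm2. destruct (Hl (- Z.of_nat N + Z.of_nat i, - Z.of_nat N + Z.of_nat j)%Z).
  apply is_lim_seq_plus'; apply is_lim_seq_mult'; assumption.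
Qed.

Lemma re2_le_nn V HV f s : is_l2 f -> re2 f f s <= nn (l2_space V HV) f.
Proof.
  intros Hf. destruct s as [n m].
  replace (re2 f f (n, m)) with (rsum n 1 m 1 (re2 f f)).
  - apply l2_le_rsum with (M := nn (l2_space V HV) f). now apply l2_le_nn.
  - unfold rsum, zsum; simpl. rewrite !Z.add_0_r. ring.
Qed.

Lemma sqrt_pow x k : 0 <= x -> sqrt (x ^ k) = sqrt x ^ k.
Proof.
  intros Hx. induction k as [|k IH]; simpl; [apply sqrt_1 | ].
  rewrite sqrt_mult_alt by assumption. now rewrite IH.
Qed.

(** The iteration below controls squared norms; taking square roots bounds the terms by a geometric
    series of ratio [sqrt rho]. *)
Lemma geom_series_lim (u : nat -> R) D rho : 0 <= D -> 0 <= rho < 1 ->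
  (forall k, u k * u k <= rho ^ k * D) ->
  exists l : R, is_lim_seq (fun n => nsum n u) l.
Proof.
  intros HD Hrho Hu.
  assert (E : ex_series u).
  { apply (ex_series_le (K := R_AbsRing) (V := R_CompleteNormedModule) u
      (fun k => sqrt D * sqrt rho ^ k)).
    - intros k. change (norm (u k)) with (Rabs (u k)).
      rewrite <- (sqrt_pow rho k) by lra. rewrite <- sqrt_mult_alt by lra.
      rewrite <- sqrt_Rsqr_abs. apply sqrt_le_1_alt. unfold Rsqr.
      rewrite Rmult_comm with (r1 := D). apply Hu.
    - apply (ex_series_scal_l (K := R_AbsRing) (sqrt D) (fun k => sqrt rho ^ k)).
      apply ex_series_geom. rewrite Rabs_pos_eq by apply sqrt_pos.
      rewrite <- sqrt_1. apply sqrt_lt_1_alt. lra. }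
  destruct E as [l Hl]. exists l.
  apply is_lim_seq_incr_1.
  eapply is_lim_seq_ext; [ | exact Hl].
  intros n. simpl. induction n as [|n IH].
  - rewrite sum_O. simpl. ring.
  - rewrite sum_Sn, IH. reflexivity.
Qed.

(* With A = H - z, the operator A^*A is inverted by Richardson's iteration: the
   corrections [d k] contract geometrically, so their sum converges at every site. *)
Lemma solve_of_bounded_below V HV z c :
  0 < c -> bounded_below (l2_space V HV) 0 0 z c ->
  forall phi, is_l2 phi -> exists psi, is_l2 psi /\ twisted_Hz V 0 0 z psi = phi.
Proof.
  intros Hc Hbb phi Hphi. destruct (HV) as [B HB].
  set (L := l2_space V HV) in *.
  set (M := 32 + 4 * B * B + 4 * Cnorm2 z).
  assert (HM : 32 <= M) by (unfold M; generalize (Cnorm2_ge0 z); nra).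
  set (A := twisted_Hz V 0 0 z). set (A' := twisted_Hz V 0 0 (Cconj z)).
  assert (dA : forall f, is_l2 f -> is_l2 (A f)) by (intros; now apply (dom_twisted L)).
  assert (dA' : forall f, is_l2 f -> is_l2 (A' f)) by (intros; now apply (dom_twisted L)).
  (* Capping [c] at 1 keeps [tau * c1 <= 1], so that the ratio [rho] is nonnegative. *)
  set (c1 := Rmin c 1).
  assert (Hc1 : 0 < c1 <= 1) by (unfold c1; split; [apply Rmin_glb_lt; lra | apply Rmin_r]).
  assert (low : forall f, is_l2 f -> c1 * nn L f <= nn L (A f)).
  { intros f Hf. eapply Rle_trans; [ | apply Hbb; exact Hf].
    apply Rmult_le_compat_r; [now apply nn_ge0 | apply Rmin_l]. }
  assert (low' : forall f, is_l2 f -> c1 * nn L f <= nn L (A' f)).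
  { intros f Hf. unfold A'. rewrite nn_twisted_conj by exact Hf. now apply low. }
  assert (up' : forall f, is_l2 f -> nn L (A' f) <= M * nn L f).
  { intros f Hf. unfold A'. rewrite nn_twisted_conj by exact Hf.
    now apply nn_twisted_le. }
  set (tau := / M).
  assert (Htau : 0 < tau) by (apply Rinv_0_lt_compat; lra).
  assert (HMt : M * tau = 1) by (unfold tau; field; lra).
  assert (Htau1 : tau <= 1) by nra.
  set (S := fun f => comb 1 f (RtoC (- tau)) (A' (A f))).
  set (rho := 1 - tau * c1).
  assert (Hrho : 0 <= rho < 1) by 
    (assert (0 < tau * c1) by (apply Rmult_lt_0_compat; lra);
     assert (tau * c1 <= 1 * 1) by (apply Rmult_le_compat; lra); unfold rho; lra).
  assert (dS : forall f, is_l2 f -> is_l2 (S f)).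
  { intros f Hf. apply is_l2_comb; auto. }
  (* ||S f||^2 = ||f||^2 - 2 tau ||A f||^2 + tau^2 ||A' A f||^2, and [M * tau = 1] makes the last
     term at most tau ||A f||^2. *)
  assert (contr : forall f, is_l2 f -> nn L (S f) <= rho * nn L f).
  { intros f Hf. unfold S.
    rewrite (nn_comb L 1 (- tau) f (A' (A f))) by (simpl; auto).
    assert (E : ip L f (A' (A f)) = nn L (A f)).
    { rewrite ip_sym. unfold A'. rewrite (twisted_adj L) by (simpl; auto).
      rewrite Cconj_conj. reflexivity. }
    rewrite E.
    assert (U := up' (A f) (dA f Hf)). assert (Lo := low f Hf).
    unfold rho.
    assert (tau * tau * nn L (A' (A f)) <= tau * nn L (A f)).
    { replace (tau * nn L (A f)) with (tau * tau * (M * nn L (A f))) by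
        (replace (tau * tau * (M * nn L (A f))) with (M * tau * (tau * nn L (A f))) by ring;
         rewrite HMt; ring).
      apply Rmult_le_compat_l; [nra | exact U]. }
    nra. }
  set (d := fun k => Nat.iter k S (comb (RtoC tau) phi 0 phi)).
  assert (dd : forall k, is_l2 (d k)).
  { induction k as [|k IH]; [apply is_l2_comb; assumption | apply dS, IH]. }
  set (D := nn L (d O)).
  assert (HD : 0 <= D) by (apply nn_ge0, dd).
  assert (geo : forall k, nn L (d k) <= rho ^ k * D).
  { induction k as [|k IH]; [rewrite pow_O, Rmult_1_l; apply Rle_refl | ].
    change (d (Datatypes.S k)) with (S (d k)). simpl.
    eapply Rle_trans; [apply contr, dd | ]. rewrite Rmult_assoc.
    apply Rmult_le_compat_l; lra. }
  set (U := fix U (n : nat) : field :=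
    match n with O => comb 0 phi 0 phi | Datatypes.S k => comb 1 (U k) 1 (d k) end).
  assert (dU : forall n, is_l2 (U n)).
  { induction n as [|n IH]; apply is_l2_comb; auto. }
  assert (UE : forall n s, U n s = (nsum n (fun k => fst (d k s)), nsum n (fun k => snd (d k s)))).
  { intros n s. induction n as [|n IH].
    - apply C_eq; simpl; ring.
    - change (U (Datatypes.S n) s) with (comb 1 (U n) 1 (d n) s).
      unfold comb. rewrite IH. apply C_eq; simpl; ring. }
  assert (Llin : forall w a f b g, twisted_Hz V 0 0 w (comb a f b g) =
    comb a (twisted_Hz V 0 0 w f) b (twisted_Hz V 0 0 w g)).
  { intros. apply field_ext; intros s. unfold twisted_Hz, twisted_H, comb. cring. }
  assert (tauC : (RtoC (/ tau) * RtoC tau)%C = 1%C).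
  { rewrite <- RtoC_mult. f_equal. field. lra. }
  (* Telescoping: [S] subtracts [tau A' A], so the correction [d n] contributes
     [(d n - d (n + 1)) / tau]. *)
  assert (res : forall n, A' (A (U n)) = comb (RtoC (/ tau)) (d O) (RtoC (- / tau)) (d n)).
  { induction n as [|n IH].
    - change (U O) with (comb 0 phi 0 phi). unfold A', A. rewrite !Llin.
      apply field_ext; intros s. unfold comb. rewrite RtoC_opp. cring.
    - change (U (Datatypes.S n)) with (comb 1 (U n) 1 (d n)).
      unfold A', A. rewrite !Llin. fold (A (U n)) (A (d n)). fold (A' (A (U n))) (A' (A (d n))).
      rewrite IH. change (d (Datatypes.S n)) with (S (d n)). unfold S.
      apply field_ext; intros s. unfold comb. rewrite !RtoC_opp.
      apply Cplus_0_inj.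
      transitivity (RtoC (/ tau) * d O s + - RtoC (/ tau) * d n s +
        (RtoC (/ tau) * RtoC tau) * A' (A (d n)) s)%C; [rewrite tauC; ring | ring]. }
  assert (lim : exists u, ptlim U u).
  { assert (Pk : forall s k, fst (d k s) * fst (d k s) <= rho ^ k * D /\
                            snd (d k s) * snd (d k s) <= rho ^ k * D).
    { intros s k. assert (P := re2_le_nn V HV (d k) s (dd k)). fold L in P.
      specialize (geo k). unfold re2 in P. split; nra. }
    assert (P : forall s, exists w : C, is_lim_seq (fun n => fst (U n s)) (fst w) /\
                             is_lim_seq (fun n => snd (U n s)) (snd w)).
    { intros s.
      destruct (geom_series_lim (fun k => fst (d k s)) D rho HD Hrho (fun k => proj1 (Pk s k)))
        as [l1 Hl1].
      destruct (geom_series_lim (fun k => snd (d k s)) D rho HD Hrho (fun k => proj2 (Pk s k)))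
        as [l2 Hl2].
      exists (l1, l2). split; simpl.
      - eapply is_lim_seq_ext; [ | exact Hl1]. intros n. now rewrite UE.
      - eapply is_lim_seq_ext; [ | exact Hl2]. intros n. now rewrite UE. }
    apply choice in P. destruct P as [u Hu]. exists u. exact Hu. }
  destruct lim as [u Hu].
  assert (du : is_l2 u).
  (* The lower bounds for [A] and [A'] turn the telescoped identity into a bound on [U n] that does
     not depend on [n]. *)
  { set (K := 4 * (/ tau * / tau) * D / (c1 * c1)).
    exists K. apply l2_le_ptlim with U; [ | exact Hu]. intros n.
    assert (N1 : nn L (U n) <= K).
    { assert (E1 := low (U n) (dU n)). assert (E2 := low' (A (U n)) (dA _ (dU n))).
      rewrite res in E2. rewrite (comb_split (RtoC (/ tau))) in E2.
      assert (E3 := nn_add_le L (comb (RtoC (/ tau)) (d O) 0 (d O))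
         (comb (RtoC (- / tau)) (d n) 0 (d n))
         (is_l2_comb _ _ _ _ (dd O) (dd O)) (is_l2_comb _ _ _ _ (dd n) (dd n))).
      rewrite !(nn_scal L) in E3 by apply dd.
      replace (Cnorm2 (RtoC (/ tau))) with (/ tau * / tau) in E3 by
        (unfold Cnorm2; simpl; ring).
      replace (Cnorm2 (RtoC (- / tau))) with (/ tau * / tau) in E3 by
        (unfold Cnorm2; simpl; ring).
      assert (E4 : nn L (d n) <= D).
      { eapply Rle_trans; [apply geo | ].
        assert (rho ^ n <= 1) by
          (rewrite <- (pow1 n); apply pow_incr; lra).
        nra. }
      fold D in E3. set (t2 := / tau * / tau) in *.
      assert (0 <= t2) by (unfold t2; nra).
      assert (c1 * c1 * nn L (U n) <= 4 * t2 * D) by nra.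
      unfold K. apply (Rmult_le_reg_l (c1 * c1)); [nra | ].
      replace (c1 * c1 * (4 * t2 * D / (c1 * c1))) with (4 * t2 * D) by (field; lra).
      assumption. }
    intros N. eapply Rle_trans; [ | exact N1]. apply (l2_le_nn V HV (U n) (dU n)). }
  assert (sol : A' (A u) = phi).
  { apply ptlim_unique with (fun n => A' (A (U n))).
    - unfold A', A. apply ptlim_twisted, ptlim_twisted, Hu.
    - replace phi with (comb (RtoC (/ tau)) (d O) (RtoC (- / tau)) (comb 0 phi 0 phi)).
      + replace (fun n => A' (A (U n))) with
          (fun n => comb (RtoC (/ tau)) (d O) (RtoC (- / tau)) (d n)) by
          (apply functional_extensionality; intros n; now rewrite res).
        apply ptlim_comb; [apply ptlim_const | ].
        intros s.
        assert (P : forall w : nat -> R, (forall n, w n * w n <= rho ^ n * D) ->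
          is_lim_seq w 0).
        { intros w Hw. destruct (geom_series_lim w D rho HD Hrho Hw) as [l Hl].
          assert (H1 := Hl). apply is_lim_seq_incr_1 in H1.
          assert (H2 := is_lim_seq_minus' _ _ _ _ H1 Hl).
          rewrite Rminus_diag in H2. eapply is_lim_seq_ext; [ | exact H2].
          intros n. simpl. ring. }
        assert (Pk : forall k, fst (d k s) * fst (d k s) <= rho ^ k * D /\
                            snd (d k s) * snd (d k s) <= rho ^ k * D).
        { intros k. assert (P' := re2_le_nn V HV (d k) s (dd k)). fold L in P'.
          specialize (geo k). unfold re2 in P'. split; nra. }
        replace (comb 0 phi 0 phi s) with (0, 0) by
          (apply C_eq; unfold comb; simpl; ring).
        split; apply P; intros n; apply Pk.
      + apply field_ext; intros s. unfold comb. change (d O s) with (comb (RtoC tau) phi 0 phi s).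
        unfold comb. apply Cplus_0_inj.
        transitivity ((RtoC (/ tau) * RtoC tau) * phi s)%C; [ring | rewrite tauC; ring]. }
  (* [A] and [A'] commute, so [A (A' u) = A' (A u) = phi]. *)
  exists (A' u). split; [now apply dA' | ].
  rewrite <- sol. unfold A, A'. apply twisted_comm.
Qed.

Lemma resolvent_of_bounded_below V HV z c : 0 < c ->
  bounded_below (l2_space V HV) 0 0 z c -> resolvent V z.
Proof.
  intros Hc Hbb. exists (/ c). split; [now apply Rinv_0_lt_compat | ].
  set (L := l2_space V HV) in *.
  assert (bound : forall f, is_l2 f -> nn L f <= / c * nn L (twisted_Hz V 0 0 z f)).
  { intros f Hf. apply (Rmult_le_reg_l c); [assumption | ].
    rewrite <- Rmult_assoc, Rinv_r, Rmult_1_l by lra. now apply Hbb. }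
  intros phi Hphi.
  destruct (solve_of_bounded_below V HV z c Hc Hbb phi Hphi) as [psi [Hpsi E]].
  exists psi. split; [assumption | ]. split; [intros x; now rewrite Hz_twisted, E | ]. split.
  - intros psi' Hpsi' E'.
    set (w := comb 1 psi' (-1) psi).
    assert (Hw : is_l2 w) by now apply is_l2_comb.
    assert (Ew : twisted_Hz V 0 0 z w = comb 0 phi 0 phi).
    { apply field_ext; intros s.
      transitivity (twisted_Hz V 0 0 z psi' s - twisted_Hz V 0 0 z psi s)%C.
      - unfold w, twisted_Hz, twisted_H, comb. cring.
      - rewrite E. rewrite <- Hz_twisted. rewrite E'. unfold comb. cring. }
    assert (B := bound w Hw). rewrite Ew, (nn_scal L) in B by assumption.
    replace (Cnorm2 (RtoC 0)) with 0 in B by (unfold Cnorm2; simpl; ring).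
    intros s. assert (P := re2_le_nn V HV w s Hw). fold L in P.
    rewrite Rmult_0_l, Rmult_0_r in B.
    unfold re2 in P.
    assert (P1 : fst (w s) = 0) by nra. assert (P2 : snd (w s) = 0) by nra.
    unfold w, comb in P1, P2; simpl in P1, P2. apply C_eq; lra.
  - intros M HM N. eapply Rle_trans; [apply (l2_le_nn V HV psi Hpsi) | ]. fold L.
    eapply Rle_trans; [now apply bound | ]. rewrite E.
    apply Rmult_le_compat_l; [left; now apply Rinv_0_lt_compat | ].
    now apply nn_le_l2.
Qed.

Lemma resolvent_nonreal V (HV : exists B, forall s, Rabs (V s) <= B) a b : b <> 0 -> resolvent V (a, b).
Proof.
  intros Hb. apply resolvent_of_bounded_below with (HV := HV) (c := b * b); [nra | ].
  intros f Hf. rewrite nn_complex_z by assumption.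
  assert (0 <= nn (l2_space V HV) (twisted_Hz V 0 0 (RtoC a) f)); [ | lra].
  apply nn_ge0, dom_twisted, Hf.
Qed.

(** * Bloch waves *)

Definition cnn (p q : nat) (f : field) : R := rsum 0 p 0 q (re2 f f).

Definition cell_below (p q : nat) (V : pot) (x y : R) (z : C) (c : R) : Prop :=
  forall f, per (Z.of_nat p) (Z.of_nat q) f ->
    c * cnn p q f <= cnn p q (twisted_Hz V x y z f).

Lemma nsum_split3 (k m l : nat) f :
  nsum (k + (m + l)) f =
  nsum k f + nsum m (fun i => f (k + i)%nat) + nsum l (fun i => f (k + (m + i))%nat).
Proof. rewrite !nsum_split. ring. Qed.

Lemma zsum_support a n b m f : (forall i, 0 <= f i) ->
  (forall i, ~ (a <= i < a + Z.of_nat n)%Z -> f i = 0) -> zsum b m f <= zsum a n f.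
Proof.
  intros Hf Hs.
  set (l := Z.min a b). set (h := Z.max (a + Z.of_nat n) (b + Z.of_nat m)).
  apply Rle_trans with (zsum l (Z.to_nat (h - l)) f).
  - apply zsum_sub; try assumption; lia.
  - right. unfold zsum.
    replace (Z.to_nat (h - l)) with
      (Z.to_nat (a - l) + (n + Z.to_nat (h - a - Z.of_nat n)))%nat by lia.
    rewrite nsum_split3.
    rewrite (nsum_ext _ (fun i => f (l + Z.of_nat i)%Z) (fun _ => 0)) by
      (intros; apply Hs; lia).
    rewrite (nsum_ext n (fun i => f (l + Z.of_nat (Z.to_nat (a - l) + i))%Z)
      (fun i => f (a + Z.of_nat i)%Z)) by (intros; f_equal; lia).
    rewrite (nsum_ext (Z.to_nat (h - a - Z.of_nat n)) _ (fun _ => 0)) by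
      (intros; apply Hs; lia).
    rewrite !nsum_const. ring.
Qed.

Lemma rsum_support a n b m a' n' b' m' F : (forall s, 0 <= F s) ->
  (forall i j, ~ ((a <= i < a + Z.of_nat n)%Z /\ (b <= j < b + Z.of_nat m)%Z) ->
     F (i, j) = 0) ->
  rsum a' n' b' m' F <= rsum a n b m F.
Proof.
  intros HF Hs. unfold rsum.
  apply Rle_trans with (zsum a' n' (fun i => zsum b m (fun j => F (i, j)))).
  - apply zsum_le; intros i _. apply zsum_support; [auto | ].
    intros j Hj. apply Hs. tauto.
  - apply zsum_support.
    + intros i. apply nsum_ge0; auto.
    + intros i Hi. unfold zsum. rewrite (nsum_ext _ _ (fun _ => 0)).
      * rewrite nsum_const; ring.
      * intros; apply Hs; tauto.
Qed.

Lemma zsum_delta_le a n k : zsum a n (fun i => if Z.eq_dec i k then 1 else 0) <= 1.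
Proof.
  apply Rle_trans with (zsum k 1 (fun i => if Z.eq_dec i k then 1 else 0)).
  - apply zsum_support; intros i; destruct (Z.eq_dec i k); intros; try lra; lia.
  - unfold zsum; simpl. destruct (Z.eq_dec (k + 0) k); lra.
Qed.

Lemma zsum_mul_periodic N p f : (forall i, f (i + Z.of_nat p)%Z = f i) ->
  zsum 0 (N * p) f = INR N * zsum 0 p f.
Proof.
  intros Hf. unfold zsum. rewrite nsum_mul.
  rewrite (nsum_ext N _ (fun _ => zsum 0 p f)).
  - now rewrite nsum_const.
  - intros j _. rewrite <- (zsum_periodic (Z.of_nat (j * p)) 0 p f Hf).
    unfold zsum. apply nsum_ext; intros; f_equal; lia.
Qed.

Lemma per_mul {T} N M p q (F : (Z * Z)%type -> T) :
  per (Z.of_nat p) (Z.of_nat q) F -> per (Z.of_nat (N * p)) (Z.of_nat (M * q)) F.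
Proof.
  intros HF n m. split.
  - induction N as [|N IH].
    + replace (n + Z.of_nat (0 * p))%Z with n by lia. reflexivity.
    + replace (n + Z.of_nat (S N * p))%Z with (n + Z.of_nat (N * p) + Z.of_nat p)%Z by lia.
      now rewrite (proj1 (HF _ m)).
  - induction M as [|M IH].
    + replace (m + Z.of_nat (0 * q))%Z with m by lia. reflexivity.
    + replace (m + Z.of_nat (S M * q))%Z with (m + Z.of_nat (M * q) + Z.of_nat q)%Z by lia.
      now rewrite (proj2 (HF n _)).
Qed.

Lemma rsum_mul_periodic N M p q F : per (Z.of_nat p) (Z.of_nat q) F ->
  rsum 0 (N * p) 0 (M * q) F = INR N * INR M * rsum 0 p 0 q F.
Proof.
  intros HF. unfold rsum. rewrite zsum_mul_periodic.
  - rewrite (zsum_ext 0 p _ (fun i => INR M * zsum 0 q (fun j => F (i, j)))).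
    + unfold zsum at 1. rewrite nsum_scal. unfold zsum. ring.
    + intros i _. apply zsum_mul_periodic. intros; apply HF.
  - intros i. apply zsum_ext; intros; apply HF.
Qed.

Lemma Cnorm2_add_le (a b : C) : Cnorm2 (a + b)%C <= 2 * Cnorm2 a + 2 * Cnorm2 b.
Proof.
  unfold Cnorm2; simpl.
  generalize (Rle_0_sqr (fst a - fst b)), (Rle_0_sqr (snd a - snd b)); unfold Rsqr; lra.
Qed.

Lemma Cnorm2_twisted_le V B x y z f S s : (forall s, Rabs (V s) <= B) ->
  (forall s, Cnorm2 (f s) <= S) ->
  Cnorm2 (twisted_Hz V x y z f s) <= (32 + 4 * B * B + 4 * Cnorm2 z) * S.
Proof.
  intros HB HS. rewrite twisted_Hz_comb. unfold comb, vmul, translate.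
  assert (HS0 : 0 <= S) by (eapply Rle_trans; [apply (Cnorm2_ge0 (f s)) | apply HS]).
  assert (P : forall t s, Cnorm2 (cis t * f s)%C <= S).
  { intros. rewrite Cnorm2_mul, Cnorm2_cis, Rmult_1_l. apply HS. }
  assert (PV : Cnorm2 (RtoC (V s) * f s)%C <= B * B * S).
  { rewrite Cnorm2_mul. apply Rmult_le_compat; try apply Cnorm2_ge0; [ | apply HS].
    unfold Cnorm2; simpl. specialize (HB s). apply Rabs_le_between in HB. nra. }
  assert (Pz : Cnorm2 (- z * f s)%C <= Cnorm2 z * S).
  { rewrite Cnorm2_mul. replace (Cnorm2 (- z)%C) with (Cnorm2 z) by
      (unfold Cnorm2; simpl; ring).
    apply Rmult_le_compat_l; [apply Cnorm2_ge0 | apply HS]. }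
  rewrite !Cmult_1_l.
  eapply Rle_trans; [apply Cnorm2_add_le | ].
  match goal with |- 2 * Cnorm2 (?a + ?b)%C + 2 * Cnorm2 (?c + ?d)%C <= _ =>
    assert (A1 := Cnorm2_add_le a b); assert (A2 := Cnorm2_add_le c d);
    match a with (?a1 + ?a2)%C => assert (A3 := Cnorm2_add_le a1 a2) end;
    match b with (?a1 + ?a2)%C => assert (A4 := Cnorm2_add_le a1 a2) end end.
  repeat match type of A3 with context [Cnorm2 (cis ?t * f ?u)%C] =>
    let Q := fresh in assert (Q := P t u); revert Q;
    generalize dependent (Cnorm2 (cis t * f u)%C); intros end.
  repeat match type of A4 with context [Cnorm2 (cis ?t * f ?u)%C] =>
    let Q := fresh in assert (Q := P t u); revert Q;
    generalize dependent (Cnorm2 (cis t * f u)%C); intros end.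
  lra.
Qed.

Lemma per_bounded p q (f : field) : (0 < p)%nat -> (0 < q)%nat ->
  per (Z.of_nat p) (Z.of_nat q) f -> forall s, Cnorm2 (f s) <= cnn p q f.
Proof.
  intros Hp Hq Hf [n m]. unfold cnn.
  rewrite (rsum_periodic 0 0 n m p q (re2 f f)) by now apply per_re2.
  apply Rle_trans with (rsum n 1 m 1 (re2 f f)).
  - unfold rsum, zsum; simpl. rewrite !Z.add_0_r. unfold re2, Cnorm2. lra.
  - apply rsum_sub; [apply re2_ge0 | lia..].
Qed.

Lemma per_twisted p q V x y z f : per (Z.of_nat p) (Z.of_nat q) V ->
  per (Z.of_nat p) (Z.of_nat q) f ->
  per (Z.of_nat p) (Z.of_nat q) (twisted_Hz V x y z f).
Proof. intros HV. apply (dom_twisted (cell_space p q V HV)). Qed.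

Definition bloch (x y : R) (v : field) : field :=
  fun s => (cis (IZR (fst s) * x + IZR (snd s) * y) * v s)%C.

Lemma twisted_bloch V x y z v :
  twisted_Hz V 0 0 z (bloch x y v) = bloch x y (twisted_Hz V x y z v).
Proof.
  apply field_ext; intros [n m]. unfold twisted_Hz, twisted_H, bloch; simpl.
  rewrite Ropp_0, cis_0, !minus_IZR, !plus_IZR.
  replace ((IZR n - 1) * x + IZR m * y) with (IZR n * x + IZR m * y + - x) by ring.
  replace ((IZR n + 1) * x + IZR m * y) with (IZR n * x + IZR m * y + x) by ring.
  replace (IZR n * x + (IZR m - 1) * y) with (IZR n * x + IZR m * y + - y) by ring.
  replace (IZR n * x + (IZR m + 1) * y) with (IZR n * x + IZR m * y + y) by ring.
  rewrite !cis_add. cring.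
Qed.

Definition in_box (a b : nat) (s : (Z * Z)%type) : bool :=
  ((0 <=? fst s) && (fst s <? Z.of_nat a) && (0 <=? snd s) && (snd s <? Z.of_nat b))%Z%bool.

Lemma in_box_spec a b s : in_box a b s = true <->
  (0 <= fst s < Z.of_nat a)%Z /\ (0 <= snd s < Z.of_nat b)%Z.
Proof.
  unfold in_box. rewrite !Bool.andb_true_iff, !Z.leb_le, !Z.ltb_lt. tauto.
Qed.

Definition delta (k i : Z) : R := if Z.eq_dec i k then 1 else 0.

Lemma delta_ge0 k i : 0 <= delta k i.
Proof. unfold delta; destruct (Z.eq_dec i k); lra. Qed.

Lemma delta_eq k i : i = k -> delta k i = 1.
Proof. intros ->. unfold delta; destruct (Z.eq_dec k k); [reflexivity | contradiction]. Qed.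

(* Restricting a Bloch wave to N x N cells costs only a boundary term O(N),
   against a squared norm of order N^2. *)
Lemma cell_below_of_l2 V HV p q x y z c : (0 < p)%nat -> (0 < q)%nat ->
  per (Z.of_nat p) (Z.of_nat q) V -> 0 < c ->
  bounded_below (l2_space V HV) 0 0 z c -> cell_below p q V x y z c.
Proof.
  intros Hp Hq HVp Hc Hbb v Hv.
  assert (HV' := HV). destruct HV' as [B HB].
  set (L := l2_space V HV) in *.
  set (w := twisted_Hz V x y z v).
  set (S := cnn p q v). set (M := 32 + 4 * B * B + 4 * Cnorm2 z).
  assert (HS : forall s, Cnorm2 (v s) <= S) by now apply per_bounded.
  assert (HS0 : 0 <= S) by (apply Rle_trans with (2 := HS (0, 0)%Z), Cnorm2_ge0).
  assert (HM : 0 <= M) by (unfold M; generalize (Cnorm2_ge0 z), (Rle_0_sqr B); unfold Rsqr; lra).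
  assert (HMS : 0 <= M * S) by now apply Rmult_le_pos.
  set (X := cnn p q w).
  assert (HX : 0 <= X) by (apply rsum_ge0, re2_ge0).
  (* The truncated wave has squared norm at least [N^2 S], its image at most [(N + 2)^2 X] plus a
     boundary term. [Y] collects what is of order [N], divided by [N]; here [4 N + 4 <= 8 N]. *)
  set (Y := 8 * X + M * S * (4 * INR (p + q + 4))).
  assert (key : forall N, (1 <= N)%nat -> INR N * (c * S - X) <= Y).
  { intros N HN.
    set (a := (N * p)%nat). set (b := (N * q)%nat).
    set (psi := (fun s => if in_box a b s then bloch x y v s else RtoC 0) : field).
    assert (Hb : forall s, Cnorm2 (bloch x y v s) = Cnorm2 (v s)).
    { intros s. unfold bloch. rewrite Cnorm2_mul, Cnorm2_cis. ring. }
    assert (psi_sup : forall i j,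
      ~ ((0 <= i < 0 + Z.of_nat a)%Z /\ (0 <= j < 0 + Z.of_nat b)%Z) -> psi (i, j) = RtoC 0).
    { intros i j Hij. unfold psi. destruct (in_box a b (i, j)) eqn:E; [ | reflexivity].
      apply in_box_spec in E. simpl in E. lia. }
    assert (psi_in : forall i j, (0 <= i < Z.of_nat a)%Z -> (0 <= j < Z.of_nat b)%Z ->
      psi (i, j) = bloch x y v (i, j)).
    { intros i j Hi Hj. unfold psi. destruct (in_box a b (i, j)) eqn:E; [reflexivity | ].
      rewrite (proj2 (in_box_spec a b (i, j))) in E; [discriminate | auto]. }
    assert (psi_S : forall s, Cnorm2 (psi s) <= S).
    { intros s. unfold psi. destruct (in_box a b s); [rewrite Hb; apply HS | ].
      unfold Cnorm2; simpl. lra. }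
    assert (dpsi : is_l2 psi).
    { exists (rsum 0 a 0 b (re2 psi psi)). intros k. rewrite box_sum_rsum.
      apply rsum_support; [apply re2_ge0 | ]. intros i j Hij.
      rewrite psi_sup by assumption. unfold Cnorm2; simpl; ring. }
    assert (low : INR N * INR N * S <= nn L psi).
    { unfold S, cnn. rewrite <- rsum_mul_periodic by now apply per_re2.
      apply Rle_trans with (rsum 0 a 0 b (re2 psi psi)).
      - right. apply rsum_ext. intros i j Hi Hj.
        rewrite !re2_Cnorm2, psi_in, Hb by lia. reflexivity.
      - apply l2_le_rsum with (M := nn L psi). now apply l2_le_nn. }
    (* At least 1 on the lines of sites on both sides of each edge of the box. Elsewhere the image
       of the truncated wave is that of the full wave inside the box and 0 outside. *)
    set (bd := fun s : (Z * Z)%type =>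
      (delta (-1) (fst s) + delta 0 (fst s)) +
      (delta (Z.of_nat a - 1) (fst s) + delta (Z.of_nat a) (fst s)) +
      ((delta (-1) (snd s) + delta 0 (snd s)) +
      (delta (Z.of_nat b - 1) (snd s) + delta (Z.of_nat b) (snd s)))).
    set (T := twisted_Hz V 0 0 z psi).
    assert (up : nn L T <= rsum (-1) (a + 2) (-1) (b + 2)
                   (fun s => 1 * re2 w w s + (M * S) * bd s)).
    { apply nn_le_l2; [apply (dom_twisted L); exact dpsi | ].
      intros k. rewrite box_sum_rsum. change (fun s => Cnorm2 (T s)) with (re2 T T).
      apply Rle_trans with (rsum (-1) (a + 2) (-1) (b + 2) (re2 T T)).
      - apply rsum_support; [apply re2_ge0 | ].
        intros i j Hij. unfold re2.
        replace (T (i, j)) with (RtoC 0); [simpl; ring | ].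
        unfold T, twisted_Hz, twisted_H; simpl. rewrite !psi_sup by lia. ring.
      - apply rsum_le. intros i j Hi Hj.
        assert (HTS : re2 T T (i, j) <= M * S).
        { rewrite re2_Cnorm2. now apply Cnorm2_twisted_le. }
        assert (Hbd0 : 0 <= bd (i, j)).
        { unfold bd. repeat apply Rplus_le_le_0_compat; apply delta_ge0. }
        assert (Hw := re2_ge0 w (i, j)).
        assert (D : (1 <= i < Z.of_nat a - 1)%Z /\ (1 <= j < Z.of_nat b - 1)%Z \/
          i = (-1)%Z \/ i = 0%Z \/ i = (Z.of_nat a - 1)%Z \/ i = Z.of_nat a \/
          j = (-1)%Z \/ j = 0%Z \/ j = (Z.of_nat b - 1)%Z \/ j = Z.of_nat b) by lia.
        destruct D as [[Hi' Hj'] | D].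
        + replace (re2 T T (i, j)) with (re2 w w (i, j)).
          * assert (0 <= M * S * bd (i, j)) by now apply Rmult_le_pos. lra.
          * rewrite !re2_Cnorm2. unfold T.
            transitivity (Cnorm2 (twisted_Hz V 0 0 z (bloch x y v) (i, j))).
            -- rewrite twisted_bloch. unfold bloch. rewrite Cnorm2_mul, Cnorm2_cis.
               unfold w. ring.
            -- f_equal. unfold twisted_Hz, twisted_H; simpl. rewrite !psi_in by lia.
               reflexivity.
        + assert (1 <= bd (i, j)).
          { unfold bd; simpl.
            assert (G := delta_ge0).
            assert (G1 := G (-1)%Z i). assert (G2 := G 0%Z i).
            assert (G3 := G (Z.of_nat a - 1)%Z i). assert (G4 := G (Z.of_nat a) i).
            assert (G5 := G (-1)%Z j). assert (G6 := G 0%Z j).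
            assert (G7 := G (Z.of_nat b - 1)%Z j). assert (G8 := G (Z.of_nat b) j).
            destruct D as [E|[E|[E|[E|[E|[E|[E|E]]]]]]]; apply delta_eq in E; lra. }
          assert (M * S * 1 <= M * S * bd (i, j)) by now apply Rmult_le_compat_l.
          lra. }
    rewrite rsum_lin in up.
    assert (wp : per (Z.of_nat p) (Z.of_nat q) (re2 w w)).
    { apply per_re2; now apply per_twisted. }
    assert (U1 : rsum (-1) (a + 2) (-1) (b + 2) (re2 w w) <= INR (N + 2) * INR (N + 2) * X).
    { unfold X, cnn. rewrite <- rsum_mul_periodic by assumption.
      apply Rle_trans with (rsum (-1) ((N + 2) * p) (-1) ((N + 2) * q) (re2 w w)).
      - apply rsum_sub; [apply re2_ge0 | ..]; unfold a, b; nia.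
      - right. now apply rsum_periodic, per_mul. }
    assert (U2 : rsum (-1) (a + 2) (-1) (b + 2) bd <= 4 * INR (b + 2) + 4 * INR (a + 2)).
    { assert (R1 : forall k, rsum (-1) (a + 2) (-1) (b + 2) (fun s => delta k (fst s))
                     <= INR (b + 2)).
      { intros k. unfold rsum; simpl.
        rewrite (zsum_ext _ _ _ (fun i => INR (b + 2) * delta k i)) by
          (intros; unfold zsum; apply nsum_const).
        unfold zsum at 1. rewrite nsum_scal.
        assert (D := zsum_delta_le (-1) (a + 2) k). unfold zsum in D.
        unfold delta. generalize (pos_INR (b + 2)). nra. }
      assert (R2 : forall k, rsum (-1) (a + 2) (-1) (b + 2) (fun s => delta k (snd s))
                     <= INR (a + 2)).
      { intros k. unfold rsum; simpl.
        apply Rle_trans with (zsum (-1) (a + 2) (fun _ => 1)).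
        - apply zsum_le; intros. apply zsum_delta_le.
        - unfold zsum. rewrite nsum_const. lra. }
      assert (RL : forall F G, rsum (-1) (a + 2) (-1) (b + 2) (fun s => F s + G s) =
        rsum (-1) (a + 2) (-1) (b + 2) F + rsum (-1) (a + 2) (-1) (b + 2) G).
      { intros F G. rewrite <- (Rmult_1_l (rsum _ _ _ _ F)), <- (Rmult_1_l (rsum _ _ _ _ G)).
        rewrite <- rsum_lin. apply rsum_ext; intros; ring. }
      unfold bd. rewrite !RL.
      generalize (R1 (-1)%Z), (R1 0%Z), (R1 (Z.of_nat a - 1)%Z), (R1 (Z.of_nat a)),
        (R2 (-1)%Z), (R2 0%Z), (R2 (Z.of_nat b - 1)%Z), (R2 (Z.of_nat b)). lra. }
    assert (bb := Hbb psi dpsi). fold T in bb.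
    assert (HN1 : 1 <= INR N) by (change 1 with (INR 1); now apply le_INR).
    assert (E2 : forall n k, INR (n * k + 2) = INR n * INR k + 2) by
      (intros; rewrite plus_INR, mult_INR; simpl; ring).
    change (INR (a + 2)) with (INR (N * p + 2)) in U2.
    change (INR (b + 2)) with (INR (N * q + 2)) in U2.
    rewrite (E2 N p), (E2 N q) in U2.
    replace (INR (N + 2)) with (INR N + 2) in U1 by (rewrite plus_INR; simpl; ring).
    assert (HpR := pos_INR p). assert (HqR := pos_INR q).
    unfold Y. rewrite !plus_INR. simpl (INR 4).
    apply (Rmult_le_reg_l (INR N)); [lra | ].
    assert (Z1 : M * S * rsum (-1) (a + 2) (-1) (b + 2) bd <=
      M * S * (INR N * (4 * (INR p + INR q + (1 + 1 + 1 + 1))))).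
    { apply Rmult_le_compat_l; [assumption | ]. eapply Rle_trans; [exact U2 | ]. nra. }
    assert (Z2 : (INR N + 2) * (INR N + 2) * X <= (INR N * INR N + 8 * INR N) * X).
    { apply Rmult_le_compat_r; [assumption | nra]. }
    assert (Z3 : c * (INR N * INR N * S) <= c * nn L psi) by
      (apply Rmult_le_compat_l; lra).
    nra. }
  apply Rnot_lt_le. intros Hlt. fold S X in Hlt.
  destruct (INR_unbounded (Y / (c * S - X))) as [N HN].
  assert (Hd : 0 < c * S - X) by lra.
  assert (K := key (Datatypes.S N) ltac:(lia)). rewrite S_INR in K.
  assert (Y < INR N * (c * S - X)).
  { replace Y with (Y / (c * S - X) * (c * S - X)) by (field; lra).
    now apply Rmult_lt_compat_r. }
  lra.
Qed.

(** * Floquet transform *)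

Lemma sin_add_2PI_Z x (d : Z) : sin (x + 2 * PI * IZR d) = sin x.
Proof.
  destruct (Z_le_gt_dec 0 d) as [H0 | H0].
  - replace d with (Z.of_nat (Z.to_nat d)) by lia. rewrite <- INR_IZR_INZ.
    replace (x + 2 * PI * INR (Z.to_nat d)) with (x + 2 * INR (Z.to_nat d) * PI) by ring.
    apply sin_period.
  - replace (IZR d) with (- INR (Z.to_nat (- d))) by (rewrite INR_IZR_INZ, <- opp_IZR; f_equal; lia).
    rewrite <- (sin_period (x + 2 * PI * - INR (Z.to_nat (- d))) (Z.to_nat (- d))).
    f_equal. ring.
Qed.

Lemma cos_add_2PI_Z x (d : Z) : cos (x + 2 * PI * IZR d) = cos x.
Proof.
  rewrite <- !sin_shift.
  replace (PI / 2 - (x + 2 * PI * IZR d)) with (PI / 2 - x + 2 * PI * IZR (- d)) by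
    (rewrite opp_IZR; ring).
  apply sin_add_2PI_Z.
Qed.

Lemma cis_add_2PI_Z x (d : Z) : cis (x + 2 * PI * IZR d) = cis x.
Proof. apply C_eq; simpl; [apply cos_add_2PI_Z | apply sin_add_2PI_Z]. Qed.

(** Multiplied by [2 sin h], with [h = pi d / K], the sums telescope, and the end terms cancel by
    periodicity; [0 < |d| < K] makes [sin h] nonzero. *)
Lemma trig_sums K (d : Z) : (0 < K)%nat -> (0 < Z.abs d < Z.of_nat K)%Z ->
  nsum K (fun s => cos (2 * PI * INR s * IZR d / INR K)) = 0 /\
  nsum K (fun s => sin (2 * PI * INR s * IZR d / INR K)) = 0.
Proof.
  intros HK Hd.
  assert (HKR : 0 < INR K) by now apply lt_0_INR.
  set (h := PI * IZR d / INR K).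
  assert (Hpi := PI_RGT_0).
  assert (Hs : sin h <> 0).
  { assert (P : forall e, (0 < e < Z.of_nat K)%Z -> 0 < sin (PI * IZR e / INR K)).
    { intros e [E1 E2]. apply IZR_lt in E1, E2. rewrite <- INR_IZR_INZ in E2.
      apply sin_gt_0.
      - apply Rdiv_lt_0_compat; [apply Rmult_lt_0_compat; assumption | assumption].
      - apply Rlt_div_l; [assumption | ]. now apply Rmult_lt_compat_l. }
    destruct (Z_lt_ge_dec 0 d) as [H0 | H0].
    - specialize (P d). unfold h. assert (0 < sin (PI * IZR d / INR K)) by (apply P; lia). lra.
    - assert (0 < sin (PI * IZR (- d) / INR K)) by (apply P; lia).
      rewrite opp_IZR in H.
      replace (PI * - IZR d / INR K) with (- h) in H by (unfold h; field; lra).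
      rewrite sin_neg in H. lra. }
  assert (T : forall n,
    2 * sin h * nsum n (fun s => cos (2 * PI * INR s * IZR d / INR K)) =
      sin (2 * INR n * h - h) + sin h /\
    2 * sin h * nsum n (fun s => sin (2 * PI * INR s * IZR d / INR K)) =
      cos h - cos (2 * INR n * h - h)).
  { induction n as [|n [IH1 IH2]].
    - simpl. rewrite !Rmult_0_r, Rmult_0_l, Rminus_0_l, sin_neg, cos_neg. lra.
    - simpl nsum. rewrite !Rmult_plus_distr_l, IH1, IH2, S_INR.
      replace (2 * PI * INR n * IZR d / INR K) with (2 * INR n * h) by
        (unfold h; field; lra).
      replace (2 * (INR n + 1) * h - h) with (2 * INR n * h + h) by ring.
      rewrite sin_minus, sin_plus, cos_minus, cos_plus. lra. }
  destruct (T K) as [T1 T2].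
  assert (E : 2 * INR K * h - h = - h + 2 * PI * IZR d) by (unfold h; field; lra).
  rewrite E, sin_add_2PI_Z, sin_neg in T1. rewrite E, cos_add_2PI_Z, cos_neg in T2.
  split; apply (Rmult_eq_reg_l (2 * sin h)); lra.
Qed.

Lemma nsum_sqr K u : nsum K u * nsum K u = nsum K (fun j => nsum K (fun j' => u j * u j')).
Proof.
  rewrite (nsum_ext K (fun j => nsum K (fun j' => u j * u j')) (fun j => nsum K u * u j)).
  - now rewrite nsum_scal.
  - intros j _. rewrite nsum_scal. ring.
Qed.

(** The phase [INR s * th] depends on the frequency [s] only, so it drops out of the moduli. It
    accounts for the position inside the cell at which a residue class of sites starts. *)
Lemma dft_parseval K (th : R) (g : nat -> C) : (0 < K)%nat ->
  nsum K (fun s =>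
    let a := fun j => (cis (- (INR s * th + 2 * PI * INR s * INR j / INR K)) * g j)%C in
    nsum K (fun j => fst (a j)) * nsum K (fun j => fst (a j)) +
    nsum K (fun j => snd (a j)) * nsum K (fun j => snd (a j))) =
  INR K * nsum K (fun j => Cnorm2 (g j)).
Proof.
  intros HK. assert (HKR : 0 < INR K) by now apply lt_0_INR.
  set (al := fun j j' => fst (g j) * fst (g j') + snd (g j) * snd (g j')).
  set (be := fun j j' => snd (g j) * fst (g j') - fst (g j) * snd (g j')).
  set (ph := fun s (d : Z) => 2 * PI * INR s * IZR d / INR K).
  transitivity (nsum K (fun s => nsum K (fun j => nsum K (fun j' =>
    al j j' * cos (ph s (Z.of_nat j - Z.of_nat j')%Z) +
    be j j' * sin (ph s (Z.of_nat j - Z.of_nat j')%Z))))).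
  { apply nsum_ext; intros s _. cbv zeta. rewrite !nsum_sqr.
    match goal with |- nsum K ?f + nsum K ?g = _ =>
      rewrite <- (Rmult_1_l (nsum K f)), <- (Rmult_1_l (nsum K g)) end.
    rewrite <- nsum_lin. apply nsum_ext; intros j _.
    rewrite <- nsum_lin. apply nsum_ext; intros j' _.
    unfold ph. rewrite minus_IZR, <- !INR_IZR_INZ.
    set (A := INR s * th + 2 * PI * INR s * INR j / INR K).
    set (B := INR s * th + 2 * PI * INR s * INR j' / INR K).
    replace (2 * PI * INR s * (INR j - INR j') / INR K) with (A - B) by
      (unfold A, B; field; lra).
    rewrite cos_minus, sin_minus. unfold cis; simpl. rewrite !cos_neg, !sin_neg.
    unfold al, be. ring. }
  rewrite nsum_exchange. rewrite <- nsum_scal. apply nsum_ext; intros j Hj.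
  rewrite nsum_exchange.
  rewrite (nsum_ext K _ (fun j' => if Nat.eq_dec j' j then INR K * Cnorm2 (g j) else 0)).
  { now rewrite (nsum_delta K j (fun _ => INR K * Cnorm2 (g j))). }
  intros j' Hj'. rewrite nsum_lin. destruct (Nat.eq_dec j' j) as [-> | Hne].
  - rewrite (nsum_ext K (fun s => cos _) (fun _ => 1)), (nsum_ext K (fun s => sin _) (fun _ => 0)).
    + rewrite !nsum_const. unfold al, be, Cnorm2. ring.
    + intros. unfold ph. rewrite Z.sub_diag.
      replace (2 * PI * INR i * 0 / INR K) with 0 by (field; lra). apply sin_0.
    + intros. unfold ph. rewrite Z.sub_diag.
      replace (2 * PI * INR i * 0 / INR K) with 0 by (field; lra). apply cos_0.
  - destruct (trig_sums K (Z.of_nat j - Z.of_nat j')%Z HK ltac:(lia)) as [E1 E2].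
    unfold ph. rewrite E1, E2. ring.
Qed.

(* Discrete Floquet transform in the first variable: the component of quasimomentum
   [phi] of a field of period [K * p]. *)
Definition floquet (K p : nat) (phi : R) (f : field) : field := fun s =>
  let a := fun j : Z => (cis (- (IZR (fst s + Z.of_nat p * j) * phi)) *
                         f (fst s + Z.of_nat p * j, snd s)%Z)%C in
  (zsum 0 K (fun j => fst (a j)), zsum 0 K (fun j => snd (a j))).

(** For this [phi] the phase, hence the summand, has period [K * p], so moving by [p] only permutes
    the [K] terms cyclically. *)
Lemma floquet_per K p q s f : (0 < K)%nat -> (0 < p)%nat ->
  per (Z.of_nat (K * p)) (Z.of_nat q) f ->
  per (Z.of_nat p) (Z.of_nat q) (floquet K p (2 * PI * INR s / INR (K * p)) f).
Proof.
  intros HK Hp Hf n m. set (phi := 2 * PI * INR s / INR (K * p)).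
  assert (HKp : 0 < INR (K * p)) by (apply lt_0_INR; nia).
  assert (Ha : forall i, (cis (- (IZR (i + Z.of_nat (K * p)) * phi)) *
     f (i + Z.of_nat (K * p), m)%Z)%C = (cis (- (IZR i * phi)) * f (i, m))%C).
  { intros i. rewrite (proj1 (Hf i m)). f_equal.
    rewrite <- (cis_add_2PI_Z (- (IZR i * phi)) (- Z.of_nat s)).
    f_equal. rewrite plus_IZR, opp_IZR, <- !INR_IZR_INZ. unfold phi. field. lra. }
  split.
  - unfold floquet; cbn [fst snd].
    set (b := fun i => (cis (- (IZR i * phi)) * f (i, m))%C).
    assert (Hz : forall h : C -> R,
      zsum 0 K (fun j => h (b (n + Z.of_nat p + Z.of_nat p * j)%Z)) =
      zsum 0 K (fun j => h (b (n + Z.of_nat p * j)%Z))).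
    { intros h.
      transitivity (zsum 0 K (fun j => (fun k => h (b (n + Z.of_nat p * k)%Z)) (j + 1)%Z)).
      - apply zsum_ext; intros. f_equal. f_equal. ring.
      - rewrite (zsum_shift1 0 K (fun k => h (b (n + Z.of_nat p * k)%Z))).
        apply zsum_periodic. intros i. f_equal. unfold b.
        replace (n + Z.of_nat p * (i + Z.of_nat K))%Z with
          (n + Z.of_nat p * i + Z.of_nat (K * p))%Z by (rewrite Nat2Z.inj_mul; ring).
        apply Ha. }
    apply C_eq; simpl; apply (Hz fst) || apply (Hz snd).
  - unfold floquet; cbn [fst snd].
    apply C_eq; simpl; apply zsum_ext; intros; now rewrite (proj2 (Hf _ m)).
Qed.

Lemma zsum_lin a n c d f g :
  zsum a n (fun i => c * f i + d * g i) = c * zsum a n f + d * zsum a n g.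
Proof. apply nsum_lin. Qed.

Lemma floquet_comb K p phi c f d g :
  floquet K p phi (comb c f d g) = comb c (floquet K p phi f) d (floquet K p phi g).
Proof.
  apply field_ext; intros s. unfold floquet, comb.
  set (e := fun j : Z => cis (- (IZR (fst s + Z.of_nat p * j) * phi))).
  set (t := fun j : Z => (fst s + Z.of_nat p * j, snd s)%Z).
  apply C_eq; cbn [fst snd].
  - transitivity (zsum 0 K (fun j =>
      1 * (fst c * fst (e j * f (t j))%C + - snd c * snd (e j * f (t j))%C) +
      1 * (fst d * fst (e j * g (t j))%C + - snd d * snd (e j * g (t j))%C))).
    + apply zsum_ext; intros; unfold e, t; simpl; ring.
    + rewrite !zsum_lin. unfold e, t. simpl. ring.
  - transitivity (zsum 0 K (fun j =>
      1 * (fst c * snd (e j * f (t j))%C + snd c * fst (e j * f (t j))%C) +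
      1 * (fst d * snd (e j * g (t j))%C + snd d * fst (e j * g (t j))%C))).
    + apply zsum_ext; intros; unfold e, t; simpl; ring.
    + rewrite !zsum_lin. unfold e, t. simpl. ring.
Qed.

Lemma floquet_translate K p phi a b f :
  floquet K p phi (translate a b f) =
  comb (cis (IZR a * phi)) (translate a b (floquet K p phi f)) 0
    (translate a b (floquet K p phi f)).
Proof.
  apply field_ext; intros s. unfold floquet, comb, translate; cbn [fst snd].
  set (e := fun j : Z => cis (- (IZR (fst s + a + Z.of_nat p * j) * phi))).
  set (t := fun j : Z => (fst s + a + Z.of_nat p * j, snd s + b)%Z).
  set (c := cis (IZR a * phi)).
  assert (E : forall j, (cis (- (IZR (fst s + Z.of_nat p * j) * phi)) *
     f (fst s + Z.of_nat p * j + a, snd s + b)%Z = c * (e j * f (t j)))%C).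
  { intros j. unfold c, e, t. rewrite Cmult_assoc, <- cis_add.
    f_equal; [f_equal; rewrite !plus_IZR; ring | do 2 f_equal; ring]. }
  apply C_eq; cbn [fst snd].
  - transitivity (zsum 0 K (fun j => fst c * fst (e j * f (t j))%C + - snd c * snd (e j * f (t j))%C)).
    + apply zsum_ext; intros j _. rewrite E. simpl. ring.
    + rewrite zsum_lin. unfold e, t. simpl. ring.
  - transitivity (zsum 0 K (fun j => fst c * snd (e j * f (t j))%C + snd c * fst (e j * f (t j))%C)).
    + apply zsum_ext; intros j _. rewrite E. simpl. ring.
    + rewrite zsum_lin. unfold e, t. simpl. ring.
Qed.

Lemma per_iter p q (V : pot) n m k : per (Z.of_nat p) q V ->
  V (n + Z.of_nat p * k, m)%Z = V (n, m).
Proof.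
  intros HV.
  assert (P : forall k n, V (n + Z.of_nat p * Z.of_nat k, m)%Z = V (n, m)).
  { intros j. induction j as [|j IH]; intros i.
    - f_equal. f_equal. lia.
    - rewrite <- (IH i). rewrite <- (proj1 (HV (i + Z.of_nat p * Z.of_nat j)%Z m)).
      f_equal. f_equal. lia. }
  destruct (Z_le_gt_dec 0 k).
  - replace k with (Z.of_nat (Z.to_nat k)) by lia. apply P.
  - rewrite <- (P (Z.to_nat (- k)) (n + Z.of_nat p * k)%Z). f_equal. f_equal. lia.
Qed.

Lemma floquet_vmul K p q V phi f : per (Z.of_nat p) q V ->
  floquet K p phi (vmul V f) = vmul V (floquet K p phi f).
Proof.
  intros HV. apply field_ext; intros [n m]. unfold floquet, vmul; cbn [fst snd].
  set (e := fun j : Z => cis (- (IZR (n + Z.of_nat p * j) * phi))).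
  apply C_eq; cbn [fst snd].
  - transitivity (zsum 0 K (fun j => V (n, m) * fst (e j * f (n + Z.of_nat p * j, m)%Z)%C
      + 0 * fst (e j * f (n + Z.of_nat p * j, m)%Z)%C)).
    + apply zsum_ext; intros j _. rewrite (per_iter p q V) by assumption.
      unfold e; simpl; ring.
    + rewrite zsum_lin. unfold e; simpl; ring.
  - transitivity (zsum 0 K (fun j => V (n, m) * snd (e j * f (n + Z.of_nat p * j, m)%Z)%C
      + 0 * snd (e j * f (n + Z.of_nat p * j, m)%Z)%C)).
    + apply zsum_ext; intros j _. rewrite (per_iter p q V) by assumption.
      unfold e; simpl; ring.
    + rewrite zsum_lin. unfold e; simpl; ring.
Qed.

(** A translation by [a] in the first variable costs the phase [cis (a phi)], absorbed by replacing
    [x] with [x + phi]; the potential is constant on the sites that are summed. *)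
Lemma floquet_twisted K p q V x y z phi f : per (Z.of_nat p) q V ->
  floquet K p phi (twisted_Hz V x y z f) =
  twisted_Hz V (x + phi) y z (floquet K p phi f).
Proof.
  intros HV. rewrite !twisted_Hz_comb, !floquet_comb, (floquet_vmul K p q) by assumption.
  rewrite !floquet_translate.
  apply field_ext; intros s. unfold comb.
  rewrite Ropp_plus_distr, !cis_add, Rmult_0_l, cis_0.
  replace (IZR (-1) * phi) with (- phi) by ring. rewrite Rmult_1_l. cring.
Qed.

Lemma floquet_parseval K p q f : (0 < K)%nat -> (0 < p)%nat ->
  nsum K (fun s => cnn p q (floquet K p (2 * PI * INR s / INR (K * p)) f)) =
  INR K * cnn (K * p) q f.
Proof.
  intros HK Hp. assert (HKR : 0 < INR K) by now apply lt_0_INR.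
  assert (HpR : 0 < INR p) by now apply lt_0_INR.
  unfold cnn, rsum, zsum. rewrite nsum_mul.
  rewrite nsum_exchange, (nsum_exchange K p), <- nsum_scal.
  apply nsum_ext; intros n _. rewrite nsum_exchange, (nsum_exchange K q), <- nsum_scal.
  apply nsum_ext; intros m _.
  rewrite (nsum_ext K (fun j => re2 f f _) (fun j => Cnorm2 (f (0 + Z.of_nat n +
    Z.of_nat p * Z.of_nat j, 0 + Z.of_nat m)%Z))).
  2: { intros j _. rewrite re2_Cnorm2.
    replace (0 + Z.of_nat (j * p + n))%Z with (0 + Z.of_nat n + Z.of_nat p * Z.of_nat j)%Z
      by lia. reflexivity. }
  rewrite <- (dft_parseval K (2 * PI * INR n / INR (K * p))) by assumption.
  apply nsum_ext; intros s _. cbv zeta.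
  unfold re2, floquet, zsum. cbn [fst snd].
  assert (E : forall j : nat,
    (cis (- (IZR (0 + Z.of_nat n + Z.of_nat p * (0 + Z.of_nat j)) * (2 * PI * INR s / INR (K * p)))) *
     f (0 + Z.of_nat n + Z.of_nat p * (0 + Z.of_nat j), 0 + Z.of_nat m)%Z =
     cis (- (INR s * (2 * PI * INR n / INR (K * p)) + 2 * PI * INR s * INR j / INR K)) *
     f (0 + Z.of_nat n + Z.of_nat p * Z.of_nat j, 0 + Z.of_nat m)%Z)%C).
  { intros j. f_equal. f_equal. f_equal.
    rewrite !plus_IZR, mult_IZR, !plus_IZR, <- !INR_IZR_INZ, mult_INR. field. lra. }
  rewrite !(nsum_ext K _ _ (fun j _ => f_equal fst (E j))).
  rewrite !(nsum_ext K _ _ (fun j _ => f_equal snd (E j))). reflexivity.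
Qed.

Lemma cell_below_mul_x K p q V x y z c : (0 < K)%nat -> (0 < p)%nat ->
  per (Z.of_nat p) (Z.of_nat q) V ->
  (forall s, (s < K)%nat -> cell_below p q V (x + 2 * PI * INR s / INR (K * p)) y z c) ->
  cell_below (K * p) q V x y z c.
Proof.
  intros HK Hp HV HB f Hf. assert (HKR : 0 < INR K) by now apply lt_0_INR.
  apply (Rmult_le_reg_l (INR K)); [assumption | ].
  rewrite <- (floquet_parseval K p q (twisted_Hz V x y z f)) by assumption.
  replace (INR K * (c * cnn (K * p) q f)) with (c * (INR K * cnn (K * p) q f)) by ring.
  rewrite <- floquet_parseval, <- nsum_scal by assumption.
  apply nsum_le; intros s Hs.
  rewrite (floquet_twisted K p (Z.of_nat q)) by assumption.
  apply HB; [assumption | ]. now apply floquet_per.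
Qed.

(** Exchanging the coordinates lets the transform in the first variable serve for the second. *)
Definition swap {T} (f : (Z * Z)%type -> T) : (Z * Z)%type -> T := fun s => f (snd s, fst s).

Lemma swap_swap {T} (f : (Z * Z)%type -> T) : swap (swap f) = f.
Proof. apply functional_extensionality; intros [n m]; reflexivity. Qed.

Lemma per_swap {T} p q (f : (Z * Z)%type -> T) : per p q f -> per q p (swap f).
Proof. intros Hf n m. unfold swap; simpl. split; apply Hf. Qed.

Lemma cnn_swap p q f : cnn q p (swap f) = cnn p q f.
Proof. unfold cnn, rsum, zsum. apply nsum_exchange. Qed.

Lemma twisted_swap V x y z f :
  twisted_Hz (swap V) y x z (swap f) = swap (twisted_Hz V x y z f).
Proof.
  apply field_ext; intros s. unfold twisted_Hz, twisted_H, swap; simpl. cring.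
Qed.

Lemma cell_below_swap p q V x y z c :
  cell_below p q V x y z c -> cell_below q p (swap V) y x z c.
Proof.
  intros HB f Hf. specialize (HB (swap f) (per_swap _ _ _ Hf)).
  rewrite cnn_swap in HB.
  rewrite <- (cnn_swap p q), <- twisted_swap, swap_swap in HB. exact HB.
Qed.

Lemma cell_below_mul K M p q V x y z c : (0 < K)%nat -> (0 < M)%nat ->
  (0 < p)%nat -> (0 < q)%nat -> per (Z.of_nat p) (Z.of_nat q) V ->
  (forall s t, (s < K)%nat -> (t < M)%nat ->
    cell_below p q V (x + 2 * PI * INR s / INR (K * p)) (y + 2 * PI * INR t / INR (M * q)) z c) ->
  cell_below (K * p) (M * q) V x y z c.
Proof.
  intros HK HM Hp Hq HV HB.
  rewrite <- (swap_swap V). apply cell_below_swap.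
  assert (HV' := per_swap _ _ _ HV).
  apply cell_below_mul_x; try assumption.
  - rewrite <- (Nat.mul_1_l q). now apply per_mul.
  - intros t Ht. apply cell_below_swap. apply cell_below_mul_x; try assumption.
    intros s Hs. now apply HB.
Qed.

(** * Absence of spectrum between resolvent points *)

(** The triangle inequality in squared form: Young's inequality with [t = b / a] gives exactly
    [(a - b)^2]. *)
Lemma nn_perturb_lower {V} (L : lattice_space V) a b N f g : 0 < b < a -> dom L f -> dom L g ->
  a * a * N <= nn L f -> nn L g <= b * b * N -> (a - b) * (a - b) * N <= nn L (comb 1 f 1 g).
Proof.
  intros Hb Hf Hg Ha HB.
  assert (Y := nn_young_lower L (b / a) f g ltac:(apply Rdiv_lt_0_compat; lra) Hf Hg).
  apply Rle_trans with (2 := Y).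
  assert (T : 0 < 1 - b / a).
  { assert (b / a < 1); [ | lra]. apply Rlt_div_l; lra. }
  assert (T' : / (b / a) - 1 >= 0).
  { assert (1 <= / (b / a)); [ | lra]. rewrite <- Rinv_1 at 1.
    apply Rinv_le_contravar; [apply Rdiv_lt_0_compat; lra | lra]. }
  assert ((1 - b / a) * (a * a * N) <= (1 - b / a) * nn L f) by
    (apply Rmult_le_compat_l; lra).
  assert ((/ (b / a) - 1) * nn L g <= (/ (b / a) - 1) * (b * b * N)) by
    (apply Rmult_le_compat_l; lra).
  assert (E : (a - b) * (a - b) * N =
    (1 - b / a) * (a * a * N) - (/ (b / a) - 1) * (b * b * N)) by (field; lra).
  rewrite E. lra.
Qed.

(** * From large tori back to l^2 *)

Definition cutoff (N : nat) (f : field) : field := fun s =>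
  if ((Z.abs (fst s) <=? Z.of_nat N) && (Z.abs (snd s) <=? Z.of_nat N))%Z%bool
  then f s else RtoC 0.

Lemma cutoff_out N f i j : (Z.of_nat N < Z.abs i)%Z \/ (Z.of_nat N < Z.abs j)%Z ->
  cutoff N f (i, j) = RtoC 0.
Proof.
  intros H. unfold cutoff; cbn [fst snd].
  destruct (Z.leb_spec (Z.abs i) (Z.of_nat N)), (Z.leb_spec (Z.abs j) (Z.of_nat N));
    try reflexivity. lia.
Qed.

Lemma cutoff_in N f i j : (Z.abs i <= Z.of_nat N)%Z -> (Z.abs j <= Z.of_nat N)%Z ->
  cutoff N f (i, j) = f (i, j).
Proof.
  intros Hi Hj. unfold cutoff; cbn [fst snd].
  destruct (Z.leb_spec (Z.abs i) (Z.of_nat N)), (Z.leb_spec (Z.abs j) (Z.of_nat N));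
    try reflexivity; lia.
Qed.

Lemma cutoff_l2 N f : is_l2 (cutoff N f).
Proof.
  set (g := cutoff N f).
  exists (rsum (- Z.of_nat N) (2 * N + 1) (- Z.of_nat N) (2 * N + 1) (re2 g g)).
  intros k. rewrite box_sum_rsum. apply rsum_support; [apply re2_ge0 | ].
  intros i j Hij. unfold g. rewrite cutoff_out by lia. unfold Cnorm2; simpl; ring.
Qed.

Lemma nn_cutoff V HV N f : is_l2 f ->
  nn (l2_space V HV) (cutoff N f) = box_sum N (re2 f f).
Proof.
  intros Hf. set (g := cutoff N f).
  assert (E : box_sum N (re2 g g) = box_sum N (re2 f f)).
  { rewrite !box_sum_rsum. apply rsum_ext; intros i j Hi Hj.
    rewrite !re2_Cnorm2. unfold g. now rewrite cutoff_in by lia. }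
  apply Rle_antisym.
  - apply nn_le_l2; [apply cutoff_l2 | ]. intros k. rewrite <- E, !box_sum_rsum.
    apply rsum_support; [apply re2_ge0 | ]. intros i j Hij.
    fold g. unfold g. rewrite cutoff_out by lia. unfold Cnorm2; simpl; ring.
  - rewrite <- E. apply l2_le_nn, cutoff_l2.
Qed.

Lemma nn_cutoff_compl V HV N f : is_l2 f ->
  nn (l2_space V HV) (comb 1 f (-1) (cutoff N f)) =
  nn (l2_space V HV) f - box_sum N (re2 f f).
Proof.
  intros Hf. set (L := l2_space V HV). rewrite <- (nn_cutoff V HV) by assumption. fold L.
  rewrite (nn_comb L 1 (-1)) by (try apply cutoff_l2; assumption).
  assert (E : ip L f (cutoff N f) = nn L (cutoff N f)).
  { unfold nn, ip. f_equal. apply functional_extensionality; intros [i j].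
    unfold re2, cutoff. destruct (_ && _)%bool; [reflexivity | simpl; ring]. }
  rewrite E. ring.
Qed.

(* A field supported in the box of radius N, periodized with periods P, Q > 2N + 2. *)
Definition periodize (N P Q : nat) (f : field) : field := fun s =>
  f ((fst s + Z.of_nat N + 1) mod Z.of_nat P - (Z.of_nat N + 1),
     (snd s + Z.of_nat N + 1) mod Z.of_nat Q - (Z.of_nat N + 1))%Z.

Lemma periodize_per N P Q f : (0 < P)%nat -> (0 < Q)%nat ->
  per (Z.of_nat P) (Z.of_nat Q) (periodize N P Q f).
Proof.
  intros HP HQ n m. unfold periodize; cbn [fst snd]. split; do 2 f_equal.
  - replace (n + Z.of_nat P + Z.of_nat N + 1)%Z with
      (n + Z.of_nat N + 1 + 1 * Z.of_nat P)%Z by ring.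
    rewrite Z_mod_plus_full. reflexivity.
  - replace (m + Z.of_nat Q + Z.of_nat N + 1)%Z with
      (m + Z.of_nat N + 1 + 1 * Z.of_nat Q)%Z by ring.
    now rewrite Z_mod_plus_full.
Qed.

Lemma mod_window N P i : (- (Z.of_nat N + 1) <= i < Z.of_nat P - (Z.of_nat N + 1))%Z ->
  ((i + Z.of_nat N + 1) mod Z.of_nat P - (Z.of_nat N + 1) = i)%Z.
Proof. intros Hi. rewrite Z.mod_small; lia. Qed.

(** The window is enlarged by one site on each side to contain nearest neighbours. There the
    periodization wraps around, but the site and its representative both lie outside the box, where
    a cut-off field vanishes. *)
Lemma mod_window_ext N P i : (2 * N + 3 <= P)%nat ->
  (- (Z.of_nat N + 2) <= i <= Z.of_nat P - (Z.of_nat N + 1))%Z ->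
  ((i + Z.of_nat N + 1) mod Z.of_nat P - (Z.of_nat N + 1) = i)%Z \/
  (Z.of_nat N < Z.abs i)%Z /\
  (Z.of_nat N < Z.abs ((i + Z.of_nat N + 1) mod Z.of_nat P - (Z.of_nat N + 1)))%Z.
Proof.
  intros HP Hi.
  destruct (Z.eq_dec i (- (Z.of_nat N + 2))) as [-> | H1].
  - right. replace (- (Z.of_nat N + 2) + Z.of_nat N + 1)%Z with
      (Z.of_nat P - 1 + (-1) * Z.of_nat P)%Z by ring.
    rewrite Z_mod_plus_full, Z.mod_small by lia. lia.
  - destruct (Z.eq_dec i (Z.of_nat P - (Z.of_nat N + 1))) as [-> | H2].
    + right. replace (Z.of_nat P - (Z.of_nat N + 1) + Z.of_nat N + 1)%Z with
        (0 + 1 * Z.of_nat P)%Z by ring.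
      rewrite Z_mod_plus_full, Z.mod_small by lia. lia.
    + left. apply mod_window. lia.
Qed.

Lemma periodize_cutoff N P Q f i j : (2 * N + 3 <= P)%nat -> (2 * N + 3 <= Q)%nat ->
  (- (Z.of_nat N + 2) <= i <= Z.of_nat P - (Z.of_nat N + 1))%Z ->
  (- (Z.of_nat N + 2) <= j <= Z.of_nat Q - (Z.of_nat N + 1))%Z ->
  periodize N P Q (cutoff N f) (i, j) = cutoff N f (i, j).
Proof.
  intros HP HQ Hi Hj. unfold periodize; cbn [fst snd].
  destruct (mod_window_ext N P i HP Hi) as [-> | [A1 A2]].
  - destruct (mod_window_ext N Q j HQ Hj) as [-> | [B1 B2]]; [reflexivity | ].
    rewrite !cutoff_out by tauto. reflexivity.
  - rewrite !cutoff_out by tauto. reflexivity.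
Qed.

Lemma per_add_mul p q (V : pot) : per (Z.of_nat p) (Z.of_nat q) V -> forall K M n m a b,
  V (n + a * Z.of_nat (K * p), m + b * Z.of_nat (M * q))%Z = V (n, m).
Proof.
  intros HV K M n m a b.
  assert (HV' := per_swap _ _ _ HV).
  replace (n + a * Z.of_nat (K * p))%Z with (n + Z.of_nat p * (a * Z.of_nat K))%Z by
    (rewrite Nat2Z.inj_mul; ring).
  rewrite (per_iter p (Z.of_nat q)) by assumption.
  replace (m + b * Z.of_nat (M * q))%Z with (m + Z.of_nat q * (b * Z.of_nat M))%Z by
    (rewrite Nat2Z.inj_mul; ring).
  apply (per_iter q (Z.of_nat p) (swap V) m n). assumption.
Qed.

(** A field cut off to a box is unchanged on a torus that holds the box and an empty layer around
    it, so the bounds on cells apply. The cutoff is then removed by letting [N] tend to infinity,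
    the operator being bounded. *)
Lemma l2_below_of_cells V HV p q z c : (0 < p)%nat -> (0 < q)%nat ->
  per (Z.of_nat p) (Z.of_nat q) V ->
  0 <= c -> (forall K, (0 < K)%nat -> cell_below (K * p) (K * q) V 0 0 z c) ->
  bounded_below (l2_space V HV) 0 0 z c.
Proof.
  intros Hp Hq HVp Hc HB f Hf. set (L := l2_space V HV).
  assert (HV' := HV). destruct HV' as [B HVB].
  set (M := 32 + 4 * B * B + 4 * Cnorm2 z).
  assert (HM : 0 < M) by (unfold M; generalize (Cnorm2_ge0 z), (Rle_0_sqr B); unfold Rsqr; lra).
  assert (cut : forall N, c * box_sum N (re2 f f) <= nn L (twisted_Hz V 0 0 z (cutoff N f))).
  (* [2 N + 3] cells give sides of at least [2 N + 3] sites: the box and one empty layer on each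
     side. *)
  { intros N. set (K := (2 * N + 3)%nat). set (P := (K * p)%nat). set (Q := (K * q)%nat).
    assert (HP : (2 * N + 3 <= P)%nat) by (unfold P, K; nia).
    assert (HQ : (2 * N + 3 <= Q)%nat) by (unfold Q, K; nia).
    set (g := cutoff N f). set (F := periodize N P Q g).
    assert (HF : per (Z.of_nat P) (Z.of_nat Q) F) by (apply periodize_per; lia).
    assert (HVP : per (Z.of_nat P) (Z.of_nat Q) V).
    { intros n m. split; [rewrite <- (per_add_mul p q V HVp K K n m 1 0) |
        rewrite <- (per_add_mul p q V HVp K K n m 0 1)]; fold P Q; f_equal; f_equal; ring. }
    assert (Lo := HB K ltac:(lia) F HF). fold P Q in Lo. unfold cnn in Lo.
    set (w := (- (Z.of_nat N + 1))%Z).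
    rewrite !(rsum_periodic 0 0 w w P Q) in Lo by (apply per_re2; try apply per_twisted; assumption).
    apply Rle_trans with (c * rsum w P w Q (re2 F F)).
    { apply Rmult_le_compat_l; [assumption | ]. rewrite box_sum_rsum.
      apply Rle_trans with (rsum (- Z.of_nat N) (2 * N + 1) (- Z.of_nat N) (2 * N + 1) (re2 F F)).
      - right. apply rsum_ext; intros i j Hi Hj. rewrite !re2_Cnorm2.
        unfold F, g. rewrite periodize_cutoff, cutoff_in by (unfold w in *; lia). reflexivity.
      - apply rsum_sub; [apply re2_ge0 | unfold w; lia ..]. }
    apply Rle_trans with (1 := Lo).
    apply Rle_trans with (rsum w P w Q (re2 (twisted_Hz V 0 0 z g) (twisted_Hz V 0 0 z g))).
    - right. apply rsum_ext; intros i j Hi Hj. rewrite !re2_Cnorm2. f_equal.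
      unfold twisted_Hz, twisted_H; cbn [fst snd].
      unfold F, g. rewrite !periodize_cutoff by (unfold w in *; lia). reflexivity.
    - apply l2_le_rsum with (M := nn L (twisted_Hz V 0 0 z g)). apply l2_le_nn.
      apply (dom_twisted L). apply cutoff_l2. }
  set (X := nn L (twisted_Hz V 0 0 z f)).
  assert (HT : is_l2 (twisted_Hz V 0 0 z f)) by (apply (dom_twisted L); exact Hf).
  assert (HX : 0 <= X) by now apply nn_ge0.
  (* Young's inequality separates the tail with a free [t], which is chosen small only after the
     limit in [N]. *)
  assert (lim : forall t, 0 < t -> c * nn L f <= (1 + t) * X).
  { intros t Ht.
    assert (S : forall N, c * box_sum N (re2 f f) <=
       (1 + t) * X + (1 + / t) * (M * (nn L f - box_sum N (re2 f f)))).
    { intros N. set (h := comb 1 f (-1) (cutoff N f)).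
      assert (Hh : is_l2 h) by (apply is_l2_comb; [assumption | apply cutoff_l2]).
      assert (Hh' : is_l2 (comb (-1) h 0 h)) by now apply is_l2_comb.
      assert (Y := nn_young_upper L t (twisted_Hz V 0 0 z f) (twisted_Hz V 0 0 z (comb (-1) h 0 h))
        Ht HT (dom_twisted L 0 0 z _ Hh')).
      replace (comb 1 (twisted_Hz V 0 0 z f) 1 (twisted_Hz V 0 0 z (comb (-1) h 0 h))) with
        (twisted_Hz V 0 0 z (cutoff N f)) in Y.
      2: { apply field_ext; intros s. unfold twisted_Hz, twisted_H, h, comb.
           replace (RtoC (-1)) with (- (1))%C by (apply C_eq; simpl; ring). cring. }
      assert (U := nn_twisted_le L B 0 0 z _ HVB Hh'). fold M in U.
      rewrite (nn_scal L) in U by assumption.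
      replace (Cnorm2 (RtoC (-1))) with 1 in U by (unfold Cnorm2; simpl; ring).
      assert (E := nn_cutoff_compl V HV N f Hf). fold L h in E. rewrite E in U.
      assert (Hti : 0 < / t) by now apply Rinv_0_lt_compat.
      specialize (cut N). fold X in Y.
      rewrite Rmult_1_l in U.
      assert ((1 + / t) * nn L (twisted_Hz V 0 0 z (comb (-1) h 0 h)) <=
        (1 + / t) * (M * (nn L f - box_sum N (re2 f f)))) by
        (apply Rmult_le_compat_l; lra).
      lra. }
    assert (Hl := l2_tr_lim f f Hf Hf). fold (ip L f f) in Hl.
    change (l2_tr (re2 f f)) with (nn L f) in Hl.
    assert (L1 : is_lim_seq (fun N => c * box_sum N (re2 f f)) (c * nn L f)) by
      (apply (is_lim_seq_scal_l _ c (nn L f)); exact Hl).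
    assert (L2 : is_lim_seq (fun N => (1 + t) * X + (1 + / t) * (M * (nn L f - box_sum N (re2 f f))))
      ((1 + t) * X + (1 + / t) * (M * (nn L f - nn L f)))).
    { apply is_lim_seq_plus'; [apply is_lim_seq_const | ].
      apply (is_lim_seq_scal_l _ (1 + / t) (M * (nn L f - nn L f))).
      apply (is_lim_seq_scal_l _ M (nn L f - nn L f)).
      apply is_lim_seq_minus'; [apply is_lim_seq_const | exact Hl]. }
    assert (R := is_lim_seq_le _ _ _ _ S L1 L2).
    rewrite Rminus_diag, !Rmult_0_r, Rplus_0_r in R. exact R. }
  apply Rnot_lt_le. intros Hlt. fold X in Hlt.
  set (g := c * nn L f - X). assert (Hg : 0 < g) by (unfold g; lra).
  specialize (lim (g / (2 * (X + 1))) ltac:(apply Rdiv_lt_0_compat; lra)).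
  assert (g / (2 * (X + 1)) * X <= g / 2).
  { replace (g / 2) with (g / (2 * (X + 1)) * (X + 1)) by (field; lra).
    apply Rmult_le_compat_l; [ | lra]. left. apply Rdiv_lt_0_compat; lra. }
  unfold g in *. lra.
Qed.

Lemma sin_sqr_le x : sin x * sin x <= x * x.
Proof.
  assert (P : forall y, 0 <= y -> sin y * sin y <= y * y).
  { intros y Hy. destruct (Req_dec y 0) as [-> | Hy0]; [rewrite sin_0; lra | ].
    assert (sin y < y) by (apply sin_lt_x; lra).
    destruct (Rle_lt_dec 1 y) as [H1 | H1].
    - generalize (SIN_bound y). nra.
    - assert (0 <= sin y).
      { apply sin_ge_0; [lra | ]. generalize PI2_1; lra. }
      nra. }
  destruct (Rle_lt_dec 0 x) as [H0 | H0]; [now apply P | ].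
  specialize (P (- x) ltac:(lra)). rewrite sin_neg in P. lra.
Qed.

(** A chord, of length [2 |sin ((s - t) / 2)|], is not longer than its arc. *)
Lemma Cnorm2_cis_sub s t : Cnorm2 (cis s - cis t)%C <= (s - t) * (s - t).
Proof.
  assert (E : Cnorm2 (cis s - cis t)%C = 4 * (sin ((s - t) / 2) * sin ((s - t) / 2))).
  { assert (C2 := cos_2a_sin ((s - t) / 2)).
    replace (2 * ((s - t) / 2)) with (s - t) in C2 by field.
    rewrite cos_minus in C2.
    assert (A1 := sin2_cos2 s). assert (A2 := sin2_cos2 t). unfold Rsqr in *.
    unfold Cnorm2, cis; simpl. nra. }
  rewrite E. assert (P := sin_sqr_le ((s - t) / 2)). lra.
Qed.

(** * Positivity along paths of quasimomenta *)

Section Chain.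
Context (p q : nat) (V : pot) (HV : per (Z.of_nat p) (Z.of_nat q) V).
Context (B : R) (HB : forall s, Rabs (V s) <= B).
Context (m r c : R) (Hc : 0 < c).
Context (H1 : forall x y, cell_below p q V x y (RtoC (m - r)) c).
Context (H2 : forall x y, cell_below p q V x y (RtoC (m + r)) c).
Let L := cell_space p q V HV.
Let K := 32 + 4 * B * B + 4 * (m * m).

Lemma chain_K : 0 < K.
Proof. unfold K. generalize (Rle_0_sqr B), (Rle_0_sqr m); unfold Rsqr; lra. Qed.

(* With A = (H - m)^2 - r^2 = (H - m + r)(H - m - r), nonnegativity of the form of A at
   f - A f / K upgrades <A f, f> >= 0 to a uniform lower bound. *)
Lemma chain_gain x y : cell_below p q V x y (RtoC m) (r * r) ->
  cell_below p q V x y (RtoC m) (r * r + c * c / K).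
Proof.
  intros H0 f Hf. assert (HK := chain_K).
  set (T := twisted_Hz V x y (RtoC m)).
  assert (dT : forall g, dom L g -> dom L (T g)) by (intros; now apply (dom_twisted L)).
  change (per (Z.of_nat p) (Z.of_nat q) f) with (dom L f) in Hf.
  change (cnn p q f) with (nn L f). change (cnn p q (T f)) with (nn L (T f)).
  set (h := comb 1 (T (T f)) (RtoC (- (r * r))) f).
  assert (Hh : dom L h) by (apply dom_comb; auto).
  assert (Th : T h = comb 1 (T (T (T f))) (RtoC (- (r * r))) (T f)).
  { unfold h. apply field_ext; intros s. unfold T, twisted_Hz, twisted_H, comb. cring. }
  assert (sym : forall g k, dom L g -> dom L k -> ip L (T g) k = ip L g (T k)).
  { intros g k Hg Hk. unfold T. rewrite (twisted_adj L) by assumption.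
    do 2 f_equal. apply C_eq; simpl; ring. }
  assert (low : c * c * nn L f <= nn L h).
  { set (g := twisted_Hz V x y (RtoC (m + r)) f).
    assert (Hg : dom L g) by now apply (dom_twisted L).
    replace h with (twisted_Hz V x y (RtoC (m - r)) g).
    - assert (A1 := H1 x y g Hg). assert (A2 := H2 x y f Hf).
      change (cnn p q g) with (nn L g) in A1. fold g in A2.
      change (cnn p q g) with (nn L g) in A2. change (cnn p q f) with (nn L f) in A2.
      apply Rle_trans with (2 := A1). rewrite Rmult_assoc.
      apply Rmult_le_compat_l; lra.
    - apply field_ext; intros s. unfold h, g, T, twisted_Hz, twisted_H, comb.
      rewrite RtoC_minus, RtoC_plus, RtoC_opp, RtoC_mult. cring. }
  assert (Q0 : r * r * nn L (comb 1 f (RtoC (- / K)) h) <= nn L (T (comb 1 f (RtoC (- / K)) h))).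
  { apply (H0 (comb 1 f (RtoC (- / K)) h)). apply (dom_comb V L); assumption. }
  replace (T (comb 1 f (RtoC (- / K)) h)) with (comb 1 (T f) (RtoC (- / K)) (T h)) in Q0.
  2: { apply field_ext; intros s. unfold T, twisted_Hz, twisted_H, comb. cring. }
  rewrite !(nn_comb L 1 (- / K)) in Q0 by auto.
  assert (cross : ip L (T f) (T h) - r * r * ip L f h = nn L h).
  { rewrite <- sym by auto.
    unfold nn. unfold h at 3. rewrite (ip_comb L) by auto. simpl. ring. }
  assert (up : nn L (T h) <= K * nn L h).
  { unfold T. assert (U := nn_twisted_le L B x y (RtoC m) h HB Hh).
    replace (Cnorm2 (RtoC m)) with (m * m) in U by (unfold Cnorm2; simpl; ring).
    exact U. }
  assert (Hh0 : 0 <= nn L h) by now apply nn_ge0.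
  assert (Hr : 0 <= r * r * nn L h) by (apply Rmult_le_pos; [nra | assumption]).
  assert (HKi : 0 < / K) by now apply Rinv_0_lt_compat.
  assert (E : / K * / K * (nn L (T h) - r * r * nn L h) <= / K * nn L h).
  { replace (/ K * nn L h) with (/ K * / K * (K * nn L h)) by (field; lra).
    apply Rmult_le_compat_l; [nra | lra]. }
  assert (F : c * c / K * nn L f <= / K * nn L h).
  { replace (c * c / K * nn L f) with (/ K * (c * c * nn L f)) by (field; lra).
    apply Rmult_le_compat_l; lra. }
  assert (G : / K * (ip L (T f) (T h) - r * r * ip L f h) = / K * nn L h) by now rewrite cross.
  lra.
Qed.

(** The gain of [chain_gain] is a margin [k] that does not depend on [(x, y)], so one step size
    [eta] serves everywhere. *)
Lemma chain_step : exists eta, 0 < eta /\ forall x y x' y',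
  Rabs (x' - x) <= eta -> Rabs (y' - y) <= eta ->
  cell_below p q V x y (RtoC m) (r * r) -> cell_below p q V x' y' (RtoC m) (r * r).
Proof.
  assert (HK := chain_K). set (k := c * c / K).
  assert (Hk : 0 < k) by (unfold k; apply Rdiv_lt_0_compat; nra).
  (* Half of [k] pays for t ||T f||^2 in Young's inequality, because ||T f||^2 <= K ||f||^2. The
     other half pays for the changes of the four hopping terms: their squared norm is at most 16
     eta^2 ||f||^2 = (k t / 2) ||f||^2, and it is divided by [t]. *)
  set (t := k / (2 * K)). assert (Ht : 0 < t) by (apply Rdiv_lt_0_compat; lra).
  exists (sqrt (k * t / 32)). assert (Hkt : 0 < k * t / 32) by nra.
  split; [now apply sqrt_lt_R0 | ].
  intros x y x' y' Hx Hy H0 f Hf. assert (G := chain_gain x y H0 f Hf). fold k in G.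
  set (eta := sqrt (k * t / 32)) in *.
  assert (Heta : eta * eta = k * t / 32) by (apply sqrt_def; lra).
  assert (sq : forall d, Rabs d <= eta -> d * d <= k * t / 32).
  { intros d Hd. apply Rabs_le_between in Hd. nra. }
  change (per (Z.of_nat p) (Z.of_nat q) f) with (dom L f) in Hf.
  change (cnn p q f) with (nn L f) in *.
  set (T := twisted_Hz V x y (RtoC m) f) in *.
  change (cnn p q T) with (nn L T) in G.
  set (D1 := comb (cis (- x') - cis (- x)) (translate (-1) 0 f) (cis x' - cis x) (translate 1 0 f)).
  set (D2 := comb (cis (- y') - cis (- y)) (translate 0 (-1) f) (cis y' - cis y) (translate 0 1 f)).
  assert (dD1 : dom L D1) by (apply dom_comb; now apply dom_translate).
  assert (dD2 : dom L D2) by (apply dom_comb; now apply dom_translate).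
  assert (dT : dom L T) by now apply (dom_twisted L).
  replace (twisted_Hz V x' y' (RtoC m) f) with (comb 1 T 1 (comb 1 D1 1 D2)).
  2: { unfold T. rewrite !twisted_Hz_comb. unfold D1, D2.
       apply field_ext; intros s. unfold comb. cring. }
  assert (Y := nn_young_lower L t T (comb 1 D1 1 D2) Ht dT (dom_comb V L _ _ _ _ dD1 dD2)).
  assert (S : forall a b d e, Rabs (d - e) <= eta ->
    nn L (comb (cis d - cis e) (translate a b f) 0 (translate a b f)) <= k * t / 32 * nn L f).
  { intros a b d e Hde. rewrite (nn_scal L), (nn_translate L) by (try apply dom_translate; assumption).
    apply Rmult_le_compat_r; [now apply nn_ge0 | ].
    eapply Rle_trans; [apply Cnorm2_cis_sub | now apply sq]. }
  assert (Hx' : Rabs (- x' - - x) <= eta) by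
    (replace (- x' - - x) with (- (x' - x)) by ring; now rewrite Rabs_Ropp).
  assert (Hy' : Rabs (- y' - - y) <= eta) by
    (replace (- y' - - y) with (- (y' - y)) by ring; now rewrite Rabs_Ropp).
  assert (dd : forall a b z, dom L (comb z (translate a b f) 0 (translate a b f))) by
    (intros; apply dom_comb; now apply dom_translate).
  assert (N1 : nn L D1 <= 4 * (k * t / 32 * nn L f)).
  { unfold D1. rewrite comb_split.
    eapply Rle_trans; [apply nn_add_le; apply dd | ].
    generalize (S (-1)%Z 0%Z _ _ Hx'), (S 1%Z 0%Z _ _ Hx). lra. }
  assert (N2 : nn L D2 <= 4 * (k * t / 32 * nn L f)).
  { unfold D2. rewrite comb_split.
    eapply Rle_trans; [apply nn_add_le; apply dd | ].
    generalize (S 0%Z (-1)%Z _ _ Hy'), (S 0%Z 1%Z _ _ Hy). lra. }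
  assert (N := nn_add_le L D1 D2 dD1 dD2).
  change (cnn p q (comb 1 T 1 (comb 1 D1 1 D2))) with (nn L (comb 1 T 1 (comb 1 D1 1 D2))).
  apply Rle_trans with (2 := Y).
  assert (U : nn L T <= K * nn L f).
  { assert (U := nn_twisted_le L B x y (RtoC m) f HB Hf).
    replace (Cnorm2 (RtoC m)) with (m * m) in U by (unfold Cnorm2; simpl; ring). exact U. }
  assert (Hf0 : 0 <= nn L f) by now apply nn_ge0.
  assert (Hti : 0 < / t) by now apply Rinv_0_lt_compat.
  set (W := nn L (comb 1 D1 1 D2)) in *.
  assert (HW : 0 <= W) by (apply nn_ge0; now apply dom_comb).
  assert (W1 : W <= k * t / 2 * nn L f) by lra.
  assert (W2 : / t * W <= k / 2 * nn L f).
  { replace (k / 2 * nn L f) with (/ t * (k * t / 2 * nn L f)) by (field; lra).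
    apply Rmult_le_compat_l; lra. }
  assert (U2 : t * nn L T <= k / 2 * nn L f).
  { replace (k / 2 * nn L f) with (t * (K * nn L f)) by (unfold t; field; lra).
    apply Rmult_le_compat_l; lra. }
  lra.
Qed.

Lemma chain x0 y0 : cell_below p q V x0 y0 (RtoC m) (r * r) ->
  forall x y, cell_below p q V x y (RtoC m) (r * r).
Proof.
  intros H0 x y. destruct chain_step as [eta [Heta S]].
  destruct (INR_unbounded ((Rabs (x - x0) + Rabs (y - y0)) / eta)) as [n Hn].
  assert (Hpos : 0 <= (Rabs (x - x0) + Rabs (y - y0)) / eta).
  { apply Rmult_le_pos; [ | left; now apply Rinv_0_lt_compat].
    generalize (Rabs_pos (x - x0)), (Rabs_pos (y - y0)); lra. }
  assert (Hn0 : 0 < INR n) by lra.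
  assert (Hle : Rabs (x - x0) + Rabs (y - y0) <= eta * INR n).
  { replace (Rabs (x - x0) + Rabs (y - y0)) with
      (eta * ((Rabs (x - x0) + Rabs (y - y0)) / eta)) by (field; lra).
    apply Rmult_le_compat_l; lra. }
  assert (sm : forall d, Rabs d <= eta * INR n -> Rabs (d / INR n) <= eta).
  { intros d Hd. rewrite Rabs_div, (Rabs_pos_eq (INR n)) by lra.
    apply Rle_div_l; lra. }
  assert (I : forall k, cell_below p q V (x0 + INR k * ((x - x0) / INR n))
    (y0 + INR k * ((y - y0) / INR n)) (RtoC m) (r * r)).
  { induction k as [|k IH].
    - simpl. rewrite !Rmult_0_l, !Rplus_0_r. exact H0.
    - apply (S _ _ _ _) with (3 := IH); rewrite S_INR.
      + replace (_ - _) with ((x - x0) / INR n) by ring. apply sm.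
        generalize (Rabs_pos (y - y0)); lra.
      + replace (_ - _) with ((y - y0) / INR n) by ring. apply sm.
        generalize (Rabs_pos (x - x0)); lra. }
  specialize (I n).
  replace (x0 + INR n * ((x - x0) / INR n)) with x in I by (field; lra).
  replace (y0 + INR n * ((y - y0) / INR n)) with y in I by (field; lra).
  exact I.
Qed.
End Chain.

Lemma bounded_below_perturb V HV a e d : 0 < d < a ->
  bounded_below (l2_space V HV) 0 0 (RtoC e) (a * a) ->
  forall e', Rabs (e' - e) <= d ->
  bounded_below (l2_space V HV) 0 0 (RtoC e') ((a - d) * (a - d)).
Proof.
  intros Hd HB e' He f Hf. set (L := l2_space V HV) in *.
  replace (twisted_Hz V 0 0 (RtoC e') f) with
    (comb 1 (twisted_Hz V 0 0 (RtoC e) f) 1 (comb (RtoC (e - e')) f 0 f)).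
  2: { apply field_ext; intros s. unfold twisted_Hz, twisted_H, comb.
       rewrite RtoC_minus. cring. }
  apply nn_perturb_lower; try assumption.
  - now apply (dom_twisted L).
  - now apply dom_comb.
  - now apply HB.
  - rewrite (nn_scal L) by assumption. apply Rmult_le_compat_r; [now apply nn_ge0 | ].
    unfold Cnorm2; simpl. apply Rabs_le_between in He. nra.
Qed.

Lemma resolvent_near V (HV : exists B, forall s, Rabs (V s) <= B) e : resolvent V (RtoC e) ->
  exists d, 0 < d /\ forall e', Rabs (e' - e) <= d -> resolvent V (RtoC e').
Proof.
  intros HR. destruct (bounded_below_of_resolvent V HV _ HR) as [c [Hc HB]].
  assert (Hs : 0 < sqrt c) by now apply sqrt_lt_R0.
  exists (sqrt c / 2). split; [lra | ]. intros e' He.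
  apply resolvent_of_bounded_below with (HV := HV)
    (c := (sqrt c - sqrt c / 2) * (sqrt c - sqrt c / 2)); [nra | ].
  apply bounded_below_perturb with e; [lra | | assumption].
  rewrite sqrt_sqrt by lra. exact HB.
Qed.

(** At the end points the bounds hold for every twist, at the midpoint for one; the chain carries
    the latter to all twists and the Floquet sums carry it to l^2. The constant [r * r] at [m] then
    leaves no spectrum at distance less than [r] from [m]. *)
Lemma resolvent_between V (HV : exists B, forall s, Rabs (V s) <= B) p q m r x0 y0 : (0 < p)%nat -> (0 < q)%nat ->
  per (Z.of_nat p) (Z.of_nat q) V -> 0 < r ->
  resolvent V (RtoC (m - r)) -> resolvent V (RtoC (m + r)) ->
  cell_below p q V x0 y0 (RtoC m) (r * r) ->
  forall e, m - r < e < m + r -> resolvent V (RtoC e).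
Proof.
  intros Hp Hq HVp Hr R1 R2 H0 e He.
  destruct (bounded_below_of_resolvent V HV _ R1) as [c1 [Hc1 B1]].
  destruct (bounded_below_of_resolvent V HV _ R2) as [c2 [Hc2 B2]].
  assert (HV' := HV). destruct HV' as [B HB].
  assert (C0 := fun x y => cell_below_of_l2 V HV p q x y _ _ Hp Hq HVp Hc1 B1).
  assert (C2 := fun x y => cell_below_of_l2 V HV p q x y _ _ Hp Hq HVp Hc2 B2).
  set (c := Rmin c1 c2).
  assert (Hc : 0 < c) by (apply Rmin_glb_lt; assumption).
  assert (pos : forall f, per (Z.of_nat p) (Z.of_nat q) f -> 0 <= cnn p q f) by
    (intros; apply rsum_ge0, re2_ge0).
  assert (All : forall x y, cell_below p q V x y (RtoC m) (r * r)).
  { apply (chain p q V HVp B HB m r c Hc) with x0 y0; [ | | assumption].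
    - intros x y f Hf. eapply Rle_trans; [ | now apply C0].
      apply Rmult_le_compat_r; [now apply pos | apply Rmin_l].
    - intros x y f Hf. eapply Rle_trans; [ | now apply C2].
      apply Rmult_le_compat_r; [now apply pos | apply Rmin_r]. }
  assert (BB : bounded_below (l2_space V HV) 0 0 (RtoC m) (r * r)).
  { apply l2_below_of_cells with p q; try assumption; [nra | ].
    intros K HK. apply cell_below_mul; auto. }
  assert (Hab : exists d, 0 < d < r /\ Rabs (e - m) <= d).
  { exists ((r + Rabs (e - m)) / 2).
    assert (Rabs (e - m) < r) by (apply Rabs_def1; lra).
    generalize (Rabs_pos (e - m)). lra. }
  destruct Hab as [d [Hd Hed]].
  apply resolvent_of_bounded_below with (HV := HV) (c := (r - d) * (r - d)); [nra | ].
  apply bounded_below_perturb with m; assumption.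
Qed.

(** * Perturbation of the free operator *)

(** Eigenvalue of the free twisted operator on the plane wave of index [(s, t)] of the cell. *)
Definition free_ev (p q s t : nat) (x y : R) : R :=
  2 * cos (x + 2 * PI * INR s / INR p) + 2 * cos (y + 2 * PI * INR t / INR q).

Lemma cell_below_weaken p q V x y z c c' : c' <= c ->
  cell_below p q V x y z c -> cell_below p q V x y z c'.
Proof.
  intros Hc HB f Hf. eapply Rle_trans; [ | now apply HB].
  apply Rmult_le_compat_r; [apply rsum_ge0, re2_ge0 | assumption].
Qed.

(** Fields of period 1 in both directions are constant, so the free operator acts on them as a
    number. Every cell is a multiple of this one, and the shifts of [x] and [y] in [cell_below_mul]
    produce the bands. *)
Lemma free_cell_below1 x y m :
  cell_below 1 1 (fun _ => 0) x y (RtoC m)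
    ((2 * cos x + 2 * cos y - m) * (2 * cos x + 2 * cos y - m)).
Proof.
  intros f Hf. right. unfold cnn. set (k := 2 * cos x + 2 * cos y - m).
  transitivity (rsum 0 1 0 1 (fun s => k * k * re2 f f s + 0 * re2 f f s)).
  - rewrite rsum_lin. ring.
  - apply rsum_ext; intros i j _ _. rewrite !re2_Cnorm2.
    replace (twisted_Hz (fun _ => 0) x y (RtoC m) f (i, j)) with (RtoC k * f (i, j))%C.
    + rewrite Cnorm2_mul. unfold Cnorm2; simpl. ring.
    + unfold twisted_Hz, twisted_H; cbn [fst snd].
      assert (S1 := proj1 (Hf (i - 1)%Z j)). assert (S2 := proj2 (Hf i (j - 1)%Z)).
      assert (S3 := proj1 (Hf i j)). assert (S4 := proj2 (Hf i j)).
      change (Z.of_nat 1) with 1%Z in *.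
      replace (i - 1 + 1)%Z with i in S1 by ring. replace (j - 1 + 1)%Z with j in S2 by ring.
      rewrite S3, S4, <- S1, <- S2.
      unfold k, cis. rewrite !cos_neg, !sin_neg. apply C_eq; simpl; ring.
Qed.

Lemma Rabs_mul_self a : Rabs a * Rabs a = a * a.
Proof. rewrite <- Rabs_mult. apply Rabs_pos_eq. nra. Qed.

Lemma free_cell_below p q x y m a : (0 < p)%nat -> (0 < q)%nat -> 0 <= a ->
  (forall s t, (s < p)%nat -> (t < q)%nat -> a <= Rabs (free_ev p q s t x y - m)) ->
  cell_below p q (fun _ => 0) x y (RtoC m) (a * a).
Proof.
  intros Hp Hq Ha He. rewrite <- (Nat.mul_1_r p), <- (Nat.mul_1_r q).
  apply cell_below_mul; try lia.
  - intros n k; split; reflexivity.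
  - intros s t Hs Ht. rewrite !Nat.mul_1_r.
    apply cell_below_weaken with (2 := free_cell_below1 _ _ _).
    specialize (He s t Hs Ht). unfold free_ev in He.
    rewrite <- (Rabs_mul_self (_ - m)). apply Rmult_le_compat; assumption.
Qed.

Lemma cell_below_potential p q V x y m a d : per (Z.of_nat p) (Z.of_nat q) V ->
  0 < d < a -> (forall s, Rabs (V s) <= d) ->
  cell_below p q (fun _ => 0) x y (RtoC m) (a * a) ->
  cell_below p q V x y (RtoC m) ((a - d) * (a - d)).
Proof.
  intros HV Hd HVd HB f Hf.
  set (L := cell_space p q V HV).
  replace (twisted_Hz V x y (RtoC m) f) with
    (comb 1 (twisted_Hz (fun _ => 0) x y (RtoC m) f) 1 (vmul V f)).
  2: { apply field_ext; intros s. unfold twisted_Hz, twisted_H, comb, vmul. cring. }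
  apply (nn_perturb_lower L a d (nn L f)); try assumption.
  - apply per_twisted; [ | assumption]. intros n k; split; reflexivity.
  - now apply dom_vmul.
  - now apply HB.
  - now apply nn_vmul.
Qed.

Lemma resolvent_far V (HV : forall s, Rabs (V s) <= 1) e : 8 <= Rabs e -> resolvent V (RtoC e).
Proof.
  intros He. assert (HV' : exists B, forall s, Rabs (V s) <= B) by now exists 1.
  (* For [|V| <= 1] and [z = 0] the norm bound [32 + 4 B^2 + 4 |z|^2] is [36 = 6^2], and 8 exceeds
     6. *)
  apply resolvent_of_bounded_below with (HV := HV') (c := (8 - 6) * (8 - 6)); [lra | ].
  intros f Hf. set (L := l2_space V HV').
  replace (twisted_Hz V 0 0 (RtoC e) f) with
    (comb 1 (comb (RtoC (- e)) f 0 f) 1 (twisted_Hz V 0 0 0 f)).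
  2: { apply field_ext; intros s. unfold twisted_Hz, twisted_H, comb.
       rewrite RtoC_opp. cring. }
  assert (H0 := nn_ge0 L f Hf).
  apply nn_perturb_lower; [lra | now apply dom_comb | now apply (dom_twisted L) | | ].
  - rewrite (nn_scal L) by assumption. apply Rmult_le_compat_r; [assumption | ].
    unfold Cnorm2; simpl. replace (- e * - e + 0 * 0) with (e * e) by ring.
    rewrite <- (Rabs_mul_self e). apply Rmult_le_compat; lra.
  - eapply Rle_trans; [apply (nn_twisted_le L 1); assumption | ].
    apply Rmult_le_compat_r; [assumption | ]. unfold Cnorm2; simpl. lra.
Qed.

Lemma gap_interval V p q d m r x y : (0 < p)%nat -> (0 < q)%nat ->
  per (Z.of_nat p) (Z.of_nat q) V -> 0 < r -> 0 < d -> (forall s, Rabs (V s) <= d) ->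
  resolvent V (RtoC (m - r)) -> resolvent V (RtoC (m + r)) ->
  (forall s t, (s < p)%nat -> (t < q)%nat -> r + d <= Rabs (free_ev p q s t x y - m)) ->
  forall e, m - r < e < m + r -> resolvent V (RtoC e).
Proof.
  intros Hp Hq HV Hr Hd HVd R1 R2 He.
  apply resolvent_between with p q x y; try assumption; [now exists d | ].
  replace (r * r) with ((r + d - d) * (r + d - d)) by ring.
  apply cell_below_potential; try assumption; [lra | ].
  apply free_cell_below; [assumption.. | lra | assumption].
Qed.

Lemma finite_min2 p q (F : nat -> nat -> R) :
  (forall s t, (s < p)%nat -> (t < q)%nat -> 0 < F s t) ->
  exists d, 0 < d /\ forall s t, (s < p)%nat -> (t < q)%nat -> d <= F s t.
Proof.
  assert (M : forall n (g : nat -> R), (forall i, (i < n)%nat -> 0 < g i) ->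
    exists d, 0 < d /\ forall i, (i < n)%nat -> d <= g i).
  { induction n as [|n IH]; intros g Hg; [exists 1; split; [lra | lia] | ].
    destruct (IH g) as [d [Hd Hdg]]; [auto | ].
    exists (Rmin d (g n)). split; [apply Rmin_glb_lt; auto | ].
    intros i Hi. destruct (Nat.eq_dec i n) as [-> | Hin]; [apply Rmin_r | ].
    eapply Rle_trans; [apply Rmin_l | apply Hdg; lia]. }
  intros HF.
  assert (R : forall s, exists d, (s < p)%nat -> 0 < d /\ forall t, (t < q)%nat -> d <= F s t).
  { intros s. destruct (lt_dec s p) as [Hs | Hs]; [ | exists 0; intros; lia].
    destruct (M q (F s)) as [d Hd]; [auto | ]. exists d; auto. }
  apply choice in R. destruct R as [g Hg].
  destruct (M p g) as [d [Hd Hdg]]; [intros i Hi; exact (proj1 (Hg i Hi)) | ].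
  exists d. split; [assumption | ]. intros s t Hs Ht.
  eapply Rle_trans; [exact (Hdg s Hs) | exact (proj2 (Hg s Hs) t Ht)].
Qed.

Lemma cos_add_cos a b : 2 * cos a + 2 * cos b = 4 * cos ((a + b) / 2) * cos ((a - b) / 2).
Proof.
  replace (cos a) with (cos ((a + b) / 2 + (a - b) / 2)) by (f_equal; field).
  replace (cos b) with (cos ((a + b) / 2 - (a - b) / 2)) by (f_equal; field).
  rewrite cos_plus, cos_minus. ring.
Qed.

Lemma IZR_PI_eq k l c : c <> 0 -> IZR k * PI / c = IZR l * PI / c -> k = l.
Proof.
  intros Hc E. assert (Hpi := PI_RGT_0). apply eq_IZR.
  replace (IZR k) with (IZR k * PI / c * (c / PI)) by (field; lra).
  rewrite E. field. lra.
Qed.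

(* At this twist the numerators of the two phases, over the even denominator [8 p q],
   have opposite parities. *)
Lemma generic_twist p q : (0 < p)%nat -> (0 < q)%nat -> exists x y d, 0 < d < 1 /\
  forall s t, (s < p)%nat -> (t < q)%nat ->
    2 * d <= Rabs (free_ev p q s t x y) <= 4 - 2 * d.
Proof.
  intros Hp Hq.
  assert (HpR : 0 < INR p) by now apply lt_0_INR.
  assert (HqR : 0 < INR q) by now apply lt_0_INR.
  set (P := Z.of_nat p). set (Q := Z.of_nat q).
  set (x := PI / (2 * INR p * INR q)). set (y := PI / (8 * INR p * INR q)).
  set (D := 8 * INR p * INR q). assert (HD : 0 < D) by (unfold D; nra).
  assert (HDZ : D = IZR (8 * P * Q)) by
    (unfold D, P, Q; rewrite !mult_IZR, <- !INR_IZR_INZ; reflexivity).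
  assert (X : forall s, x + 2 * PI * INR s / INR p = IZR (4 + 16 * Q * Z.of_nat s) * PI / D).
  { intros s. rewrite plus_IZR, !mult_IZR. unfold Q. rewrite <- !INR_IZR_INZ.
    unfold x, D. field. lra. }
  assert (Y : forall t, y + 2 * PI * INR t / INR q = IZR (1 + 16 * P * Z.of_nat t) * PI / D).
  { intros t. rewrite plus_IZR, !mult_IZR. unfold P. rewrite <- !INR_IZR_INZ.
    unfold y, D. field. lra. }
  assert (cos_ne : forall k, Z.odd k = true -> cos (IZR k * PI / (2 * D)) <> 0).
  { intros k Hk E. apply cos_eq_0_0 in E. destruct E as [l E].
    assert (E' : IZR k * PI / (2 * D) = IZR ((2 * l + 1) * (8 * P * Q)) * PI / (2 * D)).
    { rewrite E, mult_IZR, plus_IZR, mult_IZR, <- HDZ. field. lra. }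
    apply IZR_PI_eq in E'; [ | lra]. subst k.
    replace ((2 * l + 1) * (8 * P * Q))%Z with (2 * ((2 * l + 1) * (4 * P * Q)))%Z in Hk by ring.
    rewrite Z.odd_mul in Hk. discriminate. }
  assert (ev_ne : forall s t, free_ev p q s t x y <> 0).
  { intros s t. unfold free_ev. rewrite X, Y, cos_add_cos.
    replace ((IZR (4 + 16 * Q * Z.of_nat s) * PI / D + IZR (1 + 16 * P * Z.of_nat t) * PI / D) / 2)
      with (IZR (4 + 16 * Q * Z.of_nat s + (1 + 16 * P * Z.of_nat t)) * PI / (2 * D)) by
      (rewrite (plus_IZR (4 + _)); field; lra).
    replace ((IZR (4 + 16 * Q * Z.of_nat s) * PI / D - IZR (1 + 16 * P * Z.of_nat t) * PI / D) / 2)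
      with (IZR (4 + 16 * Q * Z.of_nat s - (1 + 16 * P * Z.of_nat t)) * PI / (2 * D)) by
      (rewrite (minus_IZR (4 + _)); field; lra).
    intros E. apply Rmult_integral in E. destruct E as [E | E].
    - apply Rmult_integral in E. destruct E as [E | E]; [lra | ].
      revert E. apply cos_ne.
      replace (4 + 16 * Q * Z.of_nat s + (1 + 16 * P * Z.of_nat t))%Z with
        (2 * (8 * Q * Z.of_nat s + 8 * P * Z.of_nat t + 2) + 1)%Z by ring.
      apply Z.odd_odd || (rewrite Z.add_comm, Z.odd_add_mul_2; reflexivity).
    - revert E. apply cos_ne.
      replace (4 + 16 * Q * Z.of_nat s - (1 + 16 * P * Z.of_nat t))%Z with
        (2 * (8 * Q * Z.of_nat s - 8 * P * Z.of_nat t + 1) + 1)%Z by ring.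
      apply Z.odd_odd || (rewrite Z.add_comm, Z.odd_add_mul_2; reflexivity). }
  (* The modulus 4 would require the second phase to be a multiple of pi, that is [1 + 16 p t] to be
     a multiple of [8 p q]. *)
  assert (ev_lt : forall s t, Rabs (free_ev p q s t x y) < 4).
  { intros s t. unfold free_ev. rewrite Y.
    set (b := IZR (1 + 16 * P * Z.of_nat t) * PI / D).
    assert (Hs : sin b <> 0).
    { intros E. apply sin_eq_0_0 in E. destruct E as [l E].
      assert (E' : IZR (1 + 16 * P * Z.of_nat t) * PI / D = IZR (l * (8 * P * Q)) * PI / D).
      { fold b. rewrite E, mult_IZR, <- HDZ. field. lra. }
      apply IZR_PI_eq in E'; [ | lra]. lia. }
    assert (S := sin2_cos2 b). unfold Rsqr in S.
    assert (Hc : -1 < cos b < 1) by nra.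
    generalize (COS_bound (x + 2 * PI * INR s / INR p)). intros.
    apply Rabs_def1; lra. }
  destruct (finite_min2 p q (fun s t => Rmin (Rabs (free_ev p q s t x y))
     (4 - Rabs (free_ev p q s t x y)))) as [d [Hd HF]].
  { intros s t _ _. apply Rmin_glb_lt; [now apply Rabs_pos_lt | ].
    specialize (ev_lt s t). lra. }
  exists x, y, (Rmin (d / 2) (1 / 2)). split.
  - split; [apply Rmin_glb_lt; lra | ]. generalize (Rmin_r (d / 2) (1 / 2)); lra.
  - intros s t Hs Ht. specialize (HF s t Hs Ht).
    generalize (Rmin_l (d / 2) (1 / 2)), (Rmin_l (Rabs (free_ev p q s t x y))
      (4 - Rabs (free_ev p q s t x y))), (Rmin_r (Rabs (free_ev p q s t x y))
      (4 - Rabs (free_ev p q s t x y))). lra.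
Qed.

(** A Bloch eigenvector is not square summable; it contradicts instead the bound on cells that a
    resolvent point would give. *)
Lemma spectrum_of_bloch V (HV : exists B, forall s, Rabs (V s) <= B) p q e x y f s :
  (0 < p)%nat -> (0 < q)%nat -> per (Z.of_nat p) (Z.of_nat q) V ->
  per (Z.of_nat p) (Z.of_nat q) f -> f s <> RtoC 0 ->
  (forall s, twisted_Hz V x y (RtoC e) f s = RtoC 0) -> ~ resolvent V (RtoC e).
Proof.
  intros Hp Hq HVp Hf Hs Hker HR.
  destruct (bounded_below_of_resolvent V HV _ HR) as [c [Hc HB]].
  assert (C := cell_below_of_l2 V HV p q x y _ c Hp Hq HVp Hc HB f Hf).
  assert (Z : cnn p q (twisted_Hz V x y (RtoC e) f) = 0).
  { unfold cnn, rsum, zsum. rewrite (nsum_ext p _ (fun _ => 0)); [rewrite nsum_const; ring | ].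
    intros. rewrite (nsum_ext q _ (fun _ => 0)); [rewrite nsum_const; ring | ].
    intros. unfold re2. rewrite Hker. simpl. ring. }
  rewrite Z in C.
  assert (B := per_bounded p q f Hp Hq Hf s).
  assert (0 < Cnorm2 (f s)).
  { unfold Cnorm2. destruct (Req_dec (fst (f s)) 0) as [E1 | E1];
      [destruct (Req_dec (snd (f s)) 0) as [E2 | E2] | ].
    - exfalso. apply Hs. apply C_eq; assumption.
    - nra.
    - nra. }
  nra.
Qed.

(** * Sign changes of the free determinant *)

Fixpoint nprod (n : nat) (f : nat -> R) : R :=
  match n with O => 1 | S k => nprod k f * f k end.

Definition free_det (p q : nat) (x y e : R) : R :=
  nprod p (fun s => nprod q (fun t => free_ev p q s t x y - e)).

Lemma nprod_ext n f g : (forall i, (i < n)%nat -> f i = g i) -> nprod n f = nprod n g.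
Proof.
  induction n as [|n IH]; intros E; simpl; [reflexivity | ].
  rewrite (E n), IH; auto.
Qed.

Lemma nprod_mul n f g : nprod n (fun i => f i * g i) = nprod n f * nprod n g.
Proof. induction n as [|n IH]; simpl; [ring | rewrite IH; ring]. Qed.

Lemma nprod_one n : nprod n (fun _ => 1) = 1.
Proof. induction n as [|n IH]; simpl; [reflexivity | rewrite IH; ring]. Qed.

Lemma nprod_exchange n m (F : nat -> nat -> R) :
  nprod n (fun i => nprod m (F i)) = nprod m (fun j => nprod n (fun i => F i j)).
Proof.
  induction n as [|n IH]; simpl.
  - now rewrite nprod_one.
  - now rewrite IH, nprod_mul.
Qed.

Lemma nprod_split n m f : nprod (n + m) f = nprod n f * nprod m (fun i => f (n + i)%nat).
Proof.
  induction m as [|m IH]; simpl; [rewrite Nat.add_0_r; ring | ].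
  rewrite Nat.add_succ_r; simpl. rewrite IH; ring.
Qed.

Lemma nprod_rev n f : nprod n (fun i => f (n - 1 - i)%nat) = nprod n f.
Proof.
  induction n as [|n IH]; [reflexivity | ].
  change (S n) with (1 + n)%nat at 1. rewrite nprod_split. simpl.
  rewrite (nprod_ext n _ (fun i => f (n - 1 - i)%nat)) by (intros; f_equal; lia).
  rewrite IH, !Nat.sub_0_r. ring.
Qed.

Lemma nprod_double n f : nprod (2 * n) f = nprod n (fun i => f (2 * i)%nat * f (2 * i + 1)%nat).
Proof.
  induction n as [|n IH]; [reflexivity | ].
  replace (2 * S n)%nat with (S (S (2 * n))) by lia. cbn [nprod].
  rewrite IH. replace (S (2 * n)) with (2 * n + 1)%nat by lia. ring.
Qed.

Lemma nprod_pos n f : (forall i, (i < n)%nat -> 0 < f i) -> 0 < nprod n f.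
Proof.
  induction n as [|n IH]; intros Hf; simpl; [lra | ].
  apply Rmult_lt_0_compat; auto.
Qed.

Lemma nprod_neq0 n f : (forall i, (i < n)%nat -> f i <> 0) -> nprod n f <> 0.
Proof.
  induction n as [|n IH]; intros Hf; simpl; [lra | ].
  apply Rmult_integral_contrapositive_currified; auto.
Qed.

Lemma nprod_neg_first n f : (0 < n)%nat -> f O < 0 ->
  (forall i, (0 < i < n)%nat -> 0 < f i) -> nprod n f < 0.
Proof.
  intros Hn H0 Hf. destruct n as [|n]; [lia | ].
  change (S n) with (1 + n)%nat. rewrite nprod_split. simpl.
  assert (0 < nprod n (fun i => f (S i))) by (apply nprod_pos; intros; apply Hf; lia).
  nra.
Qed.

Lemma nprod_neg_odd n f : Nat.odd n = true ->
  (forall i, (i < n)%nat -> f i < 0) -> nprod n f < 0.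
Proof.
  intros Hn Hf. apply Nat.odd_spec in Hn. destruct Hn as [k ->].
  rewrite nprod_split. cbn [nprod]. rewrite nprod_double.
  assert (0 < nprod k (fun i => f (2 * i)%nat * f (2 * i + 1)%nat)).
  { apply nprod_pos. intros i Hi.
    assert (f (2 * i)%nat < 0) by (apply Hf; lia).
    assert (f (2 * i + 1)%nat < 0) by (apply Hf; lia). nra. }
  assert (f (2 * k + 0)%nat < 0) by (apply Hf; lia). nra.
Qed.

Lemma free_det_swap p q x y e : free_det p q x y e = free_det q p y x e.
Proof.
  unfold free_det. rewrite nprod_exchange. apply nprod_ext; intros t _.
  apply nprod_ext; intros s _. unfold free_ev. ring.
Qed.

(* At energy 0 the two twists y = 0 and y = PI / q together run through all angles
   PI k / q with k < 2 q, paired by k <-> 2 q - k except for k = 0 and k = q. *)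
Lemma free_det_zero p q : (0 < p)%nat -> (0 < q)%nat -> Nat.odd p = true ->
  exists x y1 y2, free_det p q x y1 0 * free_det p q x y2 0 < 0.
Proof.
  intros Hp Hq Hodd.
  assert (HpR : 0 < INR p) by now apply lt_0_INR.
  assert (HqR : 0 < INR q) by now apply lt_0_INR.
  set (P := Z.of_nat p). set (Q := Z.of_nat q).
  set (x := PI / (2 * INR p * INR q)).
  set (D := 2 * INR p * INR q). assert (HD : 0 < D) by (unfold D; nra).
  assert (HDZ : D = IZR (2 * P * Q)) by
    (unfold D, P, Q; rewrite !mult_IZR, <- !INR_IZR_INZ; reflexivity).
  set (X := fun s : nat => x + 2 * PI * INR s / INR p).
  assert (HX : forall s, X s = IZR (1 + 4 * Q * Z.of_nat s) * PI / D).
  { intros s. rewrite plus_IZR, !mult_IZR. unfold Q. rewrite <- !INR_IZR_INZ.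
    unfold X, x, D. field. lra. }
  assert (cos_ne : forall k, Z.odd k = true -> cos (IZR k * PI / (2 * D)) <> 0).
  { intros k Hk E. apply cos_eq_0_0 in E. destruct E as [l E].
    assert (E' : IZR k * PI / (2 * D) = IZR ((2 * l + 1) * (2 * P * Q)) * PI / (2 * D)).
    { rewrite E, mult_IZR, plus_IZR, mult_IZR, <- HDZ. field. lra. }
    apply IZR_PI_eq in E'; [ | lra]. subst k.
    replace ((2 * l + 1) * (2 * P * Q))%Z with (2 * ((2 * l + 1) * (P * Q)))%Z in Hk by ring.
    rewrite Z.odd_mul in Hk. discriminate. }
  set (h := fun s k : nat => 2 * cos (X s) + 2 * cos (PI * INR k / INR q)).
  assert (h_ne : forall s k, h s k <> 0).
  { intros s k. unfold h. rewrite cos_add_cos.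
    assert (Hk : PI * INR k / INR q = IZR (2 * P * Z.of_nat k) * PI / D).
    { rewrite !mult_IZR. unfold P. rewrite <- !INR_IZR_INZ. unfold D. field. lra. }
    rewrite HX, Hk.
    replace ((IZR (1 + 4 * Q * Z.of_nat s) * PI / D + IZR (2 * P * Z.of_nat k) * PI / D) / 2)
      with (IZR (1 + 4 * Q * Z.of_nat s + 2 * P * Z.of_nat k) * PI / (2 * D)) by
      (rewrite (plus_IZR (1 + _)); field; lra).
    replace ((IZR (1 + 4 * Q * Z.of_nat s) * PI / D - IZR (2 * P * Z.of_nat k) * PI / D) / 2)
      with (IZR (1 + 4 * Q * Z.of_nat s - 2 * P * Z.of_nat k) * PI / (2 * D)) by
      (rewrite (minus_IZR (1 + _)); field; lra).
    intros E. apply Rmult_integral in E. destruct E as [E | E].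
    - apply Rmult_integral in E. destruct E as [E | E]; [lra | ].
      revert E. apply cos_ne.
      replace (1 + 4 * Q * Z.of_nat s + 2 * P * Z.of_nat k)%Z with
        (1 + 2 * (2 * Q * Z.of_nat s + P * Z.of_nat k))%Z by ring.
      now rewrite Z.odd_add_mul_2.
    - revert E. apply cos_ne.
      replace (1 + 4 * Q * Z.of_nat s - 2 * P * Z.of_nat k)%Z with
        (1 + 2 * (2 * Q * Z.of_nat s - P * Z.of_nat k))%Z by ring.
      now rewrite Z.odd_add_mul_2. }
  (* The product is [4 (cos^2 - 1) = -4 sin^2] at the angle [X s], which by parity is not a multiple
     of pi. *)
  assert (h_ends : forall s, h s O * h s q < 0).
  { intros s. unfold h. replace (PI * INR 0 / INR q) with 0 by (simpl; field; lra).
    replace (PI * INR q / INR q) with PI by (field; lra). rewrite cos_0, cos_PI.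
    assert (Hs : sin (X s) <> 0).
    { rewrite HX. intros E. apply sin_eq_0_0 in E. destruct E as [l E].
      assert (E' : IZR (1 + 4 * Q * Z.of_nat s) * PI / D = IZR (l * (2 * P * Q)) * PI / D).
      { rewrite E, mult_IZR, <- HDZ. field. lra. }
      apply IZR_PI_eq in E'; [ | lra].
      assert (O : Z.odd (1 + 2 * (2 * Q * Z.of_nat s)) = Z.odd (2 * (l * P * Q))) by
        (f_equal; lia).
      rewrite Z.odd_add_mul_2, Z.odd_mul in O. discriminate. }
    assert (S := sin2_cos2 (X s)). unfold Rsqr in S.
    assert (0 < sin (X s) * sin (X s)) by
      (destruct (Rtotal_order (sin (X s)) 0) as [?|[?|?]]; nra).
    nra. }
  exists x, 0, (PI / INR q). unfold free_det. rewrite <- nprod_mul.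
  (* For each [s] the product over both twists is negative, and the number [p] of these factors is
     odd. *)
  apply nprod_neg_odd; [assumption | ]. intros s _. rewrite <- nprod_mul.
  rewrite (nprod_ext q _ (fun t => h s (2 * t)%nat * h s (2 * t + 1)%nat)).
  2: { intros t _. unfold free_ev, h. fold (X s). rewrite !Rminus_0_r. f_equal.
       - do 2 f_equal. f_equal. rewrite mult_INR. simpl. field. lra.
       - do 2 f_equal. f_equal. rewrite plus_INR, mult_INR. simpl. field. lra. }
  rewrite <- nprod_double.
  replace (2 * q)%nat with (1 + ((q - 1) + (1 + (q - 1))))%nat by lia.
  rewrite nprod_split, nprod_split, nprod_split.
  set (M := nprod (q - 1) (fun i => h s (1 + i)%nat)).
  assert (Rv : nprod (q - 1) (fun i => h s (1 + (q - 1 + (1 + i)))%nat) = M).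
  { unfold M. rewrite <- (nprod_rev (q - 1) (fun i => h s (1 + i)%nat)).
    apply nprod_ext; intros i Hi. unfold h. f_equal. f_equal.
    rewrite <- (cos_neg (PI * INR (1 + (q - 1 - 1 - i)) / INR q)).
    rewrite <- (cos_add_2PI_Z (- _) 1). f_equal.
    replace (INR (1 + (q - 1 - 1 - i))) with (2 * INR q - INR (1 + (q - 1 + (1 + i)))).
    - field. lra.
    - change 2 with (INR 2). rewrite <- mult_INR, <- minus_INR by lia. f_equal. lia. }
  rewrite Rv. cbn [nprod].
  replace (1 + (q - 1 + 0))%nat with q by lia.
  assert (HM : M <> 0) by (apply nprod_neq0; auto).
  assert (0 < M * M) by (destruct (Rtotal_order M 0) as [?|[?|?]]; nra).
  assert (He := h_ends s).
  replace (1 * h s 0%nat * (M * (1 * h s q * M))) with (h s 0%nat * h s q * (M * M)) by ring.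
  assert (0 < - (h s 0%nat * h s q) * (M * M)) by (apply Rmult_lt_0_compat; lra). lra.
Qed.

(** * Zeros of polynomials and translates of a level curve *)

Fixpoint peval (l : list R) (x : R) : R :=
  match l with nil => 0 | cons a l => a + x * peval l x end.

(** Synthetic division: the quotient of [l(x) - l(a)] by [x - a], whose coefficients are the Horner
    values of the tails at [a]. *)
Fixpoint pquot (l : list R) (a : R) : list R :=
  match l with
  | nil => nil
  | cons _ l => match l with nil => nil | _ => cons (peval l a) (pquot l a) end
  end.

Lemma peval_quot l a x : peval l x - peval l a = (x - a) * peval (pquot l a) x.
Proof.
  induction l as [|c l IH]; [simpl; ring | ].
  destruct l as [|c' l]; [simpl; ring | ].
  change (pquot (cons c (cons c' l)) a) with
    (cons (peval (cons c' l) a) (pquot (cons c' l) a)).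
  remember (cons c' l) as l'. simpl.
  replace (c + x * peval l' x - (c + a * peval l' a)) with
    (x * (peval l' x - peval l' a) + (x - a) * peval l' a) by ring.
  rewrite IH. ring.
Qed.

Lemma length_pquot l a : length (pquot l a) = (length l - 1)%nat.
Proof.
  induction l as [|c l IH]; [reflexivity | ].
  destruct l as [|c' l]; [reflexivity | ].
  change (pquot (cons c (cons c' l)) a) with
    (cons (peval (cons c' l) a) (pquot (cons c' l) a)).
  simpl length in *. rewrite IH. lia.
Qed.

(** Induction on the number of coefficients, one root being divided out at a time. *)
Lemma finite_roots l : (exists x, peval l x <> 0) ->
  exists r : list R, forall x, peval l x = 0 -> List.In x r.
Proof.
  remember (length l) as n eqn:Hn. revert l Hn.
  induction n as [|n IH]; intros l Hn [x0 Hx0].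
  - destruct l; [simpl in Hx0; lra | discriminate].
  - destruct (classic (exists a, peval l a = 0)) as [[a Ha] | Hno].
    + destruct (IH (pquot l a)) as [r Hr].
      * rewrite length_pquot. lia.
      * exists x0. intros E. apply Hx0.
        assert (Q := peval_quot l a x0). rewrite E, Ha in Q. lra.
      * exists (cons a r). intros x Hx. destruct (Req_dec x a) as [-> | Hxa]; [now left | ].
        right. apply Hr. assert (Q := peval_quot l a x). rewrite Hx, Ha in Q.
        assert (E : (x - a) * peval (pquot l a) x = 0) by lra.
        apply Rmult_integral in E. destruct E; [lra | assumption].
    + exists nil. intros x Hx. exfalso. apply Hno. now exists x.
Qed.

Lemma avoid_finite (r : list R) lo hi : lo < hi ->
  exists x, lo < x < hi /\ ~ List.In x r.
Proof.
  revert lo hi. induction r as [|a r IH]; intros lo hi H.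
  - exists ((lo + hi) / 2). split; [lra | intros []].
  - destruct (Rlt_dec lo a) as [H1 | H1].
    + destruct (IH lo (Rmin a hi)) as [x [Hx Hr]].
      * apply Rmin_glb_lt; assumption.
      * exists x. assert (Rmin a hi <= a) by apply Rmin_l.
        assert (Rmin a hi <= hi) by apply Rmin_r.
        split; [lra | ]. intros [E | E]; [lra | contradiction].
    + destruct (IH lo hi H) as [x [Hx Hr]]. exists x. split; [assumption | ].
      intros [E | E]; [lra | contradiction].
Qed.

Lemma avoid_finite2 p q (B : nat -> nat -> R -> Prop) lo hi : lo < hi ->
  (forall s t, (s < p)%nat -> (t < q)%nat -> exists r : list R, forall x, B s t x -> List.In x r) ->
  exists x, lo < x < hi /\ forall s t, (s < p)%nat -> (t < q)%nat -> ~ B s t x.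
Proof.
  intros Hlh HB.
  assert (U : forall n (G : nat -> R -> Prop),
    (forall i, (i < n)%nat -> exists r : list R, forall x, G i x -> List.In x r) ->
    exists r : list R, forall i x, (i < n)%nat -> G i x -> List.In x r).
  { induction n as [|n IH]; intros G HG; [exists nil; intros; lia | ].
    destruct (IH G) as [r Hr]; [auto | ]. destruct (HG n) as [r' Hr']; [lia | ].
    exists (r ++ r')%list. intros i x Hi Hx. apply List.in_or_app.
    destruct (Nat.eq_dec i n) as [-> | Hne]; [right; auto | left].
    apply Hr with i; [lia | assumption]. }
  destruct (U p (fun s x => exists t, (t < q)%nat /\ B s t x)) as [r Hr].
  { intros s Hs. destruct (U q (B s)) as [r Hr]; [auto | ].
    exists r. intros x [t [Ht Hx]]. now apply Hr with t. }
  destruct (avoid_finite r lo hi Hlh) as [x [Hx Hnr]].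
  exists x. split; [assumption | ]. intros s t Hs Ht Hb. apply Hnr.
  apply Hr with s; [assumption | ]. now exists t.
Qed.

(* [C = cos x] and [S], [T] are the sines on the level curve cos x + cos y = c; squaring
   the equation of the curve translated by (alpha, beta) twice gives a quartic in [C]. *)
Lemma translated_level_roots c ca sa cb sb : c <> 0 ->
  ca * ca + sa * sa = 1 -> cb * cb + sb * sb = 1 -> ~ (ca = 1 /\ cb = 1) ->
  exists r : list R, forall C S T, C * C + S * S = 1 -> (c - C) * (c - C) + T * T = 1 ->
    (C * ca - S * sa) + ((c - C) * cb - T * sb) = c -> List.In C r.
Proof.
  intros Hc Ha Hb Hab.
  set (k := ca - cb). set (d := c * (1 - cb)). set (A := sa * sa). set (B := sb * sb).
  set (w := 1 - c * c).
  set (u2 := k * k + A + B). set (u1 := - 2 * k * d - 2 * c * B). set (u0 := d * d - A - B * w).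
  set (l := cons (u0 * u0 - 4 * A * B * w) (cons (2 * u0 * u1 - 8 * c * A * B)
    (cons (u1 * u1 + 2 * u0 * u2 + 4 * A * B * (1 + w))
    (cons (2 * u1 * u2 + 8 * c * A * B) (cons (u2 * u2 - 4 * A * B) nil))))).
  assert (Hl : forall C, peval l C = (u2 * C * C + u1 * C + u0) * (u2 * C * C + u1 * C + u0)
    - 4 * A * B * (1 - C * C) * (w + 2 * c * C - C * C)) by (intros; simpl; ring).
  assert (HA : A = 1 - ca * ca) by (unfold A; lra).
  assert (HB : B = 1 - cb * cb) by (unfold B; lra).
  assert (nz : exists x, peval l x <> 0).
  { apply NNPP. intros Hno.
    assert (Z : forall C, peval l C = 0).
    { intros C. apply NNPP. intros H. apply Hno. now exists C. }
    (* The fourth difference at -2, ..., 2 is 24 times the leading coefficient, which equals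
       [4 k^2]. *)
    assert (E4 : 96 * (k * k) = 0).
    { transitivity (peval l 2 - 4 * peval l 1 + 6 * peval l 0 - 4 * peval l (-1) + peval l (-2)).
      - rewrite !Hl. unfold u2. rewrite HA, HB. unfold k. ring.
      - rewrite !Z. ring. }
    assert (Hk : k = 0) by nra.
    assert (Hcab : ca = cb) by (unfold k in Hk; lra).
    assert (HAB : A = B) by (rewrite HA, HB, Hcab; ring).
    (* For [k = 0] the quartic term is gone, and the second difference is twice the coefficient of
       [C^2]. *)
    assert (E2 : 8 * (A * (c * c) * ((1 - cb) * (1 - cb) + A)) = 0).
    { transitivity (peval l 1 - 2 * peval l 0 + peval l (-1)).
      - rewrite !Hl. unfold u2, u1, u0, d, w. rewrite <- HAB, Hk.
        unfold w. ring.
      - rewrite !Z. ring. }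
    assert (HA0 : 0 <= A) by (unfold A; nra).
    assert (Hc2 : 0 < c * c) by (destruct (Rtotal_order c 0) as [?|[?|?]]; nra).
    assert (A0 : A = 0).
    { assert (E3 : A * (c * c) * ((1 - cb) * (1 - cb) + A) = 0) by lra.
      apply Rmult_integral in E3. destruct E3 as [E3 | E3].
      - apply Rmult_integral in E3. destruct E3; [assumption | lra].
      - nra. }
    (* What remains is the constant term [d^4]. As [c <> 0], it forces [cb = 1], hence [ca = 1]; for
       [c = 0] the translation by (pi, pi) would survive. *)
    assert (E0 : d * d * (d * d) = 0).
    { rewrite <- (Z 0), Hl. unfold u0. rewrite <- HAB, A0. ring. }
    assert (Hd : d = 0) by (destruct (Rtotal_order d 0) as [?|[?|?]]; [ | assumption | ];
      exfalso; assert (0 < d * d) by nra; nra).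
    unfold d in Hd. apply Rmult_integral in Hd. destruct Hd as [Hd | Hd]; [contradiction | ].
    apply Hab. lra. }
  destruct (finite_roots l nz) as [r Hr]. exists r. intros C S T HS HT E.
  apply Hr. rewrite Hl.
  assert (HS2 : S * S = 1 - C * C) by lra.
  assert (HT2 : T * T = w + 2 * c * C - C * C) by (unfold w; lra).
  assert (E1 : k * C - d = S * sa + T * sb) by (unfold k, d; lra).
  assert (E2 : u2 * C * C + u1 * C + u0 = 2 * (S * sa * (T * sb))).
  { transitivity ((k * C - d) * (k * C - d) - A * (1 - C * C) - B * (w + 2 * c * C - C * C)).
    - unfold u2, u1, u0. ring.
    - rewrite E1, <- HS2, <- HT2. unfold A, B. ring. }
  rewrite E2, <- HT2, <- HS2. unfold A, B. ring.
Qed.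

Lemma cos_eq_1_cell p s : (s < p)%nat -> cos (2 * PI * INR s / INR p) = 1 -> s = O.
Proof.
  intros Hs E. destruct s as [|s]; [reflexivity | exfalso].
  assert (HpR : 0 < INR p) by (apply lt_0_INR; lia).
  assert (Hpi := PI_RGT_0).
  replace (2 * PI * INR (S s) / INR p) with (2 * (PI * INR (S s) / INR p)) in E by (field; lra).
  rewrite cos_2a_sin in E.
  assert (0 < sin (PI * INR (S s) / INR p)).
  { apply sin_gt_0.
    - apply Rdiv_lt_0_compat; [apply Rmult_lt_0_compat; [assumption | apply lt_0_INR; lia] | assumption].
    - apply Rlt_div_l; [assumption | ]. apply Rmult_lt_compat_l; [assumption | now apply lt_INR]. }
  nra.
Qed.

Lemma cos_lipschitz a b : Rabs (cos a - cos b) <= Rabs (a - b).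
Proof.
  assert (E := Cnorm2_cis_sub a b). unfold Cnorm2, cis in E; simpl in E.
  apply Rsqr_le_abs_0. unfold Rsqr.
  assert (P := Rle_0_sqr (sin a + - sin b)). unfold Rsqr in P. lra.
Qed.

(* Away from energies 0 and +-4 the level curve has a point lying on no other translate,
   where exactly one factor of the free determinant changes sign. *)
Lemma free_det_nonzero p q e : (0 < p)%nat -> (0 < q)%nat -> -4 < e < 4 -> e <> 0 ->
  exists x1 y1 x2 y2, free_det p q x1 y1 e * free_det p q x2 y2 e < 0.
Proof.
  intros Hp Hq He He0. set (c := e / 2).
  assert (HpR : 0 < INR p) by now apply lt_0_INR.
  assert (HqR : 0 < INR q) by now apply lt_0_INR.
  set (al := fun s : nat => 2 * PI * INR s / INR p).
  set (be := fun t : nat => 2 * PI * INR t / INR q).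
  (* A point [(x, y)] of the level curve is encoded by [C = cos x], with [cos y = c - C]. The
     interval consists of the [C] for which both cosines lie in [(-1, 1)]; only finitely many of
     them belong to another translate. *)
  destruct (avoid_finite2 p q (fun s t C => ~ (s = O /\ t = O) /\
    exists S T, C * C + S * S = 1 /\ (c - C) * (c - C) + T * T = 1 /\
    (C * cos (al s) - S * sin (al s)) + ((c - C) * cos (be t) - T * sin (be t)) = c)
    (Rmax (-1) (c - 1)) (Rmin 1 (c + 1))) as [C [HC HB]].
  { apply Rmax_lub_lt; apply Rmin_glb_lt; unfold c; lra. }
  { intros s t Hs Ht.
    destruct (classic (s = O /\ t = O)) as [Hst | Hst];
      [exists nil; intros x [H _]; contradiction | ].
    destruct (translated_level_roots c (cos (al s)) (sin (al s)) (cos (be t)) (sin (be t)))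
      as [r Hr].
    - unfold c; lra.
    - generalize (sin2_cos2 (al s)); unfold Rsqr; lra.
    - generalize (sin2_cos2 (be t)); unfold Rsqr; lra.
    - intros [E1 E2]. apply Hst. split.
      + apply (cos_eq_1_cell p); assumption.
      + apply (cos_eq_1_cell q); assumption.
    - exists r. intros x [_ [S [T [H1 [H2 H3]]]]]. now apply Hr with S T. }
  assert (HC1 : -1 < C < 1).
  { generalize (Rmax_l (-1) (c - 1)), (Rmin_l 1 (c + 1)). lra. }
  assert (HC2 : -1 < c - C < 1).
  { generalize (Rmax_r (-1) (c - 1)), (Rmin_r 1 (c + 1)). lra. }
  set (x := acos C). set (y := acos (c - C)).
  assert (Hx : cos x = C) by (apply cos_acos; lra).
  assert (Hy : cos y = c - C) by (apply cos_acos; lra).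
  assert (Hxb : 0 < x < PI).
  { unfold x. assert (B := acos_bound C).
    assert (x <> 0) by (intros E; fold x in B; rewrite E, cos_0 in Hx; lra).
    assert (x <> PI) by (intros E; rewrite E, cos_PI in Hx; lra).
    fold x in B |- *. lra. }
  assert (F0 : forall s t, (s < p)%nat -> (t < q)%nat -> ~ (s = O /\ t = O) ->
    free_ev p q s t x y - e <> 0).
  { intros s t Hs Ht Hst E. apply (HB s t Hs Ht). split; [assumption | ].
    exists (sin x), (sin y).
    assert (S1 := sin2_cos2 x). assert (S2 := sin2_cos2 y). unfold Rsqr in S1, S2.
    rewrite Hx in S1. rewrite Hy in S2. split; [lra | split; [lra | ]].
    unfold free_ev in E. fold (al s) (be t) in E. rewrite !cos_plus, Hx, Hy in E.
    unfold c in *. lra. }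
  (* The factor of index (0, 0) vanishes at [(x, y)] and is replaced by 1 in the minimum. *)
  destruct (finite_min2 p q (fun s t => if (s + t =? 0)%nat then 1
    else Rabs (free_ev p q s t x y - e))) as [m [Hm Hmin]].
  { intros s t Hs Ht. destruct (Nat.eqb_spec (s + t) 0); [lra | ].
    apply Rabs_pos_lt. apply F0; lia. }
  (* Each factor moves by at most [2 h <= m / 2], so the other factors keep their signs; [x - h] and
     [x + h] stay in [(0, pi)], where the cosine is strictly decreasing. *)
  set (h := Rmin (m / 4) (Rmin (x / 2) ((PI - x) / 2))).
  assert (Hh : 0 < h) by (unfold h; repeat apply Rmin_glb_lt; lra).
  assert (Hh1 : h <= m / 4) by apply Rmin_l.
  assert (Hh2 : h <= x / 2) by
    (eapply Rle_trans; [apply Rmin_r | apply Rmin_l]).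
  assert (Hh3 : h <= (PI - x) / 2) by
    (eapply Rle_trans; [apply Rmin_r | apply Rmin_r]).
  exists (x + h), y, (x - h), y.
  unfold free_det. rewrite <- nprod_mul.
  rewrite (nprod_ext p _ (fun s => nprod q (fun t =>
    (free_ev p q s t (x + h) y - e) * (free_ev p q s t (x - h) y - e)))) by
    (intros; now rewrite nprod_mul).
  assert (pos : forall s t, (s < p)%nat -> (t < q)%nat -> ~ (s = O /\ t = O) ->
    0 < (free_ev p q s t (x + h) y - e) * (free_ev p q s t (x - h) y - e)).
  { intros s t Hs Ht Hst. assert (M := Hmin s t Hs Ht). cbv beta in M.
    destruct (Nat.eqb_spec (s + t) 0); [lia | ].
    assert (L1 := cos_lipschitz (x + h + 2 * PI * INR s / INR p) (x + 2 * PI * INR s / INR p)).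
    assert (L2 := cos_lipschitz (x - h + 2 * PI * INR s / INR p) (x + 2 * PI * INR s / INR p)).
    replace (x + h + 2 * PI * INR s / INR p - (x + 2 * PI * INR s / INR p)) with h in L1 by ring.
    replace (x - h + 2 * PI * INR s / INR p - (x + 2 * PI * INR s / INR p)) with (- h) in L2 by ring.
    rewrite Rabs_Ropp in L2. rewrite (Rabs_pos_eq h) in L1, L2 by lra.
    apply Rabs_le_between in L1, L2.
    unfold free_ev in *.
    unfold Rabs in M. destruct (Rcase_abs _) in M.
    - apply Rmult_neg_neg; lra.
    - apply Rmult_lt_0_compat; lra. }
  apply nprod_neg_first; [assumption | | ].
  - apply nprod_neg_first; [assumption | | ].
    + unfold free_ev. simpl (INR 0).
      replace (2 * PI * 0 / INR p) with 0 by (field; lra).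
      replace (2 * PI * 0 / INR q) with 0 by (field; lra). rewrite !Rplus_0_r, Hy.
      assert (cos (x + h) < cos x) by (apply cos_decreasing_1; lra).
      assert (cos x < cos (x - h)) by (apply cos_decreasing_1; lra).
      rewrite Hx in *. unfold c in *. nra.
    + intros t Ht. apply pos; lia.
  - intros s Hs. apply nprod_pos; intros t Ht. apply pos; lia.
Qed.

(** * The spectrum *)

Definition cell_up (p i : nat) : nat := if (i + 1 =? p)%nat then 0%nat else (i + 1)%nat.
Definition cell_dn (p i : nat) : nat := if (i =? 0)%nat then (p - 1)%nat else (i - 1)%nat.

Definition cell_eigen (p q : nat) (W : nat -> nat -> R) (x y e : R) (v : nat -> nat -> C) :=
  forall i j, (i < p)%nat -> (j < q)%nat ->
    (cis (- x) * v (cell_dn p i) j + cis x * v (cell_up p i) j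
     + cis (- y) * v i (cell_dn q j) + cis y * v i (cell_up q j)
     + RtoC (W i j) * v i j - RtoC e * v i j = 0)%C.

(** The one fact on determinants that the spectral argument uses: a sign change of the free
    determinant yields eigenvalues for all small potentials and nearby energies. It stays a
    hypothesis until the matrices are available. *)
Definition stable_sign_change (p q : nat) : Prop := forall e0 x1 y1 x2 y2,
  free_det p q x1 y1 e0 * free_det p q x2 y2 e0 < 0 ->
  exists rho, 0 < rho /\ forall W e, (forall i j, Rabs (W i j) <= rho) -> Rabs (e - e0) <= rho ->
    exists x y v i j, (i < p)%nat /\ (j < q)%nat /\ v i j <> RtoC 0 /\
      cell_eigen p q W x y e v.

Lemma cell_index_up p n : (0 < p)%nat ->
  Z.to_nat ((n + 1) mod Z.of_nat p) = cell_up p (Z.to_nat (n mod Z.of_nat p)).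
Proof.
  intros Hp. unfold cell_up.
  assert (B := Z.mod_pos_bound n (Z.of_nat p) ltac:(lia)).
  assert (E := Z.div_mod n (Z.of_nat p) ltac:(lia)).
  set (r := (n mod Z.of_nat p)%Z) in *. set (k := (n / Z.of_nat p)%Z) in *.
  destruct (Nat.eqb_spec (Z.to_nat r + 1) p) as [H | H].
  - replace (n + 1)%Z with (0 + (k + 1) * Z.of_nat p)%Z by lia.
    rewrite Z_mod_plus_full, Z.mod_0_l by lia. reflexivity.
  - replace (n + 1)%Z with (r + 1 + k * Z.of_nat p)%Z by lia.
    rewrite Z_mod_plus_full, Z.mod_small by lia. lia.
Qed.

Lemma cell_index_dn p n : (0 < p)%nat ->
  Z.to_nat ((n - 1) mod Z.of_nat p) = cell_dn p (Z.to_nat (n mod Z.of_nat p)).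
Proof.
  intros Hp. unfold cell_dn.
  assert (B := Z.mod_pos_bound n (Z.of_nat p) ltac:(lia)).
  assert (E := Z.div_mod n (Z.of_nat p) ltac:(lia)).
  set (r := (n mod Z.of_nat p)%Z) in *. set (k := (n / Z.of_nat p)%Z) in *.
  destruct (Nat.eqb_spec (Z.to_nat r) 0) as [H | H].
  - replace (n - 1)%Z with (Z.of_nat p - 1 + (k - 1) * Z.of_nat p)%Z by lia.
    rewrite Z_mod_plus_full, Z.mod_small by lia. lia.
  - replace (n - 1)%Z with (r - 1 + k * Z.of_nat p)%Z by lia.
    rewrite Z_mod_plus_full, Z.mod_small by lia. lia.
Qed.

Lemma spectrum_of_cell_eigen p q V (HV : exists B, forall s, Rabs (V s) <= B) x y e v i j :
  (0 < p)%nat -> (0 < q)%nat -> per (Z.of_nat p) (Z.of_nat q) V ->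
  (i < p)%nat -> (j < q)%nat -> v i j <> RtoC 0 ->
  cell_eigen p q (fun i j => V (Z.of_nat i, Z.of_nat j)) x y e v ->
  ~ resolvent V (RtoC e).
Proof.
  intros Hp Hq HVp Hi Hj Hv He.
  set (f := (fun s => v (Z.to_nat (fst s mod Z.of_nat p)) (Z.to_nat (snd s mod Z.of_nat q))) : field).
  apply (spectrum_of_bloch V HV p q e x y f (Z.of_nat i, Z.of_nat j)); try assumption.
  - intros n m. unfold f; cbn [fst snd]. split; f_equal; f_equal.
    + replace (n + Z.of_nat p)%Z with (n + 1 * Z.of_nat p)%Z by ring. apply Z_mod_plus_full.
    + replace (m + Z.of_nat q)%Z with (m + 1 * Z.of_nat q)%Z by ring. apply Z_mod_plus_full.
  - unfold f; cbn [fst snd]. rewrite !Z.mod_small, !Nat2Z.id by lia. exact Hv.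
  - intros [n m]. unfold twisted_Hz, twisted_H, f; cbn [fst snd].
    rewrite !cell_index_up, !cell_index_dn by assumption.
    assert (Bn := Z.mod_pos_bound n (Z.of_nat p) ltac:(lia)).
    assert (Bm := Z.mod_pos_bound m (Z.of_nat q) ltac:(lia)).
    assert (EV : V (n, m) = V (Z.of_nat (Z.to_nat (n mod Z.of_nat p)),
                               Z.of_nat (Z.to_nat (m mod Z.of_nat q)))).
    { rewrite !Z2Nat.id by lia.
      rewrite <- (per_add_mul p q V HVp 1 1 (n mod Z.of_nat p) (m mod Z.of_nat q)
        (n / Z.of_nat p) (m / Z.of_nat q)).
      rewrite !Nat.mul_1_l. f_equal. f_equal.
      - rewrite (Z.div_mod n (Z.of_nat p)) at 1 by lia. ring.
      - rewrite (Z.div_mod m (Z.of_nat q)) at 1 by lia. ring. }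
    rewrite EV. apply (He (Z.to_nat (n mod Z.of_nat p)) (Z.to_nat (m mod Z.of_nat q))); lia.
Qed.

(** Around each [e0] the same [rho] limits the size of [V] and the distance of [e] to [e0];
    compactness of [[a, b]] extracts one size for the whole interval. *)
Lemma spectrum_compact p q a b : (0 < p)%nat -> (0 < q)%nat -> stable_sign_change p q ->
  (forall e, a <= e <= b -> exists x1 y1 x2 y2,
     free_det p q x1 y1 e * free_det p q x2 y2 e < 0) ->
  exists rho, 0 < rho /\ forall V, per (Z.of_nat p) (Z.of_nat q) V ->
    (forall s, Rabs (V s) <= rho) -> forall e, a <= e <= b -> ~ resolvent V (RtoC e).
Proof.
  intros Hp Hq HK HS.
  (* [choice] and [compactness_value_1d] take a function on all of R; outside [[a, b]] its value is
     set to 1. *)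
  assert (R : forall e0, exists rho : posreal, a <= e0 <= b ->
    forall V, per (Z.of_nat p) (Z.of_nat q) V -> (forall s, Rabs (V s) <= rho) ->
    forall e, Rabs (e - e0) <= rho -> ~ resolvent V (RtoC e)).
  { intros e0. destruct (classic (a <= e0 <= b)) as [H0 | H0].
    - destruct (HS e0 H0) as [x1 [y1 [x2 [y2 H]]]].
      destruct (HK _ _ _ _ _ H) as [rho [Hr HW]].
      exists (mkposreal rho Hr). intros _ V HVp HV e He. simpl in *.
      destruct (HW (fun i j => V (Z.of_nat i, Z.of_nat j)) e (fun i j => HV _) He)
        as [x [y [v [i [j [Hi [Hj [Hv Heq]]]]]]]].
      apply (spectrum_of_cell_eigen p q V) with x y v i j; try assumption. now exists rho.
    - exists (mkposreal 1 Rlt_0_1). tauto. }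
  apply choice in R. destruct R as [rho Hrho].
  destruct (compactness_value_1d a b rho) as [d Hd].
  exists d. split; [apply cond_pos | ]. intros V HVp HV e He HR.
  apply (Hd e He). intros [t [Ht [Het Hdt]]].
  apply (Hrho t Ht V HVp) with e; [ | lra | exact HR].
  intros s. eapply Rle_trans; [apply HV | exact Hdt].
Qed.

(** The supremum argument for intervals, carried out on the real axis of the plane. *)
Lemma connected_convex (S : Cx -> Prop) : (forall z, S z -> snd z = 0) ->
  (forall a b c : R, S (a, 0) -> S (b, 0) -> a < c < b -> S (c, 0)) -> connected S.
Proof.
  intros Hre Hcv.
  assert (main : forall U1 U2, Copen U1 -> Copen U2 -> (forall z, S z -> U1 z \/ U2 z) ->
    forall a b, a <= b -> S (a, 0) -> S (b, 0) -> U1 (a, 0) -> U2 (b, 0) ->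
    exists z, S z /\ U1 z /\ U2 z).
  { intros U1 U2 O1 O2 Hcov a b Hab Sa Sb Ua Ub.
    set (E := fun t => a <= t <= b /\ U1 (t, 0)).
    destruct (completeness E) as [s [Hub Hlub]].
    - exists b. intros t [[_ Ht] _]. exact Ht.
    - exists a. split; [lra | assumption].
    - assert (Has : a <= s) by (apply Hub; split; [lra | assumption]).
      assert (Hsb : s <= b) by (apply Hlub; intros t [[_ Ht] _]; exact Ht).
      assert (Ss : forall t, a <= t <= b -> S (t, 0)).
      { intros t Ht. destruct (Req_dec t a) as [-> | H1]; [assumption | ].
        destruct (Req_dec t b) as [-> | H2]; [assumption | ]. apply (Hcv a b); auto; lra. }
      assert (near : forall U, Copen U -> U (s, 0) -> exists h, 0 < h /\
        forall t, Rabs (t - s) < h -> U (t, 0)).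
      { intros U OU Us. destruct (OU _ Us) as [eps [He HU]].
        exists (sqrt eps). split; [now apply sqrt_lt_R0 | ]. intros t Ht. apply HU.
        unfold Cdist2; simpl. rewrite <- (sqrt_sqrt eps) by lra.
        apply Rabs_def2 in Ht. assert (0 < sqrt eps) by now apply sqrt_lt_R0. nra. }
      destruct (Hcov (s, 0) (Ss s (conj Has Hsb))) as [U1s | U2s].
      + destruct (Req_dec s b) as [-> | Hne]; [exists (b, 0); auto | ].
        destruct (near U1 O1 U1s) as [h [Hh Hn]].
        set (t := s + Rmin (h / 2) (b - s)).
        assert (0 < Rmin (h / 2) (b - s)) by (apply Rmin_glb_lt; lra).
        assert (Rmin (h / 2) (b - s) <= h / 2) by apply Rmin_l.
        assert (Rmin (h / 2) (b - s) <= b - s) by apply Rmin_r.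
        assert (t <= s); [ | unfold t in *; lra].
        apply Hub. split; [unfold t; lra | ]. apply Hn. apply Rabs_def1; unfold t; lra.
      + destruct (near U2 O2 U2s) as [h [Hh Hn]].
        assert (Ht : exists t, E t /\ s - h < t).
        { apply NNPP. intros Hno. assert (s <= s - h); [ | lra].
          apply Hlub. intros t Et. apply Rnot_lt_le. intros Hlt. apply Hno. now exists t. }
        destruct Ht as [t [[Ht U1t] Hst]]. exists (t, 0). split; [now apply Ss | ].
        split; [assumption | ]. apply Hn.
        assert (t <= s) by (apply Hub; split; assumption). apply Rabs_def1; lra. }
  intros U1 U2 O1 O2 Hcov [[a a'] [Sa Ua]] [[b b'] [Sb Ub]].
  assert (Ea := Hre _ Sa). assert (Eb := Hre _ Sb). simpl in Ea, Eb. subst a' b'.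
  destruct (Rle_lt_dec a b) as [Hab | Hab].
  - now apply (main U1 U2 O1 O2 Hcov a b).
  - destruct (main U2 U1 O2 O1) with b a as [z [Sz [U2z U1z]]]; try assumption; [ | lra | ].
    + intros z Sz. destruct (Hcov z Sz); auto.
    + now exists z.
Qed.

Section Assembly.
Context (p q : nat) (Hp : (0 < p)%nat) (Hq : (0 < q)%nat).

(* Every potential gap lies in one of the windows near -4, 0 and 4, and two resolvent
   points in the same window have no spectrum between them. *)
Lemma resolvent_windows : exists d, 0 < d < 1 /\
  forall V, per (Z.of_nat p) (Z.of_nat q) V -> (forall s, Rabs (V s) <= d) ->
  forall e1 e2, resolvent V (RtoC e1) -> resolvent V (RtoC e2) ->
    (-8 <= e1 /\ e2 <= -4 + d \/ - d <= e1 /\ e2 <= d \/ 4 - d <= e1 /\ e2 <= 8) ->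
    forall e, e1 < e < e2 -> resolvent V (RtoC e).
Proof.
  destruct (generic_twist p q Hp Hq) as [x [y [d [Hd Hev]]]].
  exists d. split; [assumption | ]. intros V HVp HV e1 e2 R1 R2 Hcase e He.
  apply (gap_interval V p q d ((e1 + e2) / 2) ((e2 - e1) / 2) x y); try assumption; try lra.
  - replace ((e1 + e2) / 2 - (e2 - e1) / 2) with e1 by field. assumption.
  - replace ((e1 + e2) / 2 + (e2 - e1) / 2) with e2 by field. assumption.
  (* Since [2 d <= |band| <= 4 - 2 d], the free bands avoid the open interval from [e1 - d] to
     [e2 + d], that is, they are at distance at least [r + d] from its midpoint. *)
  - intros s t Hs Ht. specialize (Hev s t Hs Ht). destruct Hev as [H1 H2].
    apply Rabs_le_between in H2.
    unfold Rabs in *. destruct (Rcase_abs (free_ev p q s t x y));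
      destruct (Rcase_abs (free_ev p q s t x y - (e1 + e2) / 2)); lra.
Qed.

Lemma spectrum_real V e : (forall s, Rabs (V s) <= 1) -> ~ resolvent V (RtoC e) -> -8 < e < 8.
Proof.
  intros HV Hs. destruct (Rlt_dec (Rabs e) 8) as [H | H].
  - now apply Rabs_def2 in H.
  - exfalso. apply Hs, resolvent_far; [assumption | lra].
Qed.

Lemma resolvent_ends V : (forall s, Rabs (V s) <= 1) ->
  resolvent V (RtoC (-8)) /\ resolvent V (RtoC 8).
Proof.
  intros HV. split; apply resolvent_far; try assumption.
  - rewrite Rabs_left; lra.
  - rewrite Rabs_pos_eq; lra.
Qed.

Lemma two_components : stable_sign_change p q -> exists C, 0 < C /\
  forall V, per (Z.of_nat p) (Z.of_nat q) V -> (forall s, Rabs (V s) <= C) ->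
    at_most_two_components (spectrum V).
Proof.
  intros HK. destruct resolvent_windows as [d [Hd HR]].
  destruct (spectrum_compact p q (-4 + d) (- d) Hp Hq HK) as [r1 [Hr1 H1]].
  { intros e He. apply free_det_nonzero; try assumption; lra. }
  destruct (spectrum_compact p q d (4 - d) Hp Hq HK) as [r2 [Hr2 H2]].
  { intros e He. apply free_det_nonzero; try assumption; lra. }
  set (C := Rmin d (Rmin r1 r2)).
  assert (C1 : C <= d) by apply Rmin_l.
  assert (C2 : C <= r1) by (eapply Rle_trans; [apply Rmin_r | apply Rmin_l]).
  assert (C3 : C <= r2) by (eapply Rle_trans; [apply Rmin_r | apply Rmin_r]).
  exists C. split; [unfold C; repeat apply Rmin_glb_lt; lra | ].
  intros V HVp HV.
  assert (HVd : forall s, Rabs (V s) <= d) by (intros s; specialize (HV s); lra).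
  assert (HV1 : forall s, Rabs (V s) <= 1) by (intros s; specialize (HV s); lra).
  assert (HVr1 : forall s, Rabs (V s) <= r1) by (intros s; specialize (HV s); lra).
  assert (HVr2 : forall s, Rabs (V s) <= r2) by (intros s; specialize (HV s); lra).
  specialize (HR V HVp HVd). specialize (H1 V HVp HVr1). specialize (H2 V HVp HVr2).
  destruct (resolvent_ends V HV1) as [Rm Rp].
  assert (Sre : forall z, spectrum V z -> snd z = 0).
  { intros [a b] Hz. apply NNPP. intros Hb. apply Hz.
    apply resolvent_nonreal; [now exists 1 | exact Hb]. }
  (* Next to -4 or 4, [c] would share a window with the resolvent point -8 or 8, leaving no room for
     the spectral point [a] or [b] between them; between the windows all energies are spectral. *)
  assert (inner : forall a b c, spectrum V (a, 0) -> spectrum V (b, 0) -> a < c < b ->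
    resolvent V (RtoC c) -> - d < c < d).
  { intros a b c Sa Sb Hc Rc.
    assert (Ba := spectrum_real V a HV1 Sa). assert (Bb := spectrum_real V b HV1 Sb).
    destruct (Rle_dec c (-4 + d)); [exfalso; apply Sa, (HR (-8) c); auto; lra | ].
    destruct (Rle_dec (4 - d) c); [exfalso; apply Sb, (HR c 8); auto; lra | ].
    destruct (Rle_dec c (- d)); [exfalso; apply (H1 c); auto; lra | ].
    destruct (Rle_dec d c); [exfalso; apply (H2 c); auto; lra | lra]. }
  (* One resolvent point [g] of the central window suffices for the cut: any other lies in the same
     window, so no spectrum separates it from [g]. If there is none, the whole spectrum is convex
     and is taken twice. *)
  destruct (classic (exists g, - d < g < d /\ resolvent V (RtoC g))) as [[g [Hg Rg]] | Hno].
  - exists (fun z => spectrum V z /\ fst z < g), (fun z => spectrum V z /\ g < fst z).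
    split; [ | split].
    + apply connected_convex; [intros z [Hz _]; now apply Sre | ].
      intros a b c [Sa Ha] [Sb Hb] Hc. simpl in *. split; [ | lra]. intros Rc.
      assert (Hc' := inner a b c Sa Sb Hc Rc). apply Sb, (HR c g); auto; lra.
    + apply connected_convex; [intros z [Hz _]; now apply Sre | ].
      intros a b c [Sa Ha] [Sb Hb] Hc. simpl in *. split; [ | lra]. intros Rc.
      assert (Hc' := inner a b c Sa Sb Hc Rc). apply Sa, (HR g c); auto; lra.
    + intros [a b]. simpl. split; [ | tauto]. intros Hz.
      assert (Hb := Sre _ Hz). simpl in Hb. subst b.
      destruct (Rtotal_order a g) as [H | [-> | H]]; auto. contradiction.
  - assert (Cn : connected (spectrum V)).
    { apply connected_convex; [assumption | ]. intros a b c Sa Sb Hc Rc.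
      apply Hno. exists c. split; [now apply (inner a b) | assumption]. }
    exists (spectrum V), (spectrum V). split; [assumption | split; [assumption | tauto]].
Qed.

Lemma single_interval : stable_sign_change p q -> Nat.odd p = true \/ Nat.odd q = true ->
  exists C, 0 < C /\
  forall V, per (Z.of_nat p) (Z.of_nat q) V -> (forall s, Rabs (V s) <= C) ->
    exists a b : R, a <= b /\
      forall z : Cx, spectrum V z <-> (snd z = 0 /\ a <= fst z <= b).
Proof.
  intros HK Hodd. destruct resolvent_windows as [d [Hd HR]].
  destruct (spectrum_compact p q (-4 + d) (4 - d) Hp Hq HK) as [r1 [Hr1 H1]].
  { intros e He. destruct (Req_dec e 0) as [-> | He0].
    - destruct Hodd as [Ho | Ho].
      + destruct (free_det_zero p q Hp Hq Ho) as [x [y1 [y2 H]]]. now exists x, y1, x, y2.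
      + destruct (free_det_zero q p Hq Hp Ho) as [x [y1 [y2 H]]]. exists y1, x, y2, x.
        now rewrite !(free_det_swap p q).
    - apply free_det_nonzero; try assumption; lra. }
  set (C := Rmin d r1).
  assert (C1 : C <= d) by apply Rmin_l. assert (C2 : C <= r1) by apply Rmin_r.
  exists C. split; [unfold C; apply Rmin_glb_lt; lra | ].
  intros V HVp HV.
  assert (HVd : forall s, Rabs (V s) <= d) by (intros s; specialize (HV s); lra).
  assert (HV1 : forall s, Rabs (V s) <= 1) by (intros s; specialize (HV s); lra).
  assert (HVr1 : forall s, Rabs (V s) <= r1) by (intros s; specialize (HV s); lra).
  specialize (HR V HVp HVd). specialize (H1 V HVp HVr1).
  destruct (resolvent_ends V HV1) as [Rm Rp].
  set (Sp := fun e => ~ resolvent V (RtoC e)).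
  assert (convex : forall a b c, Sp a -> Sp b -> a < c < b -> Sp c).
  { intros a b c Sa Sb Hc Rc.
    assert (Ba := spectrum_real V a HV1 Sa). assert (Bb := spectrum_real V b HV1 Sb).
    destruct (Rle_dec c (-4 + d)); [apply Sa, (HR (-8) c); auto; lra | ].
    destruct (Rle_dec (4 - d) c); [apply Sb, (HR c 8); auto; lra | ].
    apply (H1 c); auto; lra. }
  (* 0 lies in the range of energies covered by [H1], so the spectrum is not empty and the suprema
     below exist. *)
  assert (S0 : Sp 0) by (apply H1; lra).
  assert (HVe : exists B, forall s, Rabs (V s) <= B) by now exists 1.
  assert (closed : forall s, (forall h, 0 < h -> exists t, Sp t /\ Rabs (t - s) <= h) -> Sp s).
  { intros s Hs Rs. destruct (resolvent_near V HVe s Rs) as [h [Hh Hn]].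
    destruct (Hs h Hh) as [t [St Ht]]. apply St. now apply Hn. }
  destruct (completeness Sp) as [b [Hb1 Hb2]].
  { exists 8. intros t St. generalize (spectrum_real V t HV1 St); lra. }
  { now exists 0. }
  (* The lower end is minus the supremum of the reflected spectrum. *)
  destruct (completeness (fun t => Sp (- t))) as [a [Ha1 Ha2]].
  { exists 8. intros t St. generalize (spectrum_real V (- t) HV1 St); lra. }
  { exists 0. now rewrite Ropp_0. }
  assert (Sb : Sp b).
  { apply closed. intros h Hh. apply NNPP. intros Hno.
    assert (b <= b - h); [ | lra]. apply Hb2. intros t St. apply Rnot_lt_le. intros Hlt.
    apply Hno. exists t. split; [assumption | ]. assert (t <= b) by now apply Hb1.
    apply Rabs_le; lra. }
  assert (Sa : Sp (- a)).
  { apply closed. intros h Hh. apply NNPP. intros Hno.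
    assert (a <= a - h); [ | lra]. apply Ha2. intros t St. apply Rnot_lt_le. intros Hlt.
    apply Hno. exists (- t). split; [assumption | ]. assert (t <= a) by now apply Ha1.
    apply Rabs_le; lra. }
  assert (Hlow : forall t, Sp t -> - a <= t).
  { intros t St. assert (- t <= a); [ | lra]. apply Ha1. now rewrite Ropp_involutive. }
  exists (- a), b. split; [now apply Hlow | ].
  intros [t u]. simpl. split.
  - intros Hz.
    assert (Hu : u = 0).
    { apply NNPP. intros Hu. apply Hz. now apply resolvent_nonreal. }
    subst u. split; [reflexivity | ]. split; [now apply Hlow | now apply Hb1].
  - intros [-> [Ht1 Ht2]].
    destruct (Req_dec t (- a)) as [-> | Hta]; [exact Sa | ].
    destruct (Req_dec t b) as [-> | Htb]; [exact Sb | ].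
    apply (convex (- a) b t Sa Sb). lra.
Qed.
End Assembly.

Lemma Z_odd_to_nat p : (0 < p)%Z -> Z.odd p = true -> Nat.odd (Z.to_nat p) = true.
Proof.
  intros Hp Ho. apply Nat.odd_spec. apply Z.odd_spec in Ho. destruct Ho as [k Hk].
  exists (Z.to_nat k). lia.
Qed.

Lemma discrete_bethe_sommerfeld (p q : Z) : (0 < p)%Z -> (0 < q)%Z ->
  stable_sign_change (Z.to_nat p) (Z.to_nat q) ->
  exists C : R, 0 < C /\
    (forall V : (Z * Z)%type -> R, periodic p q V -> (forall x, Rabs (V x) <= C) ->
       at_most_two_components (spectrum V)) /\
    ((Z.odd p = true \/ Z.odd q = true) ->
     forall V : (Z * Z)%type -> R, periodic p q V -> (forall x, Rabs (V x) <= C) ->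
       exists a b : R, a <= b /\
         forall z : Cx, spectrum V z <-> (snd z = 0 /\ a <= fst z <= b)).
Proof.
  intros hp hq HK.
  assert (Hp : (0 < Z.to_nat p)%nat) by lia. assert (Hq : (0 < Z.to_nat q)%nat) by lia.
  assert (HVp : forall V : (Z * Z)%type -> R, periodic p q V ->
    per (Z.of_nat (Z.to_nat p)) (Z.of_nat (Z.to_nat q)) V).
  { intros V HV. rewrite !Z2Nat.id by lia. exact HV. }
  destruct (two_components _ _ Hp Hq HK) as [C1 [HC1 H1]].
  destruct (classic (Z.odd p = true \/ Z.odd q = true)) as [Ho | Ho].
  - assert (Ho' : Nat.odd (Z.to_nat p) = true \/ Nat.odd (Z.to_nat q) = true) by
      (destruct Ho; [left | right]; apply Z_odd_to_nat; assumption).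
    destruct (single_interval _ _ Hp Hq HK Ho') as [C2 [HC2 H2]].
    exists (Rmin C1 C2). split; [now apply Rmin_glb_lt | split].
    + intros V HV HB. apply H1; [now apply HVp | ].
      intros s. eapply Rle_trans; [apply HB | apply Rmin_l].
    + intros _ V HV HB. apply H2; [now apply HVp | ].
      intros s. eapply Rle_trans; [apply HB | apply Rmin_r].
  - exists C1. split; [assumption | split; [ | tauto]].
    intros V HV HB. apply H1; [now apply HVp | assumption].
Qed.

(** * The determinant of the Bloch operators *)

Definition rlim {T} (F : (T -> Prop) -> Prop) (f : T -> R) (a : R) : Prop :=
  filterlim f F (locally a).

Lemma rlim_plus {T} F {FF : Filter F} (f g : T -> R) a b :
  rlim F f a -> rlim F g b -> rlim F (fun t => f t + g t) (a + b).
Proof.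
  intros Hf Hg. apply (filterlim_comp_2 _ _ Rplus Hf Hg).
  apply (filterlim_plus (V := R_NormedModule)).
Qed.

Lemma rlim_mult {T} F {FF : Filter F} (f g : T -> R) a b :
  rlim F f a -> rlim F g b -> rlim F (fun t => f t * g t) (a * b).
Proof.
  intros Hf Hg. apply (filterlim_comp_2 _ _ Rmult Hf Hg).
  apply (filterlim_mult (K := R_AbsRing)).
Qed.

Lemma rlim_opp {T} F {FF : Filter F} (f : T -> R) a :
  rlim F f a -> rlim F (fun t => - f t) (- a).
Proof.
  intros Hf. apply (filterlim_comp _ _ _ _ Ropp _ _ _ Hf).
  apply (filterlim_opp (V := R_NormedModule)).
Qed.

Lemma rlim_const {T} F {FF : Filter F} (a : R) : rlim F (fun _ : T => a) a.
Proof. apply filterlim_const. Qed.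

Lemma rlim_cos {T} F (f : T -> R) a : rlim F f a -> rlim F (fun t => cos (f t)) (cos a).
Proof. intros Hf. apply (filterlim_comp _ _ _ _ cos _ _ _ Hf). apply continuous_cos. Qed.

Lemma rlim_sin {T} F (f : T -> R) a : rlim F f a -> rlim F (fun t => sin (f t)) (sin a).
Proof. intros Hf. apply (filterlim_comp _ _ _ _ sin _ _ _ Hf). apply continuous_sin. Qed.

(** Neighbourhoods of [(0, e0)], uniform in the entries of [W]: a property that holds along this
    filter comes with the [rho] demanded by [stable_sign_change]. *)
Definition pot_filter (e0 : R) : ((nat -> nat -> R) * R -> Prop) -> Prop := fun P =>
  exists rho, 0 < rho /\ forall W e, (forall i j, Rabs (W i j) <= rho) ->
    Rabs (e - e0) <= rho -> P (W, e).

Global Instance pot_filter_filter e0 : Filter (pot_filter e0).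
Proof.
  split.
  - exists 1. split; [lra | auto].
  - intros P Q [r1 [H1 P1]] [r2 [H2 Q2]]. exists (Rmin r1 r2).
    split; [now apply Rmin_glb_lt | ]. intros W e HW He.
    assert (Rmin r1 r2 <= r1) by apply Rmin_l. assert (Rmin r1 r2 <= r2) by apply Rmin_r.
    split; [apply P1 | apply Q2]; try lra; intros i j; specialize (HW i j); lra.
  - intros P Q HPQ [r [H1 P1]]. exists r. split; auto.
Qed.

Lemma rlim_pot e0 i j : rlim (pot_filter e0) (fun w => fst w i j) 0.
Proof.
  intros P [eps HP]. exists (eps / 2). assert (H := cond_pos eps). split; [lra | ].
  intros W e HW _. apply HP. change (Rabs (W i j - 0) < eps). rewrite Rminus_0_r.
  specialize (HW i j). lra.
Qed.

Lemma rlim_energy e0 : rlim (pot_filter e0) snd e0.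
Proof.
  intros P [eps HP]. exists (eps / 2). assert (H := cond_pos eps). split; [lra | ].
  intros W e _ He. apply HP. change (Rabs (e - e0) < eps). lra.
Qed.

Lemma path_zero (g : R -> R) : (forall t, rlim (locally t) g (g t)) ->
  g 0 * g 1 < 0 -> exists t, g t = 0.
Proof.
  intros Hg Hs. destruct (IVT_cor g 0 1) as [t [_ Ht]]; [ | lra | lra | now exists t].
  intros t. apply continuity_pt_filterlim. apply Hg.
Qed.

(* [G x y W e] stands for det (H_W(x, y) - e). *)
Lemma stable_sign_change_of_det p q (G : R -> R -> (nat -> nat -> R) -> R -> R) :
  (forall W e x1 y1 x2 y2 t, rlim (locally t)
     (fun t => G (x1 + t * (x2 - x1)) (y1 + t * (y2 - y1)) W e)
     (G (x1 + t * (x2 - x1)) (y1 + t * (y2 - y1)) W e)) ->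
  (forall x y e0, rlim (pot_filter e0) (fun w => G x y (fst w) (snd w)) (G x y (fun _ _ => 0) e0)) ->
  (forall x y e, G x y (fun _ _ => 0) e = free_det p q x y e) ->
  (forall x y W e, G x y W e = 0 -> exists v i j, (i < p)%nat /\ (j < q)%nat /\
     v i j <> RtoC 0 /\ cell_eigen p q W x y e v) ->
  stable_sign_change p q.
Proof.
  intros Hpath Hpot Hfree Hker e0 x1 y1 x2 y2 Hs. rewrite <- !Hfree in Hs.
  assert (L := rlim_mult _ _ _ _ _ (Hpot x1 y1 e0) (Hpot x2 y2 e0)).
  destruct (L (fun z => z < 0)) as [rho [Hr H]].
  { exists (mkposreal _ (Ropp_0_gt_lt_contravar _ Hs)). intros z Hz.
    change (Rabs (z - G x1 y1 (fun _ _ => 0) e0 * G x2 y2 (fun _ _ => 0) e0) <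
      - (G x1 y1 (fun _ _ => 0) e0 * G x2 y2 (fun _ _ => 0) e0)) in Hz.
    apply Rabs_def2 in Hz. lra. }
  exists rho. split; [assumption | ]. intros W e HW He.
  specialize (H W e HW He). cbn [fst snd] in H.
  destruct (path_zero (fun t => G (x1 + t * (x2 - x1)) (y1 + t * (y2 - y1)) W e)) as [t Ht].
  - intros t. apply Hpath.
  - rewrite !Rmult_0_l, !Rmult_1_l, !Rplus_0_r.
    replace (x1 + (x2 - x1)) with x2 by ring. replace (y1 + (y2 - y1)) with y2 by ring.
    exact H.
  - destruct (Hker _ _ _ _ Ht) as [v [i [j Hv]]]. now eexists _, _, v, i, j.
Qed.

(** * Bloch matrices over the MathComp complex numbers *)

Module CellDeterminant.
Import ssreflect ssrfun ssrbool eqtype ssrnat seq fintype finfun bigop ssralg ssrnum matrix perm.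
Import GRing.Theory Num.Theory complex Rstruct.
Local Open Scope ring_scope.
Delimit Scope R_scope with coqR.
Delimit Scope C_scope with coqC.
Notation CR := (complex R).

Definition ex (t : R) : CR := Complex (cos t) (sin t).

Lemma exD s t : ex (Rplus s t) = ex s * ex t.
Proof.
rewrite /ex cos_plus sin_plus; apply/eqP; rewrite eq_complex /=.
by apply/andP; split; apply/eqP; [|rewrite addrC].
Qed.

Lemma ex0 : ex 0%coqR = 1.
Proof. by rewrite /ex cos_0 sin_0. Qed.

Lemma ex_opp_mul t : ex t * ex (Ropp t) = 1.
Proof. by rewrite -exD Rplus_opp_r ex0. Qed.

Lemma conj_ex t : conjc (ex t) = ex (Ropp t).
Proof. by rewrite /ex cos_neg sin_neg. Qed.

Lemma ex_2PI (n : nat) : ex (2 * PI * INR n)%coqR = 1.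
Proof.
rewrite /ex -(Rplus_0_l (2 * PI * INR n)%coqR) INR_IZR_INZ.
by rewrite cos_add_2PI_Z sin_add_2PI_Z cos_0 sin_0.
Qed.

Definition clim {T} (F : (T -> Prop) -> Prop) (f : T -> CR) (l : CR) :=
  rlim F (fun t => Re (f t)) (Re l) /\ rlim F (fun t => Im (f t)) (Im l).

Section Clim.
Context {T : Type} (F : (T -> Prop) -> Prop) {FF : Filter F}.

Lemma clim_const l : clim F (fun _ => l) l.
Proof. by split; apply: rlim_const. Qed.

Lemma clim_add f g a b : clim F f a -> clim F g b -> clim F (fun t => f t + g t) (a + b).
Proof.
move=> [f1 f2] [g1 g2]; split.
- have -> : Re (a + b) = Rplus (Re a) (Re b) by case: a b {f1 f2 g1 g2} => [? ?] [].
  apply: filterlim_ext (rlim_plus _ _ _ _ _ f1 g1) => t.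
  by case: (f t) (g t) => [? ?] [].
- have -> : Im (a + b) = Rplus (Im a) (Im b) by case: a b {f1 f2 g1 g2} => [? ?] [].
  apply: filterlim_ext (rlim_plus _ _ _ _ _ f2 g2) => t.
  by case: (f t) (g t) => [? ?] [].
Qed.

Lemma clim_mul f g a b : clim F f a -> clim F g b -> clim F (fun t => f t * g t) (a * b).
Proof.
move=> [f1 f2] [g1 g2]; split.
- have -> : Re (a * b) = Rplus (Rmult (Re a) (Re b)) (Ropp (Rmult (Im a) (Im b))).
    by case: a b {f1 f2 g1 g2} => [? ?] [].
  apply: filterlim_ext (rlim_plus _ _ _ _ _ (rlim_mult _ _ _ _ _ f1 g1)
    (rlim_opp _ _ _ (rlim_mult _ _ _ _ _ f2 g2))) => t.
  by case: (f t) (g t) => [? ?] [].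
- have -> : Im (a * b) = Rplus (Rmult (Re a) (Im b)) (Rmult (Im a) (Re b)).
    by case: a b {f1 f2 g1 g2} => [? ?] [].
  apply: filterlim_ext (rlim_plus _ _ _ _ _ (rlim_mult _ _ _ _ _ f1 g2)
    (rlim_mult _ _ _ _ _ f2 g1)) => t.
  by case: (f t) (g t) => [? ?] [].
Qed.

Lemma clim_sum I (r : seq I) (f : I -> T -> CR) a : (forall i, clim F (f i) (a i)) ->
  clim F (fun t => \sum_(i <- r) f i t) (\sum_(i <- r) a i).
Proof.
move=> fa; elim: r => [|i r IH].
  by rewrite big_nil (_ : (fun _ => _) = fun _ => 0);
    [apply: clim_const | apply: functional_extensionality => t; rewrite big_nil].
rewrite big_cons (_ : (fun _ => _) = fun t => f i t + \sum_(i <- r) f i t).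
  exact: clim_add.
by apply: functional_extensionality => t; rewrite big_cons.
Qed.

Lemma clim_prod I (r : seq I) (f : I -> T -> CR) a : (forall i, clim F (f i) (a i)) ->
  clim F (fun t => \prod_(i <- r) f i t) (\prod_(i <- r) a i).
Proof.
move=> fa; elim: r => [|i r IH].
  by rewrite big_nil (_ : (fun _ => _) = fun _ => 1);
    [apply: clim_const | apply: functional_extensionality => t; rewrite big_nil].
rewrite big_cons (_ : (fun _ => _) = fun t => f i t * \prod_(i <- r) f i t).
  exact: clim_mul.
by apply: functional_extensionality => t; rewrite big_cons.
Qed.

(** The Leibniz formula makes the determinant a polynomial in the entries. *)
Lemma clim_det n (A : T -> 'M[CR]_n) (B : 'M[CR]_n) :
  (forall i j, clim F (fun t => A t i j) (B i j)) -> clim F (fun t => \det (A t)) (\det B).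
Proof.
move=> AB; apply: clim_sum => s; apply: clim_mul; first exact: clim_const.
by apply: clim_prod => i.
Qed.

Lemma clim_mulrb f a (b : bool) : clim F f a -> clim F (fun t => f t *+ b) (a *+ b).
Proof. by case: b => // _; apply: clim_const. Qed.

Lemma clim_ex f a : rlim F f a -> clim F (fun t => ex (f t)) (ex a).
Proof. by move=> fa; split; [apply: rlim_cos | apply: rlim_sin]. Qed.

Lemma clim_real f a : rlim F f a -> clim F (fun t => Complex (f t) 0%coqR) (Complex a 0%coqR).
Proof. by move=> fa; split=> //; apply: rlim_const. Qed.
End Clim.

Lemma nprod_big n (f : nat -> R) : nprod n f = \prod_(i < n) f i.
Proof. by elim: n => [|n IH]; rewrite ?big_ord0 // big_ord_recr /= IH. Qed.

Lemma nsum_big n (f : nat -> R) : nsum n f = \sum_(i < n) f i.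
Proof. by elim: n => [|n IH]; rewrite ?big_ord0 // big_ord_recr /= IH. Qed.

Section Character.
Variable p : nat.
Implicit Types l k : 'I_p.+1.

Let HpR : INR p.+1 <> 0%coqR.
Proof. by apply: not_0_INR. Qed.

(** The characters of the cyclic group of order [p.+1]. *)
Definition chi l k : CR := ex (2 * PI * INR l * INR k / INR p.+1)%coqR.

Lemma chiS l k : chi l (ordS k) = chi l k * ex (2 * PI * INR l / INR p.+1)%coqR.
Proof.
rewrite /chi -exD /=.
have -> : (2 * PI * INR l * INR k / INR p.+1 + 2 * PI * INR l / INR p.+1 =
           2 * PI * INR l * INR k.+1 / INR p.+1)%coqR.
  by rewrite (S_INR k); field.
have := ltn_ord k; rewrite leq_eqVlt => /orP[/eqP kp|kp]; last by rewrite div.modn_small.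
rewrite kp div.modnn.
have -> : (2 * PI * INR l * INR p.+1 / INR p.+1 = 2 * PI * INR l)%coqR by field.
by rewrite ex_2PI /= Rmult_0_r /Rdiv Rmult_0_l ex0.
Qed.

Lemma chi_pred l k : chi l (ord_pred k) = chi l k * ex (- (2 * PI * INR l / INR p.+1))%coqR.
Proof. by rewrite -{2}(ord_predK k) chiS -mulrA ex_opp_mul mulr1. Qed.

Lemma chi_orth l l' : \sum_k chi l k * conjc (chi l' k) = (p.+1)%:R *+ (l == l').
Proof.
case: eqP => [<-|ll'].
  rewrite (eq_bigr (fun _ => 1)); last by move=> k _; rewrite /chi conj_ex ex_opp_mul.
  by rewrite sumr_const card_ord.
pose d := (Z.of_nat l - Z.of_nat l')%Z.
have dn0 : (0 < Z.abs d < Z.of_nat p.+1)%Z.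
  have Hl := ltn_ord l; have Hl' := ltn_ord l'.
  move/ltP: Hl => Hl; move/ltP: Hl' => Hl'.
  have : nat_of_ord l <> nat_of_ord l' by move=> /val_inj.
  by rewrite /d; lia.
have [E1 E2] := trig_sums p.+1 d (Nat.lt_0_succ p) dn0.
have ph k : chi l k * conjc (chi l' k) = ex (2 * PI * INR k * IZR d / INR p.+1)%coqR.
  rewrite /chi conj_ex -exD /d minus_IZR -!INR_IZR_INZ; congr ex; field.
  exact: HpR.
rewrite (eq_bigr _ (fun k _ => ph k)) mulr0n.
have Rsum (r : seq 'I_p.+1) (f : 'I_p.+1 -> R) : \sum_(k <- r) ex (f k) =
    Complex (\sum_(k <- r) (cos (f k) : R)) (\sum_(k <- r) (sin (f k) : R)).
  by elim: r => [|k r IH]; rewrite ?big_nil // !big_cons IH.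
rewrite Rsum.
move: E1 E2; rewrite !nsum_big => E1 E2.
by rewrite E1 E2.
Qed.
End Character.

Definition toC (z : CR) : Complex.C := (Re z, Im z).

Lemma toC_sum (z1 z2 z3 z4 z5 : CR) x y w e :
  z1 * ex (Ropp x) + z2 * ex x + z3 * ex (Ropp y) + z4 * ex y
    + z5 * Complex (w - e)%coqR 0%coqR = 0 ->
  (cis (- x) * toC z1 + cis x * toC z2 + cis (- y) * toC z3 + cis y * toC z4
    + RtoC w * toC z5 - RtoC e * toC z5)%coqC = RtoC 0%coqR.
Proof.
case: z1 z2 z3 z4 z5 => [a1 b1] [a2 b2] [a3 b3] [a4 b4] [a5 b5].
rewrite /ex => -[H1 H2].
have {}H1 : (a1 * cos (- x) - b1 * sin (- x) + (a2 * cos x - b2 * sin x)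
  + (a3 * cos (- y) - b3 * sin (- y)) + (a4 * cos y - b4 * sin y)
  + (a5 * (w - e) - b5 * 0) = 0)%coqR by exact: H1.
have {}H2 : (a1 * sin (- x) + b1 * cos (- x) + (a2 * sin x + b2 * cos x)
  + (a3 * sin (- y) + b3 * cos (- y)) + (a4 * sin y + b4 * cos y)
  + (a5 * 0 + b5 * (w - e)) = 0)%coqR by exact: H2.
by apply: C_eq; rewrite /toC /cis; cbn; lra.
Qed.

Lemma mulrb_and (a c : CR) (b1 b2 : bool) : (a * c) *+ (b1 && b2) = (a *+ b1) * (c *+ b2).
Proof. by case: b1 b2 => [] []; rewrite ?mulr1n ?mulr0n ?mulr0 ?mul0r. Qed.

Lemma factor_eigen (c1 c2 a1 a2 a3 a4 b1 b2 b3 b4 w : CR) :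
  c1 * a1 * c2 * b1 + c1 * a2 * c2 * b2 + c1 * (c2 * a3) * b3 + c1 * (c2 * a4) * b4
    + c1 * c2 * w = (a1 * b1 + a2 * b2 + a3 * b3 + a4 * b4 + w) * (c1 * c2).
Proof.
rewrite !mulrDl; congr (_ + _ + _ + _ + _); rewrite [RHS]mulrC //.
- by rewrite mulrACA !mulrA.
- by rewrite mulrACA !mulrA.
- by rewrite !mulrA.
- by rewrite !mulrA.
Qed.

Section Cell.
Variables p q : nat.
Let T : finType := ('I_p.+1 * 'I_q.+1)%type.

(** Indicators are added rather than decided by cases, so that neighbours which coincide, as they do
    for sides 1 and 2, contribute the sum of their phases. The second index is the site at which the
    equation is written: the matrix acts on row vectors, as in [det0P]. *)
Definition entry (x y : R) (W : nat -> nat -> R) (e : R) (s' s : T) : CR :=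
  ex (Ropp x) *+ ((ord_pred s.1, s.2) == s') + ex x *+ ((ordS s.1, s.2) == s')
  + ex (Ropp y) *+ ((s.1, ord_pred s.2) == s') + ex y *+ ((s.1, ordS s.2) == s')
  + Complex (W s.1 s.2 - e)%coqR 0%coqR *+ (s == s').

Definition Hmat x y W e : 'M[CR]_#|T| :=
  \matrix_(a, b) entry x y W e (enum_val a) (enum_val b).

Lemma sum_pick (v : T -> CR) c g : \sum_s v s * (c *+ (g == s)) = v g * c.
Proof.
rewrite (bigD1 g) //= eqxx mulr1n big1 ?addr0 // => s.
by rewrite eq_sym => /negbTE ->; rewrite mulr0n mulr0.
Qed.

Lemma sum_entry x y W e (v : T -> CR) s :
  \sum_s' v s' * entry x y W e s' s =
  v (ord_pred s.1, s.2) * ex (Ropp x) + v (ordS s.1, s.2) * ex x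
  + v (s.1, ord_pred s.2) * ex (Ropp y) + v (s.1, ordS s.2) * ex y
  + v s * Complex (W s.1 s.2 - e)%coqR 0%coqR.
Proof.
rewrite (eq_bigr (fun s' => v s' * (ex (Ropp x) *+ ((ord_pred s.1, s.2) == s'))
  + v s' * (ex x *+ ((ordS s.1, s.2) == s'))
  + v s' * (ex (Ropp y) *+ ((s.1, ord_pred s.2) == s'))
  + v s' * (ex y *+ ((s.1, ordS s.2) == s'))
  + v s' * (Complex (W s.1 s.2 - e)%coqR 0%coqR *+ (s == s')))).
  by rewrite !big_split /= !sum_pick.
by move=> s' _; rewrite /entry !mulrDr.
Qed.

(** Matrices are indexed by ['I_#|T|]; the enumeration of [T] moves sums back to the cell. *)
Lemma sum_enum (G : T -> CR) : \sum_(a < #|T|) G (enum_val a) = \sum_s G s.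
Proof.
rewrite [RHS](reindex_onto (fun a : 'I_#|T| => enum_val a) enum_rank) /=.
  by apply: eq_bigl => a; rewrite enum_valK eqxx.
by move=> s _; rewrite enum_rankK.
Qed.

Lemma prod_enum (G : T -> CR) : \prod_(a < #|T|) G (enum_val a) = \prod_s G s.
Proof.
rewrite [RHS](reindex_onto (fun a : 'I_#|T| => enum_val a) enum_rank) /=.
  by apply: eq_bigl => a; rewrite enum_valK eqxx.
by move=> s _; rewrite enum_rankK.
Qed.

(** [ord_pred] and [ordS] are inverse to each other, so conjugation exchanges the two hopping terms
    of each direction. *)
Lemma entry_conj x y W e s s' : conjc (entry x y W e s' s) = entry x y W e s s'.
Proof.
have conj_mulrb (z : CR) (b : bool) : conjc (z *+ b) = conjc z *+ b by rewrite rmorphMn.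
rewrite /entry !rmorphD /= !conj_mulrb !conj_ex !Ropp_involutive.
have P (n : nat) (i j : 'I_n) : (ord_pred i == j) = (ordS j == i).
  by apply/eqP/eqP => [<-|<-]; rewrite ?ord_predK ?ordSK.
have comm4 (a b c d w : CR) : a + b + c + d + w = b + a + d + c + w.
  by rewrite (addrC a b) -!addrA (addrCA c d).
have -> : conjc (Complex (W s.1 s.2 - e)%coqR 0%coqR) = Complex (W s.1 s.2 - e)%coqR 0%coqR.
  by rewrite /= oppr0.
case: s s' => [i j] [i' j'] /=.
have -> : ((ord_pred i', j') == (i, j)) = ((ordS i, j) == (i', j')).
  by rewrite !xpair_eqE P (eq_sym j).
have -> : ((ordS i', j') == (i, j)) = ((ord_pred i, j) == (i', j')).
  by rewrite !xpair_eqE P (eq_sym j).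
have -> : ((i', ord_pred j') == (i, j)) = ((i, ordS j) == (i', j')).
  by rewrite !xpair_eqE P (eq_sym i).
have -> : ((i', ordS j') == (i, j)) = ((i, ord_pred j) == (i', j')).
  by rewrite !xpair_eqE P (eq_sym i).
rewrite [(i', j') == _]eq_sym comm4; congr (_ + _).
by case: eqP => // -[-> ->].
Qed.

Lemma Hmat_adj x y W e : map_mx conjc (Hmat x y W e) = (Hmat x y W e)^T.
Proof. by apply/matrixP => a b; rewrite !mxE entry_conj. Qed.

(** The matrix is Hermitian. Hence the real part of its determinant, to which the intermediate value
    theorem applies, vanishes only together with the determinant. *)
Lemma det_Hmat_real x y W e : Im (\det (Hmat x y W e)) = 0%coqR.
Proof.
have : conjc (\det (Hmat x y W e)) = \det (Hmat x y W e).
  by rewrite -det_map_mx Hmat_adj det_tr.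
case: (\det _) => a b /= [H]; have {}H : Ropp b = b by [].
lra.
Qed.

Lemma det_Hmat_kernel x y W e : \det (Hmat x y W e) = 0 ->
  exists v i j, (i < p.+1)%coq_nat /\ (j < q.+1)%coq_nat /\ v i j <> RtoC 0%coqR /\
    cell_eigen p.+1 q.+1 W x y e v.
Proof.
move/eqP/det0P => [u u0 uH].
pose f (s : T) : CR := u ord0 (enum_rank s).
pose v (i j : nat) : Complex.C := toC (f (inord i, inord j)).
have [a ua] : exists a, u ord0 a != 0.
  apply/existsP; rewrite -negb_forall; apply: contra u0 => /forallP u0.
  by apply/eqP/rowP => a; rewrite mxE; apply/eqP.
exists v, (nat_of_ord (enum_val a).1), (nat_of_ord (enum_val a).2).
split; first exact/ltP. split; first exact/ltP. split.
  move=> [E1 E2]; case/eqP: ua; move: E1 E2; rewrite !inord_val /f -surjective_pairing enum_valK.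
  by case: (u ord0 a) => x1 x2 /= -> ->.
move=> i j /ltP Hi /ltP Hj.
(* [cell_up] and [cell_dn] wrap around as [ordS] and [ord_pred] do, the latter being defined by
   remainders modulo [n.+1]. *)
have up n k : (k < n.+1)%N -> inord (cell_up n.+1 k) = ordS (inord k : 'I_n.+1).
  move=> Hk; apply: val_inj; rewrite /cell_up.
  case: Nat.eqb_spec => [E|E].
    have E' : k.+1 = n.+1 by rewrite -E; lia.
    by rewrite /= !inordK // E' div.modnn.
  have {}Hk' : (k.+1 < n.+1)%N by rewrite ltn_neqAle Hk andbT; apply/eqP => ?; lia.
  have -> : (k + 1)%coq_nat = k.+1 by lia.
  by rewrite /= !inordK // div.modn_small.
have dn n k : (k < n.+1)%N -> inord (cell_dn n.+1 k) = ord_pred (inord k : 'I_n.+1).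
  move=> Hk; apply: val_inj; rewrite /cell_dn.
  case: Nat.eqb_spec => [E|E].
    have -> : (n.+1 - 1)%coq_nat = n by lia.
    by rewrite E /= !inordK // add0n div.modn_small.
  case: k Hk E => [|k] Hk E //.
  have -> : (k.+1 - 1)%coq_nat = k by lia.
  have Hk' := ltnW Hk.
  by rewrite /= !inordK // addSn /= div.modnDr div.modn_small.
have := congr1 (fun M : 'rV_#|T| => M ord0 (enum_rank ((inord i, inord j) : T))) uH.
rewrite !mxE.
rewrite (eq_bigr (fun a => f (enum_val a) * entry x y W e (enum_val a) (inord i, inord j)));
  last by move=> b _; rewrite !mxE enum_rankK /f enum_valK.
rewrite (sum_enum (fun s => f s * entry x y W e s (inord i, inord j))) sum_entry /=.
rewrite -!up -?dn // !inordK // => H.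
exact: toC_sum H.
Qed.

Definition chi2 (l k : T) : CR := chi p l.1 k.1 * chi q l.2 k.2.

Definition Fourier : 'M[CR]_#|T| := \matrix_(a, b) chi2 (enum_val a) (enum_val b).

(** Orthogonality of the characters in each variable; it makes [Fourier] invertible. *)
Lemma Fourier_adj :
  Fourier *m map_mx conjc Fourier^T = ((p.+1)%:R * (q.+1)%:R)%:M.
Proof.
apply/matrixP => a b; rewrite !mxE.
rewrite (eq_bigr (fun c => chi2 (enum_val a) (enum_val c) * conjc (chi2 (enum_val b) (enum_val c))));
  last by move=> c _; rewrite !mxE.
rewrite (sum_enum (fun s => chi2 (enum_val a) s * conjc (chi2 (enum_val b) s))).
rewrite -(inj_eq enum_val_inj).
case: (enum_val a) (enum_val b) => [l1 l2] [m1 m2].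
transitivity (\sum_i \sum_j chi2 (l1, l2) (i, j) * conjc (chi2 (m1, m2) (i, j))).
  by rewrite pair_bigA; apply: eq_bigr => -[i j] _.
rewrite xpair_eqE mulrb_and -!chi_orth big_distrl; apply: eq_bigr => i _.
rewrite big_distrr; apply: eq_bigr => j _.
by rewrite /chi2 (rmorphM conjc) mulrACA.
Qed.

Lemma det_Fourier : \det Fourier != 0.
Proof.
have /(congr1 determinant) := Fourier_adj.
rewrite det_mulmx det_scalar => E; apply/eqP => E0; move: E; rewrite E0 mul0r.
by move/esym/eqP; rewrite expf_eq0 mulf_eq0 !pnatr_eq0 /= andbF.
Qed.

Definition free_value x y e (l : T) : CR :=
  Complex (free_ev p.+1 q.+1 l.1 l.2 x y - e)%coqR 0%coqR.

Lemma free_eigen x y e (l : T) :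
  ex (- (2 * PI * INR l.1 / INR p.+1))%coqR * ex (- x)%coqR
  + ex (2 * PI * INR l.1 / INR p.+1)%coqR * ex x
  + ex (- (2 * PI * INR l.2 / INR q.+1))%coqR * ex (- y)%coqR
  + ex (2 * PI * INR l.2 / INR q.+1)%coqR * ex y + Complex (0 - e)%coqR 0%coqR =
  free_value x y e l.
Proof.
rewrite -!exD /free_value /free_ev.
set a := (2 * PI * INR l.1 / INR p.+1)%coqR; set b := (2 * PI * INR l.2 / INR q.+1)%coqR.
rewrite -!Ropp_plus_distr /ex !cos_neg !sin_neg !(Rplus_comm a) !(Rplus_comm b).
apply/eqP; rewrite eq_complex /=; apply/andP; split; apply/eqP.
  by change (cos (x + a) + cos (x + a) + cos (y + b) + cos (y + b) + (0 - e) =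
    2 * cos (x + a) + 2 * cos (y + b) - e)%coqR; ring.
by change (- sin (x + a) + sin (x + a) + - sin (y + b) + sin (y + b) + 0 = 0)%coqR; ring.
Qed.

(** Each row of [Fourier] is a plane wave, a left eigenvector of the free matrix, because [chiS] and
    [chi_pred] turn shifts into phases. *)
Lemma Fourier_eigen x y e :
  Fourier *m Hmat x y (fun _ _ => 0%coqR) e =
  diag_mx (\row_(a < #|T|) free_value x y e (enum_val a))
  *m Fourier.
Proof.
apply/matrixP => a b; rewrite mul_diag_mx !mxE.
rewrite (eq_bigr (fun c => chi2 (enum_val a) (enum_val c) *
  entry x y (fun _ _ => 0%coqR) e (enum_val c) (enum_val b))); last by move=> c _; rewrite !mxE.
rewrite (sum_enum (fun s => chi2 (enum_val a) s * entry x y (fun _ _ => 0%coqR) e s (enum_val b))).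
rewrite sum_entry /chi2 /= !chiS !chi_pred -free_eigen.
exact: factor_eigen.
Qed.

(** Take determinants in [Fourier_eigen] and cancel the nonzero determinant of [Fourier]. *)
Lemma det_Hmat_free x y e :
  \det (Hmat x y (fun _ _ => 0%coqR) e) = Complex (free_det p.+1 q.+1 x y e) 0%coqR.
Proof.
have /(congr1 determinant) := Fourier_eigen x y e.
rewrite !det_mulmx mulrC => /(mulIf det_Fourier) ->; rewrite det_diag.
rewrite (eq_bigr (fun a => free_value x y e (enum_val a))); last by move=> a _; rewrite mxE.
rewrite (prod_enum (free_value x y e)).
transitivity (\prod_(i < p.+1) \prod_(j < q.+1) free_value x y e (i, j)).
  by rewrite pair_bigA; apply: eq_bigr => -[i j] _.
have prodC n (g : 'I_n -> R) : \prod_i Complex (g i) 0%coqR = Complex (\prod_i g i) 0%coqR :> CR.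
  elim/big_rec2: _ => // i z1 z2 _ ->.
  by apply/eqP; rewrite eq_complex /= !mul0r !mulr0 subr0 addr0 !eqxx.
rewrite /free_det nprod_big -prodC; apply: eq_bigr => i _.
by rewrite nprod_big -prodC; apply: eq_bigr.
Qed.

Lemma clim_entry {X} (F : (X -> Prop) -> Prop) {FF : Filter F} (x y e : X -> R)
    (W : X -> nat -> nat -> R) x0 y0 e0 W0 (s' s : T) :
  rlim F x x0 -> rlim F y y0 -> rlim F e e0 ->
  (forall i j, rlim F (fun t => W t i j) (W0 i j)) ->
  clim F (fun t => entry (x t) (y t) (W t) (e t) s' s) (entry x0 y0 W0 e0 s' s).
Proof.
move=> hx hy he hW.
by repeat apply: clim_add; apply: clim_mulrb;
  first [apply: clim_ex; first [done | exact: rlim_opp] |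
         apply: clim_real; apply: rlim_plus => //; exact: rlim_opp].
Qed.

Lemma clim_det_Hmat {X} (F : (X -> Prop) -> Prop) {FF : Filter F} (x y e : X -> R)
    (W : X -> nat -> nat -> R) x0 y0 e0 W0 :
  rlim F x x0 -> rlim F y y0 -> rlim F e e0 ->
  (forall i j, rlim F (fun t => W t i j) (W0 i j)) ->
  rlim F (fun t => Re (\det (Hmat (x t) (y t) (W t) (e t)))) (Re (\det (Hmat x0 y0 W0 e0))).
Proof.
move=> hx hy he hW; apply: (proj1 (clim_det _ _ _ _ _)) => a b.
have -> : (fun t => Hmat (x t) (y t) (W t) (e t) a b) =
    (fun t => entry (x t) (y t) (W t) (e t) (enum_val a) (enum_val b)).
  by apply: functional_extensionality => t; rewrite mxE.
by rewrite mxE; apply: clim_entry.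
Qed.

Lemma stable_sign_change_succ : stable_sign_change p.+1 q.+1.
Proof.
apply: (stable_sign_change_of_det _ _ (fun x y W e => Re (\det (Hmat x y W e)))).
- move=> W e x1 y1 x2 y2 t.
  have aff (a b : R) : rlim (locally t) (fun t => a + t * b)%coqR (a + t * b)%coqR.
    apply: rlim_plus; first exact: rlim_const.
    by apply: rlim_mult; [apply: filterlim_id | apply: rlim_const].
  by apply: clim_det_Hmat; rewrite ?/(rlim _ _ _) //; try exact: aff; move=> *; exact: rlim_const.
- move=> x y e0; apply: (clim_det_Hmat _ (fun=> x) (fun=> y) snd fst).
  + exact: rlim_const.
  + exact: rlim_const.
  + exact: rlim_energy.
  + exact: rlim_pot.
- by move=> x y e; rewrite det_Hmat_free.
- move=> x y W e E; apply: det_Hmat_kernel.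
  by apply/eqP; rewrite eq_complex /= det_Hmat_real E !eqxx.
Qed.
End Cell.
End CellDeterminant.

Lemma stable_sign_change_cell p q : (0 < p)%nat -> (0 < q)%nat -> stable_sign_change p q.
Proof.
  destruct p as [|p], q as [|q]; intros Hp Hq; try lia.
  apply CellDeterminant.stable_sign_change_succ.
Qed.

Theorem theorem1p1 (p q : Z) (hp : (0 < p)%Z) (hq : (0 < q)%Z) :
  exists C : R, 0 < C /\
    (forall V : (Z * Z)%type -> R, periodic p q V ->
       (forall x, Rabs (V x) <= C) ->
       at_most_two_components (spectrum V)) /\
    ((Z.odd p = true \/ Z.odd q = true) ->
     forall V : (Z * Z)%type -> R, periodic p q V ->
       (forall x, Rabs (V x) <= C) ->
       exists a b : R, a <= b /\
         forall z : Cx, spectrum V z <-> (snd z = 0 /\ a <= fst z <= b)).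
Proof.
  apply discrete_bethe_sommerfeld; [assumption | assumption | ].
  apply stable_sign_change_cell; lia.
Qed.
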